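(* Let $Q$ be a finite quiver without oriented cycles, let $x$ be a source of $Q$, and let $Q'$ be the quiver obtained from $Q$ by a BGP reflection at $x$, that is, by reversing all arrows starting at $x$. Then the posets $\mathcal{T}_Q$ and $\mathcal{T}_{Q'}$ are related via a flip-flop.
   Context: Fix a field $k$. For a finite quiver $Q$ without oriented cycles, $\operatorname{rep} Q$ is the category of finite-dimensional representations of $Q$ over $k$, and $\mathcal{D}^b(Q)$ is its bounded derived category. An object $T \in \operatorname{rep} Q$ is a tilting module if $\operatorname{Ext}^i(T,T)=0$ for all $i>0$ and the direct summands of $T$ generate $\mathcal{D}^b(Q)$ as a triangulated category; it is basic if its indecomposable summands are pairwise non-isomorphic. $\mathcal{T}_Q$ is the set of (isomorphism classes of) basic tilting modules in $\operatorname{rep} Q$, partially ordered by $T \leq T'$ iff $T^{\perp} \supseteq T'^{\perp}$, where $T^{\perp} = \{ M \in \operatorname{rep} Q : \operatorname{Ext}^i(T,M)=0 \text{ for all } i>0\}$ (equivalently, $T\le T'$ iff $\operatorname{Ext}^i(T,T')=0$ for all $i>0$). Flip-flop: for posets $(X,\leq_X)$, $(Y,\leq_Y)$ and an order-preserving function $f : X \to Y$, define partial orders $\leq^f_+$ and $\leq^f_-$ on the disjoint union $X \sqcup Y$ by keeping the original orders inside $X$ and $Y$ and setting, for $x\in X$, $y \in Y$, $x \leq^f_{+} y \Leftrightarrow f(x) \leq_Y y$, respectively $y \leq^f_{-} x \Leftrightarrow y \leq_Y f(x)$, with no other additional order relations. Two posets $Z$ and $Z'$ are related via a flip-flop if there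 exist $X$, $Y$ and an order-preserving $f: X \to Y$ such that $Z \simeq (X \sqcup Y, \leq^f_{+})$ and $Z' \simeq (X \sqcup Y, \leq^f_{-})$ as posets. *)

(* Defs.v *)
From HB Require Import structures.
From Stdlib Require Relation_Definitions.
From mathcomp Require Import all_boot all_algebra.

Set Implicit Arguments.
Unset Strict Implicit.
Unset Printing Implicit Defensive.

Import GRing.Theory.
Local Open Scope ring_scope.

Record quiver := Quiver {
  vertex : finType;
  arrow : finType;
  src : arrow -> vertex;
  tgt : arrow -> vertex }.

(* A loop [a] gives the cycle [:: a]. *)
Definition acyclic (Q : quiver) : Prop :=
  forall c : seq (arrow Q),
    c != [::] -> ~~ cycle (fun a b : arrow Q => tgt a == src b) c.

Definition is_source (Q : quiver) (x : vertex Q) : Prop :=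
  forall a : arrow Q, tgt a != x.

(* Reverses the arrows starting at [x] and keeps all the others. *)
Definition reflection (Q : quiver) (x : vertex Q) : quiver :=
  {| vertex := vertex Q;
     arrow := arrow Q;
     src := fun a => if src a == x then tgt a else src a;
     tgt := fun a => if src a == x then src a else tgt a |}.

Record rep (k : fieldType) (Q : quiver) := Rep {
  space :> vertex Q -> vectType k;
  rmap : forall a : arrow Q, 'Hom(space (src a), space (tgt a)) }.

Record hom (k : fieldType) (Q : quiver) (M N : rep k Q) := Hom {
  hom_at :> forall v : vertex Q, 'Hom(M v, N v);
  hom_rmap : forall (a : arrow Q) (u : M (src a)),
    hom_at (tgt a) (rmap M a u) = rmap N a (hom_at (src a) u) }.

Definition epi (k : fieldType) (Q : quiver) (M N : rep k Q) (f : hom M N) :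
    Prop :=
  forall v (y : N v), exists x : M v, f v x = y.

Definition iso (k : fieldType) (Q : quiver) (M N : rep k Q) : Prop :=
  exists (f : hom M N) (g : hom N M),
    forall v, cancel (f v) (g v) /\ cancel (g v) (f v).

Definition is_zero (k : fieldType) (Q : quiver) (M : rep k Q) : Prop :=
  forall v (x : M v), x = 0.

Definition zero_rep (k : fieldType) (Q : quiver) : rep k Q :=
  {| space := fun=> 'rV[k]_0; rmap := fun=> 0 |}.

Lemma zero_hom_subproof (k : fieldType) (Q : quiver) (M N : rep k Q)
    (a : arrow Q) (u : M (src a)) :
  (0 : 'Hom(M (tgt a), N (tgt a))) (rmap M a u) =
  rmap N a ((0 : 'Hom(M (src a), N (src a))) u).
Proof. by rewrite !lfunE linear0. Qed.

Definition zero_hom (k : fieldType) (Q : quiver) (M N : rep k Q) : hom M N :=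
  {| hom_at := fun=> 0; hom_rmap := @zero_hom_subproof k Q M N |}.

Definition pair_lfun (k : fieldType) (W V1 V2 : vectType k)
    (f : 'Hom(W, V1)) (g : 'Hom(W, V2)) : 'Hom(W, (V1 * V2)%type) :=
  linfun (fun w => (f w, g w)).

Definition fst_lfun (k : fieldType) (V1 V2 : vectType k) :
  'Hom((V1 * V2)%type, V1) := linfun (fun w : V1 * V2 => w.1).

Definition snd_lfun (k : fieldType) (V1 V2 : vectType k) :
  'Hom((V1 * V2)%type, V2) := linfun (fun w : V1 * V2 => w.2).

(* [lfunE] needs a canonical linear structure, built here by hand. *)
Lemma linfun_apply (k : fieldType) (U V : vectType k) (f : U -> V) :
  linear f -> linfun f =1 f.
Proof.
move=> lf x; pose fL := GRing.isLinear.Build k U V *:%R f lf.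
by rewrite (lfunE (HB.pack_for {linear U -> V} f fL)).
Qed.

Lemma pair_lfunE (k : fieldType) (W V1 V2 : vectType k)
    (f : 'Hom(W, V1)) (g : 'Hom(W, V2)) (w : W) :
  pair_lfun f g w = (f w, g w).
Proof. by rewrite linfun_apply // => a u v; rewrite !linearP. Qed.

Lemma fst_lfunE (k : fieldType) (V1 V2 : vectType k) (w : V1 * V2) :
  fst_lfun V1 V2 w = w.1.
Proof. by rewrite linfun_apply. Qed.

Lemma snd_lfunE (k : fieldType) (V1 V2 : vectType k) (w : V1 * V2) :
  snd_lfun V1 V2 w = w.2.
Proof. by rewrite linfun_apply. Qed.

Definition dsum (k : fieldType) (Q : quiver) (M N : rep k Q) : rep k Q :=
  {| space := fun v => (M v * N v)%type;
     rmap := fun a => pair_lfun (rmap M a \o fst_lfun _ _)%VF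
                                (rmap N a \o snd_lfun _ _)%VF |}.

Lemma dsum_rmapE (k : fieldType) (Q : quiver) (M N : rep k Q) (a : arrow Q)
    (u : dsum M N (src a)) :
  rmap (dsum M N) a u = (rmap M a u.1, rmap N a u.2).
Proof. by rewrite /= pair_lfunE !comp_lfunE fst_lfunE snd_lfunE. Qed.

Definition is_summand (k : fieldType) (Q : quiver) (M T : rep k Q) : Prop :=
  exists N : rep k Q, iso T (dsum M N).

Definition indecomposable (k : fieldType) (Q : quiver) (M : rep k Q) : Prop :=
  ~ is_zero M /\
  forall A B : rep k Q, iso M (dsum A B) -> is_zero A \/ is_zero B.

Definition projective (k : fieldType) (Q : quiver) (P : rep k Q) : Prop :=
  forall (A B : rep k Q) (g : hom A B) (f : hom P B),
    epi g -> exists h : hom P A, forall v x, g v (h v x) = f v x.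

(* [... -> P 2 -> P 1 -> P 0 -> M -> 0] *)
Record proj_resolution (k : fieldType) (Q : quiver) (M : rep k Q) :=
  ProjResolution {
    res_obj :> nat -> rep k Q;
    res_d : forall n, hom (res_obj n.+1) (res_obj n);
    res_aug : hom (res_obj 0%N) M;
    res_proj : forall n, projective (res_obj n);
    res_aug_epi : epi res_aug;
    res_exact0 : forall v (x : res_obj 0%N v),
      res_aug v x = 0 <-> exists y, res_d 0%N v y = x;
    res_exactS : forall n v (x : res_obj n.+1 v),
      res_d n v x = 0 <-> exists y, res_d n.+1 v y = x }.

(* [Ext^(n+1)(M, N) = 0]: for a projective resolution [P] of [M], the complex
   [Hom(P, N)] is exact in degree [n+1]. The choice of [P] is immaterial; when
   [Q] is acyclic, [rep Q] has enough projectives, so that some [P] exists. *)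
Definition ExtS_zero (k : fieldType) (Q : quiver) (n : nat) (M N : rep k Q) :
    Prop :=
  forall (P : proj_resolution M) (f : hom (P n.+1) N),
    (forall v x, f v (res_d P n.+1 v x) = 0) ->
    exists g : hom (P n) N, forall v x, f v x = g v (res_d P n v x).

Definition Ext_pos_zero (k : fieldType) (Q : quiver) (M N : rep k Q) : Prop :=
  forall n : nat, ExtS_zero n M N.

(* Cochain complexes of representations. The objects of the bounded derived
   category of [rep Q] are the bounded ones. *)
Record cplx (k : fieldType) (Q : quiver) := Cplx {
  cobj :> int -> rep k Q;
  cdiff : forall i : int, hom (cobj i) (cobj (i + 1));
  cdiff2 : forall (i : int) v (x : cobj i v),
    cdiff (i + 1) v (cdiff i v x) = 0 }.

Definition bounded (k : fieldType) (Q : quiver) (X : cplx k Q) : Prop :=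
  exists n : nat, forall i : int, (n < `|i|)%N -> is_zero (X i).

Record chain_map (k : fieldType) (Q : quiver) (X Y : cplx k Q) := ChainMap {
  cm_at :> forall i : int, hom (X i) (Y i);
  cm_comm : forall (i : int) v (x : X i v),
    cm_at (i + 1) v (cdiff X i v x) = cdiff Y i v (cm_at i v x) }.

(* The induced map on cohomology is injective and surjective in each degree;
   every degree is of the form [i + 1]. *)
Definition quasi_iso (k : fieldType) (Q : quiver) (X Y : cplx k Q)
    (f : chain_map X Y) : Prop :=
  forall (i : int) v,
    (forall x : X (i + 1) v, cdiff X (i + 1) v x = 0 ->
       (exists y : Y i v, cdiff Y i v y = f (i + 1) v x) ->
       exists x' : X i v, cdiff X i v x' = x) /\
    (forall y : Y (i + 1) v, cdiff Y (i + 1) v y = 0 ->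
       exists (x : X (i + 1) v) (y' : Y i v),
         cdiff X (i + 1) v x = 0 /\ y = f (i + 1) v x + cdiff Y i v y').

Lemma stalk_subproof (k : fieldType) (Q : quiver) (F : int -> rep k Q)
    (i : int) v (x : F i v) :
  zero_hom (F (i + 1)) (F (i + 1 + 1)) v (zero_hom (F i) (F (i + 1)) v x) = 0.
Proof. by rewrite lfunE. Qed.

(* [M] as a complex concentrated in degree 0. *)
Definition stalk (k : fieldType) (Q : quiver) (M : rep k Q) : cplx k Q :=
  let F := fun i : int => if i == 0 then M else zero_rep k Q in
  {| cobj := F;
     cdiff := fun i => zero_hom (F i) (F (i + 1));
     cdiff2 := stalk_subproof (F := F) |}.

Lemma opp_hom_subproof (k : fieldType) (Q : quiver) (M N : rep k Q)
    (f : hom M N) (a : arrow Q) (u : M (src a)) :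
  (- f (tgt a)) (rmap M a u) = rmap N a ((- f (src a)) u).
Proof. by rewrite !lfunE /= hom_rmap linearN. Qed.

Definition opp_hom (k : fieldType) (Q : quiver) (M N : rep k Q) (f : hom M N) :
    hom M N :=
  {| hom_at := fun v => - f v; hom_rmap := opp_hom_subproof f |}.

Lemma shift_subproof (k : fieldType) (Q : quiver) (X : cplx k Q) (i : int) v
    (x : X (i + 1) v) :
  opp_hom (cdiff X (i + 1 + 1)) v (opp_hom (cdiff X (i + 1)) v x) = 0.
Proof. by rewrite /= !opp_lfunE linearN /= cdiff2 !oppr0. Qed.

(* [X[1]] *)
Definition shift (k : fieldType) (Q : quiver) (X : cplx k Q) : cplx k Q :=
  {| cobj := fun i => X (i + 1);
     cdiff := fun i => opp_hom (cdiff X (i + 1));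
     cdiff2 := @shift_subproof k Q X |}.

Definition cone_diff_at (k : fieldType) (Q : quiver) (X Y : cplx k Q)
    (f : chain_map X Y) (i : int) (v : vertex Q) :
    'Hom(dsum (X (i + 1)) (Y i) v, dsum (X (i + 1 + 1)) (Y (i + 1)) v) :=
  pair_lfun ((- cdiff X (i + 1) v) \o fst_lfun _ _)%VF
            ((f (i + 1) v \o fst_lfun _ _)%VF + (cdiff Y i v \o snd_lfun _ _)%VF).

Lemma cone_diff_atE (k : fieldType) (Q : quiver) (X Y : cplx k Q)
    (f : chain_map X Y) (i : int) v (u : dsum (X (i + 1)) (Y i) v) :
  cone_diff_at f i v u =
  (- cdiff X (i + 1) v u.1, f (i + 1) v u.1 + cdiff Y i v u.2).
Proof.
by rewrite pair_lfunE add_lfunE !comp_lfunE fst_lfunE snd_lfunE opp_lfunE.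
Qed.

Lemma cone_diff_rmap (k : fieldType) (Q : quiver) (X Y : cplx k Q)
    (f : chain_map X Y) (i : int) (a : arrow Q)
    (u : dsum (X (i + 1)) (Y i) (src a)) :
  cone_diff_at f i (tgt a) (rmap (dsum (X (i + 1)) (Y i)) a u) =
  rmap (dsum (X (i + 1 + 1)) (Y (i + 1))) a (cone_diff_at f i (src a) u).
Proof.
by rewrite cone_diff_atE !dsum_rmapE cone_diff_atE /= !hom_rmap linearN linearD.
Qed.

Definition cone_diff (k : fieldType) (Q : quiver) (X Y : cplx k Q)
    (f : chain_map X Y) (i : int) :
    hom (dsum (X (i + 1)) (Y i)) (dsum (X (i + 1 + 1)) (Y (i + 1))) :=
  {| hom_at := cone_diff_at f i; hom_rmap := @cone_diff_rmap k Q X Y f i |}.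

Lemma cone_subproof (k : fieldType) (Q : quiver) (X Y : cplx k Q)
    (f : chain_map X Y) (i : int) v (u : dsum (X (i + 1)) (Y i) v) :
  cone_diff f (i + 1) v (cone_diff f i v u) = 0.
Proof.
rewrite /= !cone_diff_atE; case: u => x y /=.
by rewrite linearD /= cdiff2 addr0 !linearN /= cdiff2 !oppr0 cm_comm addNr.
Qed.

Definition cone (k : fieldType) (Q : quiver) (X Y : cplx k Q)
    (f : chain_map X Y) : cplx k Q :=
  {| cobj := fun i => dsum (X (i + 1)) (Y i);
     cdiff := cone_diff f;
     cdiff2 := @cone_subproof k Q X Y f |}.

(* Strictly full triangulated subcategories of the bounded derived category,
   as classes of bounded complexes. Isomorphisms in the derived category are
   zigzags of quasi-isomorphisms, and a morphism is a roof [X <- X' -> Y] with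
   left leg a quasi-isomorphism; so every distinguished triangle is isomorphic
   to the one given by the cone of a chain map [X' -> Y]. *)
Record triangulated_subcat (k : fieldType) (Q : quiver)
    (C : cplx k Q -> Prop) : Prop := {
  tri_zero : C (stalk (zero_rep k Q));
  tri_qis : forall (X Y : cplx k Q) (f : chain_map X Y),
    bounded X -> bounded Y -> quasi_iso f -> (C X <-> C Y);
  tri_shift : forall X : cplx k Q, bounded X -> (C X <-> C (shift X));
  tri_cone : forall (X Y : cplx k Q) (f : chain_map X Y),
    bounded X -> bounded Y -> C X -> C Y -> C (cone f) }.

Definition generates_Db (k : fieldType) (Q : quiver) (S : rep k Q -> Prop) :
    Prop :=
  forall C : cplx k Q -> Prop,
    triangulated_subcat C -> (forall M, S M -> C (stalk M)) ->
    forall X, bounded X -> C X.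

Definition tilting (k : fieldType) (Q : quiver) (T : rep k Q) : Prop :=
  Ext_pos_zero T T /\ generates_Db (fun M => is_summand M T).

Definition basic (k : fieldType) (Q : quiver) (T : rep k Q) : Prop :=
  forall s : seq (rep k Q),
    (forall i, (i < size s)%N -> indecomposable (nth (zero_rep k Q) s i)) ->
    iso T (foldr (@dsum k Q) (zero_rep k Q) s) ->
    forall i j, (i < j < size s)%N ->
      ~ iso (nth (zero_rep k Q) s i) (nth (zero_rep k Q) s j).

Definition perp (k : fieldType) (Q : quiver) (T M : rep k Q) : Prop :=
  Ext_pos_zero T M.

(* The elements are the isomorphism classes of basic tilting modules, each
   class being the predicate [iso T] for some [T]. *)
Definition tilting_class (k : fieldType) (Q : quiver) : Type :=
  {C : rep k Q -> Prop |
    exists T, [/\ tilting T, basic T & C = (fun M => iso T M)]}.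

Definition tilting_le (k : fieldType) (Q : quiver)
    (C C' : tilting_class k Q) : Prop :=
  exists T T' : rep k Q, [/\ sval C T, sval C' T' &
    forall M, perp T' M -> perp T M].

(* Posets are types with a [Prop]-valued [order] relation rather than
   [porderType]s: [tilting_class] quantifies over [vectType]s, and so lives in
   too large a universe to carry a [porderType] structure. *)
Definition flip_plus (X Y : Type) (leX : X -> X -> Prop) (leY : Y -> Y -> Prop)
    (f : X -> Y) (u w : X + Y) : Prop :=
  match u, w with
  | inl x, inl x' => leX x x'
  | inr y, inr y' => leY y y'
  | inl x, inr y => leY (f x) y
  | inr _, inl _ => False
  end.

Definition flip_minus (X Y : Type) (leX : X -> X -> Prop) (leY : Y -> Y -> Prop)
    (f : X -> Y) (u w : X + Y) : Prop :=
  match u, w with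
  | inl x, inl x' => leX x x'
  | inr y, inr y' => leY y y'
  | inl _, inr _ => False
  | inr y, inl x => leY y (f x)
  end.

Definition order_iso (Z W : Type) (leZ : Z -> Z -> Prop)
    (leW : W -> W -> Prop) : Prop :=
  exists h : Z -> W, bijective h /\ forall z z', leZ z z' <-> leW (h z) (h z').

(* When this holds, [leZ] and [leZ'] are partial orders, being isomorphic to
   [flip_plus leX leY f] and [flip_minus leX leY f]. *)
Definition related_by_flip_flop (Z Z' : Type) (leZ : Z -> Z -> Prop)
    (leZ' : Z' -> Z' -> Prop) : Prop :=
  exists (X Y : Type) (leX : X -> X -> Prop) (leY : Y -> Y -> Prop)
      (f : X -> Y),
    [/\ Relation_Definitions.order X leX /\ Relation_Definitions.order Y leY,
        forall x x', leX x x' -> leY (f x) (f x'),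
        order_iso leZ (flip_plus leX leY f) &
        order_iso leZ' (flip_minus leX leY f)].

(* Main.v *)
From HB Require Import structures.
From Stdlib Require Import Classical ClassicalEpsilon.
From Stdlib Require Import FunctionalExtensionality PropExtensionality.
From Stdlib Require Import ProofIrrelevance.
From Stdlib Require List Relation_Definitions.
From mathcomp Require Import all_boot all_algebra zify.
Require Import Defs.

(** The algebra kQ is hereditary, so everything can be phrased in terms of Hom
    and Ext^1, and Ext^1(M, N) is the cokernel of an explicit linear map. A
    module T with Ext^1(T, T) = 0 generates the derived category if and only if
    no nonzero M satisfies Hom(T, M) = Ext^1(T, M) = 0: the complexes X with
    RHom(X, M) = 0 form a triangulated subcategory, and conversely every module
    is built from T by a universal extension followed by a T-resolution of
    length one. By the Krull-Schmidt theorem the poset of tilting classes is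
    the poset of equivalence classes of the preorder Ext^1(T, T') = 0 on all
    tilting modules.

    Let x be a source, S the simple module at x, and j the inclusion of Q \ x.
    Restriction j^* sends tilting modules to tilting modules, and so does
    U |-> S + j_* U in the other direction. The image of the latter consists of
    the T with Ext^1(S, T) = 0, and
      Ext^1(T, S + j_* U) = 0  iff  Ext^1(j^* T, U) = 0.
    At a sink the same holds for S + j_! U with all arguments exchanged. If
    Ext^1(S, T) <> 0, then T(x) embeds in the product of the T(y) over the
    arrows x -> y; replacing T(x) by the cokernel gives the tilting modules of
    the reflected quiver with Ext^1(T', S) <> 0, and both Hom and Ext^1 on the
    two sides are expressed by the same short exact sequences. Hence both posets
    are obtained from f = j^* : X -> Y, where X consists of the T with
    Ext^1(S, T) <> 0 and Y of the tilting classes of Q \ x. *)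

Set Implicit Arguments.
Unset Strict Implicit.
Unset Printing Implicit Defensive.

Import GRing.Theory Num.Theory.
Local Open Scope ring_scope.

(** * Identities in abelian groups *)

(** The standard resolution of length one turns RHom(X, M) into the total complex of a double
    complex with two rows, so the arguments are linear algebra over the vertices and arrows.
    Projective resolutions only serve to match [Ext_pos_zero] with the linear condition
    [ext1_vanish], and acyclicity is used there.

    Restriction j^* may make non-isomorphic summands isomorphic, so it does not preserve basic
    modules. All constructions therefore take place in the preorder of arbitrary tilting modules,
    and representatives of classes are chosen only when the posets are compared.

    Reflection functors lose the simple module S, which is why the matching is confined to the T
    with Ext^1(S, T) nonzero. For these T(x) embeds: a vector of T(x) killed by all arrows would
    make S a submodule of T, and Ext^1(-, T), being right exact, would then vanish on S together
    with Ext^1(T, T). *)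

Inductive zterm :=
  | ZVar of nat | ZZero | ZAdd of zterm & zterm | ZOpp of zterm.

Fixpoint zcoef (t : zterm) (i : nat) : int :=
  match t with
  | ZVar j => (i == j)%:Z
  | ZZero => 0
  | ZAdd t1 t2 => zcoef t1 i + zcoef t2 i
  | ZOpp t1 => - zcoef t1 i
  end.

Fixpoint zeval (V : zmodType) (e : seq V) (t : zterm) : V :=
  match t with
  | ZVar j => e`_j
  | ZZero => 0
  | ZAdd t1 t2 => zeval e t1 + zeval e t2
  | ZOpp t1 => - zeval e t1
  end.

Lemma zevalE (V : zmodType) (e : seq V) t :
  zeval e t = \sum_(i < size e) e`_i *~ zcoef t i.
Proof.
elim: t => /= [j||t1 -> t2 ->|t ->].
- have [lj|gj] := ltnP j (size e).
    rewrite (bigD1 (Ordinal lj)) //= eqxx big1 ?addr0 // => i.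
    by rewrite -val_eqE /= => /negPf->.
  rewrite nth_default // big1 // => i _; rewrite (_ : (i == j :> nat) = false) //.
  by apply/negbTE; rewrite neq_ltn (leq_trans (ltn_ord i) gj).
- by rewrite big1.
- by rewrite -big_split; apply: eq_bigr => i _; rewrite mulrzDr.
- by rewrite -sumrN; apply: eq_bigr => i _; rewrite mulrNz.
Qed.

(** Variables beyond [size e] evaluate to the default 0 of [nth], so comparing the coefficients
    below [size e] suffices. The premise is decided by computation. *)
Lemma zeval_eq (V : zmodType) (e : seq V) t1 t2 :
  all (fun i => zcoef t1 i == zcoef t2 i) (iota 0 (size e)) ->
  zeval e t1 = zeval e t2.
Proof.
move/allP=> h; rewrite !zevalE; apply: eq_bigr => i _; congr (_ *~ _).
by apply/eqP/h; rewrite mem_iota /=.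
Qed.

(** The inner [match goal] lets [unify] run while a term is being built. Atoms are compared up to
    unification, since equal vectors may carry convertible but different types. *)
Ltac zmod_index e x :=
  match e with
  | ?y :: _ => let _ := match goal with _ => unify x y end in constr:(0%N)
  | _ :: ?e' => let n := zmod_index e' x in constr:(n.+1)
  end.
Ltac zmod_mem e x :=
  match e with
  | nil => constr:(false)
  | ?y :: _ => let _ := match goal with _ => unify x y end in constr:(true)
  | _ :: ?e' => zmod_mem e' x
  end.
Ltac zmod_atoms e t :=
  lazymatch t with
  | (?a + ?b)%R => let e1 := zmod_atoms e a in zmod_atoms e1 b
  | (- ?a)%R => zmod_atoms e a
  | 0%R => e
  | _ => let m := zmod_mem e t in
    lazymatch m with true => e | false => constr:(t :: e) end
  end.
Ltac zmod_reify e t :=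
  lazymatch t with
  | (?a + ?b)%R =>
      let x := zmod_reify e a in let y := zmod_reify e b in constr:(ZAdd x y)
  | (- ?a)%R => let x := zmod_reify e a in constr:(ZOpp x)
  | 0%R => constr:(ZZero)
  | _ => let n := zmod_index e t in constr:(ZVar n)
  end.
Ltac zmod :=
  lazymatch goal with
  | |- @eq ?V ?a ?b =>
    let e0 := zmod_atoms (@nil V) a in
    let e := zmod_atoms e0 b in
    let x := zmod_reify e a in
    let y := zmod_reify e b in
    exact: (@zeval_eq _ e x y erefl)
  end.

Lemma subr_transfer (V : zmodType) (a b c d : V) :
  a = b -> c - d = a - b -> c = d.
Proof. by move=> -> /eqP; rewrite subrr subr_eq0 => /eqP. Qed.

(** For goals that differ from [E], or from its mirror image, by an identity of abelian groups. *)
Ltac zmod_from E :=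
  first [apply: (subr_transfer E); zmod | apply: (subr_transfer (esym E)); zmod].

(** * Hom and Ext^1 of representations *)

Section LfunLinear.
Variables (k : fieldType) (U V W : vectType k).

Lemma lfunD (f : 'Hom(U, V)) u v : f (u + v) = f u + f v.
Proof. exact: linearD. Qed.
Lemma lfunN (f : 'Hom(U, V)) u : f (- u) = - f u.
Proof. exact: linearN. Qed.
Lemma lfunB (f : 'Hom(U, V)) u v : f (u - v) = f u - f v.
Proof. exact: linearB. Qed.
Lemma lfun0 (f : 'Hom(U, V)) : f 0 = 0.
Proof. exact: linear0. Qed.
Lemma sub_lfunE (f g : 'Hom(U, V)) u : (f - g) u = f u - g u.
Proof. by rewrite add_lfunE opp_lfunE. Qed.
End LfunLinear.

Definition lfE := (sub_lfunE, add_lfunE, opp_lfunE, comp_lfunE, id_lfunE).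

Section LinearMaps.
Variables (k : fieldType) (U V W : vectType k).

(** [f^-1] picks preimages linearly on the image of [f]. It supplies the splittings used below: a
    retraction of an injective map, a section of a surjective one, and factorizations of maps that
    vanish on a kernel. *)
Lemma lfun_invK (f : 'Hom(U, V)) u : f (f^-1%VF (f u)) = f u.
Proof. by apply: limg_lfunVK; rewrite memv_img ?memvf. Qed.

Lemma lfun_inv_retract (f : 'Hom(U, V)) :
  (forall u, f u = 0 -> u = 0) -> cancel f f^-1%VF.
Proof.
move=> f0 u; apply/eqP; rewrite -subr_eq0; apply/eqP/f0.
by rewrite linearB /= lfun_invK subrr.
Qed.

Lemma lfun_inv_factor (f : 'Hom(U, V)) (g : 'Hom(U, W)) :
  (forall u, f u = 0 -> g u = 0) -> forall u, g (f^-1%VF (f u)) = g u.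
Proof.
move=> fg u; apply/eqP; rewrite -subr_eq0 -linearB; apply/eqP/fg.
by rewrite linearB /= lfun_invK subrr.
Qed.

Lemma lfun_inv_section (p : 'Hom(U, V)) y :
  (exists x, p x = y) -> p (p^-1%VF y) = y.
Proof. by case=> x <-; apply: lfun_invK. Qed.

Lemma lfunB0_inj (f : 'Hom(U, V)) u u' :
  (forall w, f w = 0 -> w = 0) -> f u = f u' -> u = u'.
Proof.
by move=> f0 fu; rewrite -[u](lfun_inv_retract f0) fu lfun_inv_retract.
Qed.

End LinearMaps.

Section SubQuotient.
Variables (k : fieldType) (V : vectType k) (U : {vspace V}).

Definition sub_incl : 'Hom(subvs_of U, V) := linfun vsval.
Definition sub_proj : 'Hom(V, subvs_of U) := linfun (vsproj U).
(** The quotient [V / U] is realized on the complement [U^C], where [subvs_of] provides a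
    [vectType]. *)
Definition quot_proj : 'Hom(V, subvs_of U^C%VS) :=
  linfun (fun w => vsproj U^C%VS (w - projv U w)).

Lemma sub_inclE u : sub_incl u = vsval u.
Proof. by rewrite linfun_apply. Qed.

Lemma sub_projK u : u \in U -> sub_incl (sub_proj u) = u.
Proof.
move=> uU; rewrite sub_inclE linfun_apply ?vsprojK //.
exact: vsproj_is_linear.
Qed.

Lemma sub_incl_mem u : sub_incl u \in U.
Proof. by rewrite sub_inclE subvsP. Qed.

Lemma sub_incl_inj u : sub_incl u = 0 -> u = 0.
Proof. by rewrite sub_inclE => u0; apply: subvs_inj; rewrite u0 linear0. Qed.

Lemma quot_projE w : vsval (quot_proj w) = w - projv U w.
Proof.
rewrite linfun_apply ?vsprojK ?memv_projC // => c x y.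
rewrite -vsproj_is_linear; congr vsproj.
by rewrite linearP scalerBr /=; zmod.
Qed.

Lemma quot_proj_eq0 w : quot_proj w = 0 <-> w \in U.
Proof.
split=> [q0|wU].
  have := quot_projE w; rewrite q0 linear0 => /esym/eqP; rewrite subr_eq0.
  by move/eqP->; apply: memv_proj.
by apply: subvs_inj; rewrite quot_projE projv_id // subrr linear0.
Qed.

Lemma quot_proj_surj y : exists w, quot_proj w = y.
Proof.
exists (vsval y); apply: subvs_inj; rewrite quot_projE.
have : vsval y \in lker (projv U) by rewrite lker_proj subvsP.
by rewrite memv_ker => /eqP->; rewrite subr0.
Qed.

End SubQuotient.

Section Homs.
Variables (k : fieldType) (Q : quiver).
Implicit Types A B C E M N T : rep k Q.

Definition mono A B (f : hom A B) := forall v u, f v u = 0 -> u = 0.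

Definition exact A B C (f : hom A B) (g : hom B C) :=
  forall v u, g v u = 0 <-> exists y, f v y = u.

Lemma id_hom_subproof M a (u : M (src a)) :
  \1%VF (rmap M a u) = rmap M a (\1%VF u).
Proof. by rewrite !id_lfunE. Qed.
Definition id_hom M : hom M M :=
  {| hom_at := fun v => \1%VF; hom_rmap := @id_hom_subproof M |}.

Lemma comp_hom_subproof A B C (g : hom B C) (f : hom A B) a (u : A (src a)) :
  (g (tgt a) \o f (tgt a))%VF (rmap A a u) =
  rmap C a ((g (src a) \o f (src a))%VF u).
Proof. by rewrite !comp_lfunE !hom_rmap. Qed.
Definition comp_hom A B C (g : hom B C) (f : hom A B) : hom A C :=
  {| hom_at := fun v => (g v \o f v)%VF; hom_rmap := comp_hom_subproof g f |}.

Lemma add_hom_subproof A B (g f : hom A B) a (u : A (src a)) :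
  (g (tgt a) + f (tgt a)) (rmap A a u) = rmap B a ((g (src a) + f (src a)) u).
Proof. by rewrite !add_lfunE !hom_rmap linearD. Qed.
Definition add_hom A B (g f : hom A B) : hom A B :=
  {| hom_at := fun v => g v + f v; hom_rmap := add_hom_subproof g f |}.

Lemma id_homE M v u : id_hom M v u = u. Proof. exact: id_lfunE. Qed.
Lemma comp_homE A B C (g : hom B C) (f : hom A B) v u :
  comp_hom g f v u = g v (f v u).
Proof. exact: comp_lfunE. Qed.
Lemma add_homE A B (g f : hom A B) v u : add_hom g f v u = g v u + f v u.
Proof. exact: add_lfunE. Qed.
Lemma opp_homE A B (f : hom A B) v u : opp_hom f v u = - f v u.
Proof. exact: opp_lfunE. Qed.
Lemma zero_homE A B v u : zero_hom A B v u = 0.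
Proof. exact: zero_lfunE. Qed.
Definition homE := (id_homE, comp_homE, add_homE, opp_homE, zero_homE).

Lemma iso_refl M : iso M M.
Proof. by exists (id_hom M), (id_hom M) => v; split=> u; rewrite !homE. Qed.

Lemma iso_sym M N : iso M N -> iso N M.
Proof. by case=> f [g fg]; exists g, f => v; case: (fg v). Qed.

Lemma iso_trans M N P : iso M N -> iso N P -> iso M P.
Proof.
case=> f [g fg] [f' [g' fg']]; exists (comp_hom f' f), (comp_hom g g') => v.
have [fK gK] := fg v; have [fK' gK'] := fg' v.
by split=> u; rewrite !homE ?fK' ?gK.
Qed.

(* [Ext^1(M, N)] is the cokernel of
   [\prod_v Hom(M v, N v) -> \prod_a Hom(M (src a), N (tgt a))]. *)
Definition ext1_vanish M N :=
  forall g : (forall a, 'Hom(M (src a), N (tgt a))),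
  exists f : (forall v, 'Hom(M v, N v)),
  forall a u, g a u = f (tgt a) (rmap M a u) - rmap N a (f (src a) u).

Definition hom_vanish M N := forall (f : hom M N) v u, f v u = 0.

(** The hereditary property: without Ext^2, Ext^1(-, N) is right exact, so its vanishing passes to
    subrepresentations. A cochain on [A] extends to [B] by a linear retraction, and the solution on
    [B] restricts. *)
Lemma ext1_mono A B N (i : hom A B) :
  mono i -> ext1_vanish B N -> ext1_vanish A N.
Proof.
move=> i0 BN g; have [f fE] := BN (fun a => (g a \o (i (src a))^-1)%VF).
exists (fun v => (f v \o i v)%VF) => a u; rewrite !comp_lfunE hom_rmap -fE.
by rewrite comp_lfunE lfun_inv_retract //; apply: i0.
Qed.

Lemma ext1_epi M A B (p : hom A B) :
  epi p -> ext1_vanish M A -> ext1_vanish M B.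
Proof.
move=> p1 MA g; have [f fE] := MA (fun a => ((p (tgt a))^-1 \o g a)%VF).
exists (fun v => (p v \o f v)%VF) => a u; rewrite !comp_lfunE -hom_rmap.
by rewrite -lfunB -fE comp_lfunE lfun_inv_section //; apply: p1.
Qed.

Lemma hom_vanish_mono M A B (i : hom A B) :
  mono i -> hom_vanish M B -> hom_vanish M A.
Proof.
by move=> i0 MB f v u; apply: (i0 v); have := MB (comp_hom i f) v u;
   rewrite homE.
Qed.

Lemma hom_vanish_epi A B N (p : hom A B) :
  epi p -> hom_vanish A N -> hom_vanish B N.
Proof.
move=> p1 AN f v u; have [w <-] := p1 v u.
by have := AN (comp_hom f p) v w; rewrite homE.
Qed.

(** The lift is only a family of linear maps. Its failure to commute with the arrows is a cochain
    with values in a kernel, to be removed by the vanishing of an Ext^1. *)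
Lemma epi_lift A B (W : vertex Q -> vectType k) (p : hom A B)
    (f : forall v, 'Hom(W v, B v)) : epi p ->
  exists f1 : (forall v, 'Hom(W v, A v)), forall v w, p v (f1 v w) = f v w.
Proof.
move=> p1; exists (fun v => ((p v)^-1 \o f v)%VF) => v w.
by rewrite comp_lfunE lfun_inv_section //; apply: p1.
Qed.

Lemma mono_extend A B (W : vertex Q -> vectType k) (i : hom A B)
    (f : forall v, 'Hom(A v, W v)) : mono i ->
  exists f1 : (forall v, 'Hom(B v, W v)), forall v w, f1 v (i v w) = f v w.
Proof.
move=> i0; exists (fun v => (f v \o (i v)^-1)%VF) => v w.
by rewrite comp_lfunE lfun_inv_retract //; apply: i0.
Qed.

(** * Pieces of the long exact sequences of Hom and Ext^1 *)

Section ShortExact.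
Variables (A B C : rep k Q) (i : hom A B) (p : hom B C).
Hypothesis ip : exact i p.

Lemma exact_comp0 v x : p v (i v x) = 0.
Proof. by apply/ip; exists x. Qed.

(** A solution modulo [A] is lifted vertexwise; the remaining defect lies in the image of [i] and is
    solved there. *)
Lemma ext1_middle_right M : epi p ->
  ext1_vanish M A -> ext1_vanish M C -> ext1_vanish M B.
Proof.
move=> p1 MA MC g.
have [f fE] := MC (fun a => (p (tgt a) \o g a)%VF).
have [f1 pf1] := epi_lift f p1.
pose g1 a : 'Hom(M (src a), B (tgt a)) :=
  g a - ((f1 (tgt a) \o rmap M a) - (rmap B a \o f1 (src a)))%VF.
have [h hE] := MA (fun a => ((i (tgt a))^-1 \o g1 a)%VF).
exists (fun v => f1 v + (i v \o h v)%VF) => a u.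
have : i (tgt a) ((i (tgt a))^-1%VF (g1 a u)) = g1 a u.
  apply: lfun_inv_section; apply/ip.
  rewrite !lfE !lfunB.
  by rewrite pf1 hom_rmap pf1 -fE comp_lfunE subrr.
have := hE a u; rewrite comp_lfunE => -> ig1.
rewrite !lfE lfunD -hom_rmap.
rewrite lfunB !lfE in ig1.
zmod_from ig1.
Qed.

Lemma ext1_middle_left N : mono i ->
  ext1_vanish A N -> ext1_vanish C N -> ext1_vanish B N.
Proof.
move=> i0 AN CN g.
have [f fE] := AN (fun a => (g a \o i (src a))%VF).
have [f1 f1E] := mono_extend f i0.
pose g1 a : 'Hom(B (src a), N (tgt a)) :=
  g a - ((f1 (tgt a) \o rmap B a) - (rmap N a \o f1 (src a)))%VF.
have [h hE] := CN (fun a => (g1 a \o (p (src a))^-1)%VF).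
exists (fun v => f1 v + (h v \o p v)%VF) => a u.
have : g1 a ((p (src a))^-1%VF (p (src a) u)) = g1 a u.
  apply: lfun_inv_factor => w /ip[y <-].
  rewrite !lfE -hom_rmap !f1E.
  by rewrite -fE comp_lfunE subrr.
have := hE a (p _ u); rewrite comp_lfunE => -> g1E.
rewrite !lfE lfunD hom_rmap.
rewrite !lfE in g1E.
zmod_from g1E.
Qed.

(** The obstruction is the class of the cochain [g1] with values in the kernel of [p]. This kernel
    is a quotient of [A], so it has no Ext^1 from [M] either. *)
Lemma ext1_lift M : epi p -> ext1_vanish M A ->
  forall f : hom M C, exists f' : hom M B, forall v u, p v (f' v u) = f v u.
Proof.
move=> p1 MA f.
have [f1 pf1] := epi_lift f p1.
pose g1 a : 'Hom(M (src a), B (tgt a)) :=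
  ((f1 (tgt a) \o rmap M a) - (rmap B a \o f1 (src a)))%VF.
have [h hE] := MA (fun a => ((i (tgt a))^-1 \o g1 a)%VF).
pose f2 v := f1 v - (i v \o h v)%VF.
have f'P a u : f2 (tgt a) (rmap M a u) = rmap B a (f2 (src a) u).
  have : i (tgt a) ((i (tgt a))^-1%VF (g1 a u)) = g1 a u.
    apply: lfun_inv_section; apply/ip.
    rewrite !lfE !lfunB.
    by rewrite hom_rmap !pf1 hom_rmap subrr.
  have := hE a u; rewrite comp_lfunE => -> E.
  rewrite lfunB !lfE hom_rmap in E.
  rewrite !lfE !lfunB.
  zmod_from E.
exists (Hom f'P) => v u /=.
by rewrite !lfE lfunB exact_comp0 pf1 subr0.
Qed.

(** Surjectivity of Hom(M, B) -> Hom(M, C) kills the connecting map. A solution in [B] becomes a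
    homomorphism after [p], and subtracting a lift of it moves the solution into [A]. *)
Lemma ext1_kernel M : mono i ->
  (forall f : hom M C, exists f' : hom M B, forall v u, p v (f' v u) = f v u) ->
  ext1_vanish M B -> ext1_vanish M A.
Proof.
move=> i0 lift MB g.
have [f fE] := MB (fun a => (i (tgt a) \o g a)%VF).
pose f2 v := (p v \o f v)%VF.
have pfP a u : f2 (tgt a) (rmap M a u) = rmap C a (f2 (src a) u).
  rewrite !comp_lfunE; apply/eqP; rewrite -subr_eq0 -hom_rmap -lfunB -fE.
  by rewrite comp_lfunE exact_comp0.
have [f' f'E] := lift (Hom pfP).
exists (fun v => ((i v)^-1 \o (f v - f' v))%VF) => a u.
have iK v w : i v ((i v)^-1%VF (f v w - f' v w)) = f v w - f' v w.
  apply: lfun_inv_section; apply/ip.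
  by rewrite lfunB f'E /= comp_lfunE subrr.
apply: (lfunB0_inj (@i0 (tgt a))).
have := fE a u; rewrite comp_lfunE => ->.
rewrite lfunB hom_rmap !lfE !iK.
by rewrite lfunB hom_rmap opprB addrA subrK.
Qed.

End ShortExact.

End Homs.

(** * Kernels, cokernels, sums and powers *)

Section Constructions.
Variables (k : fieldType) (Q : quiver).
Implicit Types A B C E M N T : rep k Q.

Lemma exact_factor_left X A B C (i : hom A B) (p : hom B C) (f : hom X B) :
  mono i -> exact i p -> (forall v u, p v (f v u) = 0) ->
  exists g : hom X A, forall v u, i v (g v u) = f v u.
Proof.
move=> i0 ip pf.
have fE v u : i v ((i v)^-1%VF (f v u)) = f v u.
  by apply: lfun_inv_section; apply/ip.
pose h v := ((i v)^-1 \o f v)%VF.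
have hP a u : h (tgt a) (rmap X a u) = rmap A a (h (src a) u).
  apply: (lfunB0_inj (@i0 (tgt a))); rewrite hom_rmap !comp_lfunE !fE.
  exact: hom_rmap.
by exists (Hom hP) => v u /=; rewrite comp_lfunE fE.
Qed.

Lemma exact_factor_right A B C X (i : hom A B) (p : hom B C) (f : hom B X) :
  epi p -> exact i p -> (forall v u, f v (i v u) = 0) ->
  exists g : hom C X, forall v u, g v (p v u) = f v u.
Proof.
move=> p1 ip fi.
have fE v u : f v ((p v)^-1%VF (p v u)) = f v u.
  by apply: lfun_inv_factor => w /ip[y <-].
pose h v := (f v \o (p v)^-1)%VF.
have hP a u : h (tgt a) (rmap C a u) = rmap X a (h (src a) u).
  have [w <-] := p1 _ u.
  by rewrite !comp_lfunE -hom_rmap !fE hom_rmap.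
by exists (Hom hP) => v u /=; rewrite comp_lfunE fE.
Qed.

Lemma hom_middle_left A B C N (i : hom A B) (p : hom B C) :
  epi p -> exact i p ->
  hom_vanish A N -> hom_vanish C N -> hom_vanish B N.
Proof.
move=> p1 ip AN CN f v u.
have fi w x : f w (i w x) = 0 by have := AN (comp_hom f i) w x; rewrite homE.
by have [g <-] := exact_factor_right p1 ip fi; apply: CN.
Qed.

Section Kernel.
Variables (M N : rep k Q) (f : hom M N).

Definition ker_rep : rep k Q :=
  {| space := fun v => subvs_of (lker (f v));
     rmap := fun a => (sub_proj _ \o rmap M a \o sub_incl _)%VF |}.

Lemma ker_incl_subproof a (u : ker_rep (src a)) :
  sub_incl (lker (f (tgt a))) (rmap ker_rep a u) =
  rmap M a (sub_incl (lker (f (src a))) u).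
Proof.
rewrite !comp_lfunE sub_projK // memv_ker hom_rmap.
have := sub_incl_mem u; rewrite memv_ker => /eqP->.
by rewrite lfun0.
Qed.
Definition ker_incl : hom ker_rep M :=
  @Hom k Q ker_rep M (fun v => sub_incl (lker (f v))) ker_incl_subproof.

Lemma ker_incl_mono : mono ker_incl.
Proof. by move=> v u; apply: sub_incl_inj. Qed.

Lemma ker_incl_exact : exact ker_incl f.
Proof.
move=> v u; split=> [fu|[y <-]]; last first.
  by apply/eqP; rewrite -memv_ker sub_incl_mem.
by exists (sub_proj _ u); rewrite sub_projK // memv_ker fu.
Qed.

Definition coker_rep : rep k Q :=
  {| space := fun v => subvs_of (limg (f v))^C%VS;
     rmap := fun a => (quot_proj _ \o rmap N a \o sub_incl _)%VF |}.

Lemma coker_proj_subproof a (u : N (src a)) :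
  quot_proj (limg (f (tgt a))) (rmap N a u) =
  rmap coker_rep a (quot_proj (limg (f (src a))) u).
Proof.
rewrite !comp_lfunE; apply/eqP; rewrite -subr_eq0 -!lfunB; apply/eqP.
apply/quot_proj_eq0; rewrite sub_inclE quot_projE opprB addrC subrK.
have /memv_imgP[w _ ->] := memv_proj (limg (f (src a))) u.
by rewrite -hom_rmap memv_img ?memvf.
Qed.
Definition coker_proj : hom N coker_rep :=
  @Hom k Q N coker_rep (fun v => quot_proj (limg (f v))) coker_proj_subproof.

Lemma coker_proj_epi : epi coker_proj.
Proof. by move=> v u; apply: quot_proj_surj. Qed.

Lemma coker_proj_exact : exact f coker_proj.
Proof.
move=> v u; split=> [/quot_proj_eq0/memv_imgP[w _ ->]|[w <-]].
  by exists w.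
by apply/quot_proj_eq0; rewrite memv_img ?memvf.
Qed.

End Kernel.

Lemma pair_hom_subproof X M N (f : hom X M) (g : hom X N) a (u : X (src a)) :
  pair_lfun (f (tgt a)) (g (tgt a)) (rmap X a u) =
  rmap (dsum M N) a (pair_lfun (f (src a)) (g (src a)) u).
Proof. by rewrite dsum_rmapE !pair_lfunE !hom_rmap. Qed.
Definition pair_hom X M N (f : hom X M) (g : hom X N) : hom X (dsum M N) :=
  @Hom k Q X (dsum M N) (fun v => pair_lfun (f v) (g v))
    (pair_hom_subproof f g).
Lemma pair_homE X M N (f : hom X M) (g : hom X N) v u :
  pair_hom f g v u = (f v u, g v u).
Proof. exact: pair_lfunE. Qed.

Section DirectSum.
Variables (M N : rep k Q).

Definition inl_hom : hom M (dsum M N) := pair_hom (id_hom M) (zero_hom M N).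
Definition inr_hom : hom N (dsum M N) := pair_hom (zero_hom N M) (id_hom N).

Lemma fst_hom_subproof a (u : dsum M N (src a)) :
  fst_lfun _ _ (rmap (dsum M N) a u) = rmap M a (fst_lfun _ _ u).
Proof. by rewrite dsum_rmapE !fst_lfunE. Qed.
Definition fst_hom : hom (dsum M N) M :=
  @Hom k Q (dsum M N) M (fun v => fst_lfun (M v) (N v)) fst_hom_subproof.

Lemma snd_hom_subproof a (u : dsum M N (src a)) :
  snd_lfun _ _ (rmap (dsum M N) a u) = rmap N a (snd_lfun _ _ u).
Proof. by rewrite dsum_rmapE !snd_lfunE. Qed.
Definition snd_hom : hom (dsum M N) N :=
  @Hom k Q (dsum M N) N (fun v => snd_lfun (M v) (N v)) snd_hom_subproof.

Lemma inl_homE v u : inl_hom v u = (u, 0).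
Proof. by rewrite pair_homE !homE. Qed.
Lemma inr_homE v u : inr_hom v u = (0, u).
Proof. by rewrite pair_homE !homE. Qed.
Lemma fst_homE v u : fst_hom v u = u.1.
Proof. exact: fst_lfunE. Qed.
Lemma snd_homE v u : snd_hom v u = u.2.
Proof. exact: snd_lfunE. Qed.

Lemma inl_hom_mono : mono inl_hom.
Proof. by move=> v u; rewrite inl_homE => -[]. Qed.
Lemma snd_hom_epi : epi snd_hom.
Proof. by move=> v u; exists (inr_hom v u); rewrite snd_homE inr_homE. Qed.
Lemma dsum_exact : exact inl_hom snd_hom.
Proof.
move=> v [u w]; rewrite snd_homE /=; split=> [->|[y]].
  by exists u; rewrite inl_homE.
by rewrite inl_homE => -[].
Qed.

End DirectSum.

Definition dsumE := (inl_homE, inr_homE, fst_homE, snd_homE).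

Definition pow_rep (I : finType) T : rep k Q :=
  {| space := fun v => {ffun I -> T v};
     rmap := fun a => linfun (fun u : {ffun I -> T (src a)} =>
       [ffun i => rmap T a (u i)]) |}.

Lemma pow_rmapE (I : finType) T a (u : pow_rep I T (src a)) i :
  (rmap (pow_rep I T) a u : {ffun _}) i = rmap T a ((u : {ffun _}) i).
Proof.
rewrite /= linfun_apply ?ffunE // => c x y.
by apply/ffunP => j; rewrite !ffunE linearP.
Qed.

Definition ffun_tuple (V W : vectType k) (I : finType) (f : I -> 'Hom(V, W)) :
    'Hom(V, {ffun I -> W}) := linfun (fun u => [ffun i => f i u]).

Lemma ffun_tupleE (V W : vectType k) (I : finType) (f : I -> 'Hom(V, W)) u i :
  ffun_tuple f u i = f i u.
Proof.
rewrite linfun_apply ?ffunE // => c x y.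
by apply/ffunP => j; rewrite !ffunE linearP.
Qed.

Definition ffun_cotuple (V W : vectType k) (I : finType)
    (f : I -> 'Hom(V, W)) : 'Hom({ffun I -> V}, W) :=
  linfun (fun u : {ffun I -> V} => \sum_i f i (u i)).

Lemma ffun_cotupleE (V W : vectType k) (I : finType) (f : I -> 'Hom(V, W)) u :
  ffun_cotuple f u = \sum_i f i (u i).
Proof.
rewrite linfun_apply // => c x y.
rewrite scaler_sumr -big_split; apply: eq_bigr => i _.
by rewrite !ffunE linearP.
Qed.

Lemma tuple_hom_subproof (I : finType) M T (f : I -> hom M T) a
    (u : M (src a)) :
  ffun_tuple (fun i => f i (tgt a)) (rmap M a u) =
  rmap (pow_rep I T) a (ffun_tuple (fun i => f i (src a)) u).
Proof.
by apply/ffunP => i; rewrite pow_rmapE !ffun_tupleE hom_rmap.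
Qed.
Definition tuple_hom (I : finType) M T (f : I -> hom M T) :
    hom M (pow_rep I T) :=
  @Hom k Q M (pow_rep I T) (fun v => ffun_tuple (fun i => f i v))
    (tuple_hom_subproof f).

Lemma cotuple_hom_subproof (I : finType) M T (f : I -> hom T M) a
    (u : pow_rep I T (src a)) :
  ffun_cotuple (fun i => f i (tgt a)) (rmap (pow_rep I T) a u) =
  rmap M a (ffun_cotuple (fun i => f i (src a)) u).
Proof.
rewrite !ffun_cotupleE linear_sum; apply: eq_bigr => i _.
by rewrite pow_rmapE hom_rmap.
Qed.
Definition cotuple_hom (I : finType) M T (f : I -> hom T M) :
    hom (pow_rep I T) M :=
  @Hom k Q (pow_rep I T) M (fun v => ffun_cotuple (fun i => f i v))
    (cotuple_hom_subproof f).

Lemma tuple_homE (I : finType) M T (f : I -> hom M T) v u i :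
  (tuple_hom f v u : {ffun _}) i = f i v u.
Proof. exact: ffun_tupleE. Qed.
Lemma cotuple_homE (I : finType) M T (f : I -> hom T M) v u :
  cotuple_hom f v u = \sum_i f i v ((u : {ffun _}) i).
Proof. exact: ffun_cotupleE. Qed.

Definition pow_proj (I : finType) T (i : I) : hom (pow_rep I T) T :=
  cotuple_hom (fun j => if j == i then id_hom T else zero_hom T T).
Definition pow_inj (I : finType) T (i : I) : hom T (pow_rep I T) :=
  tuple_hom (fun j => if j == i then id_hom T else zero_hom T T).

Lemma pow_projE (I : finType) T (i : I) v u :
  pow_proj T i v u = (u : {ffun _}) i.
Proof.
rewrite cotuple_homE (bigD1 i) //= eqxx homE big1 ?addr0 // => j /negPf->.
by rewrite zero_homE.
Qed.

Lemma pow_injE (I : finType) T (i j : I) v u :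
  (pow_inj T i v u : {ffun _}) j = if j == i then u else 0.
Proof. by rewrite tuple_homE; case: eqP; rewrite homE. Qed.

Lemma pow_sum (I : finType) T v (u : pow_rep I T v) :
  u = \sum_i pow_inj T i v ((u : {ffun _}) i).
Proof.
apply/ffunP => j; rewrite sum_ffunE (bigD1 j) //= pow_injE eqxx.
by rewrite big1 ?addr0 // => i /negPf ij; rewrite pow_injE eq_sym ij.
Qed.

Lemma ext1_pow_left (I : finType) T N :
  ext1_vanish T N -> ext1_vanish (pow_rep I T) N.
Proof.
move=> TN g.
have /fin_all_exists[f fE] i := TN (fun a => (g a \o pow_inj T i (src a))%VF).
exists (fun v => ffun_cotuple (fun i => f i v)) => a u.
rewrite {1}[u]pow_sum linear_sum !ffun_cotupleE linear_sum -sumrB.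
apply: eq_bigr => i _; have := fE i a ((u : {ffun _}) i).
by rewrite comp_lfunE pow_rmapE.
Qed.

Lemma ext1_pow_right (I : finType) T N :
  ext1_vanish N T -> ext1_vanish N (pow_rep I T).
Proof.
move=> NT g.
have /fin_all_exists[f fE] i := NT (fun a => (pow_proj T i (tgt a) \o g a)%VF).
exists (fun v => ffun_tuple (fun i => f i v)) => a u; apply/ffunP => i.
have := fE i a u; rewrite comp_lfunE pow_projE => ->.
by rewrite !ffunE pow_rmapE !ffun_tupleE.
Qed.

(** Being a direct summand, without naming a complement; [retract_compl] recovers one. *)
Definition retract K M :=
  exists (s : hom K M) (r : hom M K), forall v u, r v (s v u) = u.

Lemma retract_mono K M : retract K M -> exists s : hom K M, mono s.
Proof.
case=> s [r rs]; exists s => v u su.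
by rewrite -(rs v u) su lfun0.
Qed.

Lemma retract_epi K M : retract K M -> exists r : hom M K, epi r.
Proof. by case=> s [r rs]; exists r => v u; exists (s v u). Qed.

Lemma ext1_retract_left K M N :
  retract K M -> ext1_vanish M N -> ext1_vanish K N.
Proof. by case/retract_mono => s; apply: ext1_mono. Qed.
Lemma ext1_retract_right K M N :
  retract K M -> ext1_vanish N M -> ext1_vanish N K.
Proof. by case/retract_epi => s; apply: ext1_epi. Qed.
Lemma hom_vanish_retract_left K M N :
  retract K M -> hom_vanish M N -> hom_vanish K N.
Proof. by case/retract_epi => s; apply: hom_vanish_epi. Qed.
Lemma hom_vanish_retract_right K M N :
  retract K M -> hom_vanish N M -> hom_vanish N K.
Proof. by case/retract_mono => s; apply: hom_vanish_mono. Qed.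

Lemma retract_refl M : retract M M.
Proof. by exists (id_hom M), (id_hom M) => v u; rewrite !homE. Qed.

Lemma retract_trans K L M : retract K L -> retract L M -> retract K M.
Proof.
move=> [s [r rs]] [s' [r' rs']]; exists (comp_hom s' s), (comp_hom r r') => v u.
by rewrite !homE rs' rs.
Qed.

Lemma iso_retract M N : iso M N -> retract M N.
Proof. by case=> f [g fg]; exists f, g => v u; case: (fg v). Qed.

(** Coordinates are padded by zeros up to a common bound [D], so that spaces of different dimensions
    at different vertices share one index type. *)
Lemma vbasis_coords (V : vectType k) D (v : V) :
  (\dim (fullv : {vspace V}) <= D)%N ->
  exists c : 'I_D -> k, v = \sum_(j < D) c j *: (vbasis fullv)`_j.
Proof.
move=> leD; pose co j := if insub j is Some j' then
  coord (vbasis (fullv : {vspace V})) j' v else 0.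
exists (fun j => co j); rewrite [LHS](coord_vbasis (memvf _)).
rewrite (eq_bigr (fun j : 'I__ => co j *: (vbasis fullv)`_j)) => [|j _].
  rewrite (big_ord_widen D (fun j => co j *: (vbasis fullv)`_j)) //.
  rewrite big_mkcond; apply: eq_bigr => j _.
  by case: ifP => // /negbT ge_j; rewrite /co insubN // scale0r.
by rewrite /co valK.
Qed.

(** Hom(T, E) is cut out by linear equations in the finite-dimensional space [L] of coordinate
    families. Padding makes [dec] non-injective, so the result is a spanning family and not a
    basis. *)
Lemma hom_span T E : exists n (phi : 'I_n -> hom T E), forall f : hom T E,
  exists c : 'I_n -> k, forall v u, f v u = \sum_i c i *: phi i v u.
Proof.
pose D := \max_v \dim (fullv : {vspace 'Hom(T v, E v)}).
pose L := {ffun (vertex Q * 'I_D) -> k^o}.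
pose dec (c : L) v : 'Hom(T v, E v) :=
  \sum_(j < D) c (v, j) *:
    (vbasis (fullv : {vspace 'Hom(T v, E v)}))`_j.
have decP v c x y : dec (c *: x + y) v = c *: dec x v + dec y v.
  rewrite scaler_sumr -big_split; apply: eq_bigr => j _.
  by rewrite !ffunE scalerDl scalerA.
pose del a (c : L) : 'Hom(T (src a), E (tgt a)) :=
  (dec c (tgt a) \o rmap T a)%VF - (rmap E a \o dec c (src a))%VF.
have delP a : linear (del a).
  move=> c x y; rewrite /del !decP; apply/lfunP => u.
  rewrite !(lfE, scale_lfunE) lfunD linearZ /=.
  rewrite scalerBr; zmod.
pose H := (\bigcap_a lker (linfun (del a)))%VS.
have homP c : c \in H -> forall a u,
    dec c (tgt a) (rmap T a u) = rmap E a (dec c (src a) u).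
  move=> cH a u; have /subvP/(_ _ cH) : (H <= lker (linfun (del a)))%VS.
    by rewrite /H (bigD1 a) //= capvSl.
  rewrite memv_ker (linfun_apply (delP a)) => /eqP d0.
  have := congr1 (fun h : 'Hom(_, _) => h u) d0.
  by rewrite !lfE zero_lfunE => /eqP; rewrite subr_eq0 => /eqP.
have bH i : (vbasis H)`_i \in H.
  have [lt_i|ge_i] := ltnP i (\dim H); last first.
    by rewrite nth_default ?size_tuple ?mem0v.
  by apply: vbasis_mem; apply: mem_nth; rewrite size_tuple.
exists (\dim H), (fun i => Hom (homP _ (bH i))) => f.
have dimD v : (\dim (fullv : {vspace 'Hom(T v, E v)}) <= D)%N.
  exact: leq_bigmax.
have /fin_all_exists[c cE] v := vbasis_coords (f v) (dimD v).
pose cf : L := [ffun vj => c vj.1 vj.2].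
have decf v : dec cf v = f v.
  by rewrite (cE v); apply: eq_bigr => j _; rewrite ffunE.
have cfH : cf \in H.
  rewrite /H memvE; apply/subv_bigcapP => a _; rewrite -memvE memv_ker.
  rewrite (linfun_apply (delP a)) /del !decf; apply/eqP/lfunP => u.
  by rewrite !lfE zero_lfunE hom_rmap subrr.
exists (fun i => coord (vbasis H) i cf) => v u /=.
rewrite -decf {1}(coord_vbasis cfH).
have -> : dec (\sum_(i < \dim H) coord (vbasis H) i cf *: (vbasis H)`_i) v =
   \sum_(i < \dim H) coord (vbasis H) i cf *: dec (vbasis H)`_i v.
  have dl : linear (dec^~ v) by move=> z x y; apply: decP.
  have -> x : dec x v = linfun (dec^~ v) x by rewrite linfun_apply.
  rewrite linear_sum; apply: eq_bigr => i _.
  by rewrite linearZ /= linfun_apply.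
by rewrite sum_lfunE; apply: eq_bigr => i _; rewrite scale_lfunE.
Qed.

End Constructions.

(** * Universal extensions and approximations *)

Section Extensions.
Variables (k : fieldType) (Q : quiver).
Implicit Types A B C E M N T : rep k Q.

Section Twisted.
Variables (A C : rep k Q) (g : forall a : arrow Q, 'Hom(C (src a), A (tgt a))).

(** The extension of [C] by [A] whose class in Ext^1(C, A) is that of the cochain [g]. *)
Definition ext_rep : rep k Q :=
  {| space := fun v => (A v * C v)%type;
     rmap := fun a => pair_lfun
       ((rmap A a \o fst_lfun _ _)%VF + (g a \o snd_lfun _ _)%VF)
       (rmap C a \o snd_lfun _ _)%VF |}.

Lemma ext_rmapE a (u : ext_rep (src a)) :
  rmap ext_rep a u = (rmap A a u.1 + g a u.2, rmap C a u.2).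
Proof. by rewrite /= pair_lfunE !lfE fst_lfunE snd_lfunE. Qed.

Lemma ext_incl_subproof a (u : A (src a)) :
  pair_lfun \1 0 (rmap A a u) = rmap ext_rep a (pair_lfun \1%VF 0 u).
Proof.
by rewrite ext_rmapE !pair_lfunE /= !lfE !zero_lfunE !lfun0 addr0.
Qed.
Definition ext_incl : hom A ext_rep :=
  @Hom k Q A ext_rep (fun v => pair_lfun \1%VF 0) ext_incl_subproof.

Lemma ext_proj_subproof a (u : ext_rep (src a)) :
  snd_lfun _ _ (rmap ext_rep a u) = rmap C a (snd_lfun _ _ u).
Proof. by rewrite ext_rmapE !snd_lfunE. Qed.
Definition ext_proj : hom ext_rep C :=
  @Hom k Q ext_rep C (fun v => snd_lfun (A v) (C v)) ext_proj_subproof.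

Lemma ext_inclE v u : ext_incl v u = (u, 0).
Proof. by rewrite pair_lfunE id_lfunE zero_lfunE. Qed.
Lemma ext_projE v u : ext_proj v u = u.2.
Proof. exact: snd_lfunE. Qed.

Lemma ext_incl_mono : mono ext_incl.
Proof. by move=> v u; rewrite ext_inclE => -[]. Qed.
Lemma ext_proj_epi : epi ext_proj.
Proof. by move=> v u; exists (0, u); rewrite ext_projE. Qed.
Lemma ext_exact : exact ext_incl ext_proj.
Proof.
move=> v [u w]; rewrite ext_projE /=; split=> [->|[y]].
  by exists u; rewrite ext_inclE.
by rewrite ext_inclE => -[].
Qed.

End Twisted.

Lemma scale_hom_ex M N (c : k) (f : hom M N) :
  exists g : hom M N, forall v u, g v u = c *: f v u.
Proof.
pose h v := c *: f v.
have hP a u : h (tgt a) (rmap M a u) = rmap N a (h (src a) u).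
  by rewrite /h !scale_lfunE linearZ /= hom_rmap.
by exists (Hom hP) => v u; rewrite /= scale_lfunE.
Qed.

(** All cochains are spanned, not only a system of representatives of Ext^1: a redundant family
    serves the universal extension equally well. *)
Lemma arrow_family_span M N : exists n
    (g : 'I_n -> forall a : arrow Q, 'Hom(M (src a), N (tgt a))),
  forall f : (forall a, 'Hom(M (src a), N (tgt a))),
  exists c : 'I_n -> k, forall a, f a = \sum_i c i *: g i a.
Proof.
pose D := \max_a \dim (fullv : {vspace 'Hom(M (src a), N (tgt a))}).
pose g (i : arrow Q * 'I_D) a := if i.1 == a then
  (vbasis (fullv : {vspace 'Hom(M (src a), N (tgt a))}))`_i.2 else 0.
exists #|{: arrow Q * 'I_D}|, (fun i => g (enum_val i)) => f.
have dimD a : (\dim (fullv : {vspace 'Hom(M (src a), N (tgt a))}) <= D)%N.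
  exact: leq_bigmax.
have /fin_all_exists[c cE] a := vbasis_coords (f a) (dimD a).
pose c' (i : arrow Q * 'I_D) := c i.1 i.2.
exists (fun i => c' (enum_val i)) => a; rewrite (cE a).
rewrite -(big_enum_val (fun i => c' i *: g i a)) /=.
rewrite -(pair_bigA _ (fun i j => c i j *: (if i == a then
  (vbasis (fullv : {vspace 'Hom(M (src a), N (tgt a))}))`_j else 0))) /=.
rewrite (bigD1 a) //= [X in _ = _ + X]big1 ?addr0 => [|b /negPf ba].
  by apply: eq_bigr => j _; rewrite eqxx.
by rewrite big1 // => j _; rewrite ba scaler0.
Qed.

(** Bongartz's construction: the pullback of the extension along the i-th inclusion of [T] has
    cochain [g i], so the connecting map Hom(T, T^n) -> Ext^1(T, M) is surjective. As Ext^1(T, T^n)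
    = 0, nothing is left in Ext^1(T, E). *)
Lemma universal_extension T M : ext1_vanish T T ->
  exists n E (i : hom M E) (p : hom E (pow_rep 'I_n T)),
  [/\ mono i, epi p, exact i p & ext1_vanish T E].
Proof.
move=> TT; have [n [g gspan]] := arrow_family_span T M.
pose gg a : 'Hom(pow_rep 'I_n T (src a), M (tgt a)) := ffun_cotuple (g^~ a).
exists n, (ext_rep gg), (ext_incl gg), (ext_proj gg).
split; [exact: ext_incl_mono|exact: ext_proj_epi|exact: ext_exact|].
move=> f; have [f2 f2E] := @ext1_pow_right k Q _ T T TT
  (fun a => (ext_proj gg (tgt a) \o f a)%VF).
(* Once the T^n component is solved by [f2], the rest takes values in [M] and is a combination of
   the [g i]. Subtracting the diagonal map [h] from [f2] absorbs it. *)
have [c cE] := gspan (fun a => (fst_lfun _ _ \o f a)%VF +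
  (gg a \o f2 (src a))%VF).
pose h v : 'Hom(T v, pow_rep 'I_n T v) := ffun_tuple (fun i => c i *: \1%VF).
exists (fun v => pair_lfun 0 (f2 v - h v)) => a u.
have hE v w i : (h v w : {ffun _}) i = c i *: w.
  by rewrite ffun_tupleE scale_lfunE id_lfunE.
rewrite ext_rmapE !pair_lfunE /= !zero_lfunE lfun0 add0r.
have E2 : (f a u).2 = (f2 (tgt a) - h (tgt a)) (rmap T a u) -
    rmap (pow_rep 'I_n T) a ((f2 (src a) - h (src a)) u).
  have := f2E a u; rewrite comp_lfunE ext_projE => ->.
  rewrite !sub_lfunE lfunB; set x := f2 _ _; set y := rmap _ _ _.
  have -> : rmap (pow_rep 'I_n T) a (h (src a) u) = h (tgt a) (rmap T a u).
    by apply/ffunP => i; rewrite pow_rmapE !hE linearZ.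
  by zmod.
have E1 : (f a u).1 = - gg a ((f2 (src a) - h (src a)) u).
  have := congr1 (fun F : 'Hom(_, _) => F u) (cE a).
  rewrite !lfE fst_lfunE lfunB sum_lfunE.
  have -> : gg a (h (src a) u) = \sum_i (c i *: g i a) u.
    rewrite ffun_cotupleE; apply: eq_bigr => i _.
    by rewrite hE linearZ scale_lfunE.
  by move=> E; zmod_from E.
rewrite [LHS]surjective_pairing E1 E2.
rewrite [RHS]surjective_pairing /=; congr pair; zmod.
Qed.

Definition perp_trivial T :=
  forall M, hom_vanish T M -> ext1_vanish T M -> is_zero M.

(** By the choice of [p], every map T -> E factors through it. Its cokernel C has Ext^1(T, C) = 0 as
    a quotient of [E], and Hom(T, C) = 0 because maps T -> C lift to [E] and then along [p]. Hence C
    = 0. *)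
Lemma perp_approximation T E :
  ext1_vanish T T -> perp_trivial T -> ext1_vanish T E ->
  exists n K (i : hom K (pow_rep 'I_n T)) (p : hom (pow_rep 'I_n T) E),
  [/\ mono i, epi p, exact i p & ext1_vanish T K].
Proof.
move=> TT T0 TE; have [n [phi span]] := hom_span T E.
pose p := cotuple_hom phi.
have lift (f : hom T E) : exists f' : hom T (pow_rep 'I_n T),
    forall v u, p v (f' v u) = f v u.
  have [c cE] := span f.
  have /fin_all_exists[s sE] i := scale_hom_ex (c i) (id_hom T).
  exists (tuple_hom s) => v u; rewrite cE cotuple_homE.
  by apply: eq_bigr => i _; rewrite tuple_homE sE homE linearZ.
have q1 := @coker_proj_epi k Q _ _ p; have pq := @coker_proj_exact k Q _ _ p.
have C0 : is_zero (coker_rep p).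
  apply: T0 => [f|]; last exact: ext1_epi q1 TE.
  have [f' f'E] := ext1_lift pq q1 (ext1_pow_right TT) f.
  have [f2 f2E] := lift f' => v u.
  by rewrite -f'E; apply/pq; exists (f2 v u); rewrite f2E.
have p1 : epi p by move=> v u; apply/pq/C0.
exists n, (ker_rep p), (ker_incl p), p.
have i0 := @ker_incl_mono k Q _ _ p; have ip := @ker_incl_exact k Q _ _ p.
by split=> //; apply: (ext1_kernel ip i0 lift (ext1_pow_right TT)).
Qed.

(* As [T]-perpendicular modules have [T]-resolutions of length one, the kernel
   of an approximation is itself a summand of a power of [T]. *)
Lemma perp_resolution T E :
  ext1_vanish T T -> perp_trivial T -> ext1_vanish T E ->
  exists n m K (i : hom K (pow_rep 'I_n T)) (p : hom (pow_rep 'I_n T) E),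
  [/\ mono i, epi p, exact i p & retract K (pow_rep 'I_m T)].
Proof.
move=> TT T0 TE.
have [n [K [i [p [i0 p1 ip TK]]]]] := perp_approximation TT T0 TE.
have [m [L [j [q [j0 q1 jq TL]]]]] := perp_approximation TT T0 TK.
exists n, m, K, i, p; split=> //.
have KL : ext1_vanish K L by apply: ext1_mono i0 (ext1_pow_left TL).
have [s sE] := ext1_lift jq q1 KL (id_hom K).
by exists s, q => v u; rewrite sE homE.
Qed.

(* [T'^perp] consists of the quotients of the powers of [T']. *)
Lemma ext1_tilting_trans T T' N :
  ext1_vanish T' T' -> perp_trivial T' ->
  ext1_vanish T T' -> ext1_vanish T' N -> ext1_vanish T N.
Proof.
move=> TT' T0' T_T' T'N.
have [n [K [i [p [i0 p1 ip _]]]]] := perp_approximation TT' T0' T'N.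
exact: ext1_epi p1 (ext1_pow_right T_T').
Qed.

(** The resolution of length one of [K] splits: its kernel [L] is a summand of a power of [T], so
    Ext^1(K, L) = 0. *)
Lemma ext1_tilting_retract T K :
  ext1_vanish T T -> perp_trivial T -> ext1_vanish K T -> ext1_vanish T K ->
  exists n, retract K (pow_rep 'I_n T).
Proof.
move=> TT T0 KT TK.
have [n [m [L [i [p [i0 p1 ip Lr]]]]]] := perp_resolution TT T0 TK.
have KL : ext1_vanish K L.
  exact: ext1_retract_right Lr (ext1_pow_right KT).
have [s sE] := ext1_lift ip p1 KL (id_hom K).
by exists n, s, p => v u; rewrite sE homE.
Qed.

End Extensions.

(** * The Krull-Schmidt theorem *)

Section KrullSchmidt.
Variables (k : fieldType) (Q : quiver).
Implicit Types A B C E K L M N T : rep k Q.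

Lemma mono_epi_inv M N (f : hom M N) : mono f -> epi f ->
  exists g : hom N M, forall v, cancel (f v) (g v) /\ cancel (g v) (f v).
Proof.
move=> f0 f1.
have fK v u : (f v)^-1%VF (f v u) = u by apply: lfun_inv_retract; apply: f0.
have gK v u : f v ((f v)^-1%VF u) = u by apply: lfun_inv_section; apply: f1.
have hP a u : (f (tgt a))^-1%VF (rmap N a u) = rmap M a ((f (src a))^-1%VF u).
  by apply: (lfunB0_inj (@f0 (tgt a))); rewrite gK hom_rmap gK.
by exists (Hom (hom_at := fun v => ((f v)^-1)%VF) hP) => v; split.
Qed.

Lemma mono_limg_dim M N (f : hom M N) v : mono f ->
  \dim (limg (f v)) = \dim (fullv : {vspace M v}).
Proof.
move=> f0; apply: limg_dim_eq; apply/eqP; rewrite -subv0 capfv.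
by apply/subvP => u; rewrite memv_ker memv0 => /eqP/f0->.
Qed.

Lemma mono_dim M N (f : hom M N) v : mono f ->
  (\dim (fullv : {vspace M v}) <= \dim (fullv : {vspace N v}))%N.
Proof. by move=> /(mono_limg_dim v) <-; rewrite dimvS ?subvf. Qed.

Lemma mono_dim_epi M N (f : hom M N) : mono f ->
  (forall v, (\dim (fullv : {vspace N v}) <= \dim (fullv : {vspace M v}))%N) ->
  epi f.
Proof.
move=> f0 dimle v y.
suff : y \in limg (f v) by case/memv_imgP => x _ ->; exists x.
suff -> : limg (f v) = fullv by rewrite memvf.
apply/eqP; rewrite eqEdim subvf (mono_limg_dim v f0) /=; exact: dimle.
Qed.

Lemma mono_endo_inv M (f : hom M M) : mono f ->
  exists g : hom M M, forall v, cancel (f v) (g v) /\ cancel (g v) (f v).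
Proof. by move=> f0; apply: mono_epi_inv => //; apply: mono_dim_epi. Qed.

(** Mutual embeddings force equal dimensions at every vertex, so an embedding is already
    bijective. *)
Lemma retract_anti M N : retract M N -> retract N M -> iso M N.
Proof.
move=> /retract_mono[s s0] /retract_mono[r r0].
have s1 : epi s by apply: mono_dim_epi => // v; apply: mono_dim r0.
by have [g gE] := mono_epi_inv s0 s1; exists s, g.
Qed.

Definition copair_hom M N X (f : hom M X) (g : hom N X) : hom (dsum M N) X :=
  add_hom (comp_hom f (fst_hom M N)) (comp_hom g (snd_hom M N)).
Lemma copair_homE M N X (f : hom M X) (g : hom N X) v u :
  copair_hom f g v u = f v u.1 + g v u.2.
Proof. by rewrite !homE !dsumE. Qed.

Lemma retract_dsum K K' M M' :
  retract K M -> retract K' M' -> retract (dsum K K') (dsum M M').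
Proof.
move=> [s [r rs]] [s' [r' rs']].
exists (pair_hom (comp_hom s (fst_hom K K')) (comp_hom s' (snd_hom K K'))).
exists (pair_hom (comp_hom r (fst_hom M M')) (comp_hom r' (snd_hom M M'))).
by move=> v [x y]; rewrite !(pair_homE, homE, dsumE) /= rs rs'.
Qed.

Lemma iso_dsum K K' M M' : iso K M -> iso K' M' -> iso (dsum K K') (dsum M M').
Proof.
by move=> KM KM'; apply: retract_anti; apply: retract_dsum;
   apply: iso_retract => //; apply: iso_sym.
Qed.

Lemma retract_inl M N : retract M (dsum M N).
Proof. by exists (inl_hom M N), (fst_hom M N) => v u; rewrite !dsumE. Qed.
Lemma retract_inr M N : retract N (dsum M N).
Proof. by exists (inr_hom M N), (snd_hom M N) => v u; rewrite !dsumE. Qed.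

Lemma dsumC M N : iso (dsum M N) (dsum N M).
Proof.
exists (pair_hom (snd_hom M N) (fst_hom M N)).
exists (pair_hom (snd_hom N M) (fst_hom N M)).
by move=> v; split=> -[x y]; rewrite !(pair_homE, dsumE).
Qed.

Lemma dsumA L M N : iso (dsum (dsum L M) N) (dsum L (dsum M N)).
Proof.
exists (pair_hom (comp_hom (fst_hom _ _) (fst_hom _ _))
  (pair_hom (comp_hom (snd_hom _ _) (fst_hom _ _)) (snd_hom _ _))).
exists (pair_hom (pair_hom (fst_hom _ _) (comp_hom (fst_hom _ _) (snd_hom _ _)))
  (comp_hom (snd_hom _ _) (snd_hom _ _))).
move=> v; split=> [[[x y] z]|[x [y z]]];
  by rewrite !(pair_homE, homE, dsumE).
Qed.

Lemma dsum_zero M N : is_zero N -> iso (dsum M N) M.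
Proof.
move=> N0; exists (fst_hom M N), (inl_hom M N) => v.
by split=> [[x y]|x]; rewrite !dsumE //= (N0 _ y).
Qed.

Lemma zero_dsum M N : is_zero M -> iso (dsum M N) N.
Proof. by move=> M0; apply: iso_trans (dsumC M N) (dsum_zero _ M0). Qed.

Lemma retract_zero M N : is_zero M -> retract M N.
Proof.
by move=> M0; exists (zero_hom M N), (zero_hom N M) => v u; rewrite zero_homE (M0 _ u).
Qed.

Lemma zero_retract M N : retract M N -> is_zero N -> is_zero M.
Proof.
move=> [s [r rs]] N0 v u.
by have := rs v u; rewrite (N0 v (s v u)) lfun0 => <-.
Qed.

Lemma zero_repP : is_zero (zero_rep k Q).
Proof. by move=> v u; apply/rowP => -[]. Qed.

Lemma split_iso K M (s : hom K M) (r : hom M K) :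
  (forall v u, r v (s v u) = u) -> iso M (dsum K (ker_rep r)).
Proof.
move=> rs.
have r0 := @ker_incl_mono k Q _ _ r; have rE := @ker_incl_exact k Q _ _ r.
have rq v u : r v (add_hom (id_hom M) (opp_hom (comp_hom s r)) v u) = 0.
  by rewrite !homE lfunB rs subrr.
have [q qE] := exact_factor_left r0 rE rq.
exists (pair_hom r q), (copair_hom s (ker_incl r)) => v; split=> [u|[x y]].
  by rewrite pair_homE copair_homE qE !homE; zmod.
have ry : r v (ker_incl r v y) = 0 by apply/rE; exists y.
rewrite copair_homE pair_homE lfunD rs ry addr0; congr pair.
apply: (lfunB0_inj (@r0 v)); rewrite qE !homE lfunD rs ry addr0 /=.
by zmod.
Qed.

Lemma retract_compl K M : retract K M -> exists N, iso M (dsum K N).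
Proof. by case=> s [r rs]; exists (ker_rep r); apply: split_iso rs. Qed.

Lemma summand_retract M T : is_summand M T <-> retract M T.
Proof.
split=> [[N /iso_sym/iso_retract MN]|/retract_compl//].
exact: retract_trans (retract_inl M N) MN.
Qed.

Lemma indecomposable_retract K M :
  indecomposable M -> ~ is_zero K -> retract K M -> iso K M.
Proof.
move=> [_ Mi] K0 /retract_compl[N MN]; have [//|N0] := Mi _ _ MN.
exact: iso_sym (iso_trans MN (dsum_zero K N0)).
Qed.

Fixpoint iter_hom n M (f : hom M M) : hom M M :=
  if n is n'.+1 then comp_hom f (iter_hom n' f) else id_hom M.

Lemma iter_homD m n M (f : hom M M) v u :
  iter_hom (m + n) f v u = iter_hom m f v (iter_hom n f v u).
Proof. by elim: m => [|m IH] /=; rewrite !homE //= -IH. Qed.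

(** A positive iterate of least total rank is taken. Positivity matters: [n = 0] is always stable
    but says nothing about [f]. *)
Lemma iter_hom_stable M (f : hom M M) : exists2 n, (0 < n)%N &
  forall v, \dim (limg (iter_hom (n + n) f v)) = \dim (limg (iter_hom n f v)).
Proof.
pose R n := (\sum_v \dim (limg (iter_hom n f v)))%N.
have leR m n v : (\dim (limg (iter_hom (m + n) f v)) <=
    \dim (limg (iter_hom m f v)))%N.
  apply/dimvS/subvP => _ /memv_imgP[u _ ->].
  by rewrite iter_homD memv_img ?memvf.
have exR : exists r, exists2 n, (0 < n)%N & R n = r.
  by exists (R 1%N), 1%N.
have [r [[n n0 Rn] rmin]] : exists r, (exists2 n, (0 < n)%N & R n = r) /\
    forall m, (0 < m)%N -> (r <= R m)%N.
  case: exR => r; elim/ltn_ind: r => r IH [n n0 Rn].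
  case: (classic (exists2 m, (0 < m)%N & (R m < r)%N)) => [[m m0 lt_m]|no].
    by apply: (IH _ lt_m); exists m.
  exists r; split; first by exists n.
  by move=> m m0; rewrite leqNgt; apply/negP => lt_m; apply: no; exists m.
exists n => // v; have nn0 : (0 < n + n)%N by rewrite addn_gt0 n0.
apply/eqP; apply: contraTT (rmin _ nn0) => ne.
 rewrite -ltnNge -Rn /R (bigD1 v) //= [X in (_ < X)%N](bigD1 v) //=.
rewrite -addSn leq_add //; first by rewrite ltn_neqAle ne leR.
by apply: leq_sum => w _; apply: leR.
Qed.

(** The image and the kernel of a stable iterate [g] are complementary subrepresentations, and
    indecomposability makes one of them zero. *)
Lemma fitting M (f : hom M M) : indecomposable M ->
  mono f \/ exists n, forall v u, iter_hom n f v u = 0.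
Proof.
move=> [M0 Mi]; have [n n0 dimE] := iter_hom_stable f.
have [g gE] : exists g, g = iter_hom n f by exists (iter_hom n f).
rewrite -gE in dimE.
have ggE v u : (g v \o g v)%VF u = g v (g v u) by rewrite comp_lfunE.
have limgE v : limg (g v \o g v)%VF = limg (g v).
  apply/eqP; rewrite eqEdim; apply/andP; split.
    by apply/subvP => _ /memv_imgP[u _ ->]; rewrite ggE memv_img ?memvf.
  rewrite -dimE; apply/dimvS/subvP => _ /memv_imgP[u _ ->].
  by rewrite gE iter_homD -gE -ggE memv_img ?memvf.
have ggex v u : exists w, (g v \o g v)%VF w = g v u.
  have : g v u \in limg (g v \o g v)%VF by rewrite limgE memv_img ?memvf.
  by case/memv_imgP => w _ ->; exists w.
have gker v u : g v (g v u) = 0 -> g v u = 0.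
  have : lker (g v) = lker (g v \o g v)%VF.
    apply/eqP; rewrite eqEdim; apply/andP; split.
      by apply/subvP => w; rewrite !memv_ker ggE => /eqP->; rewrite lfun0.
    have := limg_ker_dim (g v) fullv.
    rewrite -(limg_ker_dim (g v \o g v)%VF fullv) !capfv limgE => /eqP.
    by rewrite eqn_add2r => /eqP->.
  by move=> kE gg; apply/eqP; rewrite -memv_ker kE memv_ker ggE gg.
have ginj v x y : g v (g v x) = g v (g v y) -> g v x = g v y.
  move=> E; apply/eqP; rewrite -subr_eq0 -lfunB; apply/eqP/gker.
  by rewrite !lfunB E subrr.
(* The vertexwise choice [c] need not be a homomorphism, but e = g c is the projection onto the
   image of [g] along its kernel. It commutes with the arrows because [g] is injective on its own
   image. *)
have [c cE] : exists c : (forall v, 'Hom(M v, M v)),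
    forall v u, g v (g v (c v u)) = g v u.
  exists (fun v => ((g v \o g v)^-1 \o g v)%VF) => v u.
  rewrite -ggE [((_ \o g v)%VF u)]comp_lfunE.
  by apply: lfun_inv_section; apply: ggex.
have [e eE] : exists e : (forall v, 'Hom(M v, M v)),
    forall v u, e v u = g v (c v u).
  by exists (fun v => (g v \o c v)%VF) => v u; rewrite comp_lfunE.
have geE v u : g v (e v u) = g v u by rewrite eE.
have eP a u : e (tgt a) (rmap M a u) = rmap M a (e (src a) u).
  rewrite [in RHS]eE -hom_rmap [LHS]eE; apply: ginj.
  by rewrite -eE geE !hom_rmap -eE geE.
pose eh := Hom eP.
pose d := add_hom (id_hom M) (opp_hom eh).
have dE v u : d v u = u - e v u by rewrite !homE.
have eeE v u : e v (e v u) = e v u.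
  by rewrite [LHS]eE [RHS]eE; apply: ginj; rewrite -!eE geE.
(* The kernel of d = 1 - e is the image of [e]; this is the summand that is split off. *)
have i0 := @ker_incl_mono k Q _ _ d; have iE := @ker_incl_exact k Q _ _ d.
have de v u : d v (eh v u) = 0 by rewrite dE /= eeE subrr.
have [r rE] := exact_factor_left i0 iE de.
have rs v u : r v (ker_incl d v u) = u.
  apply: (lfunB0_inj (@i0 v)).
  have : d v (ker_incl d v u) = 0 by apply/iE; exists u.
  by rewrite dE rE => /eqP; rewrite subr_eq0 => /eqP <-.
case: (Mi _ _ (split_iso rs)) => [K0|N0].
  right; exists n => v u; rewrite -gE -geE -[e v u]/(eh v u) -rE.
  by rewrite (K0 _ (r v u)) !lfun0.
left=> v u fu.
have r0 : mono r.
  move=> w x /(@ker_incl_exact k Q _ _ r)[y <-].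
  by rewrite (N0 _ y) lfun0.
apply: (r0 v); apply: (i0 v); rewrite rE /= eE.
apply: gker; rewrite cE.
by rewrite gE -(prednK n0) -addn1 iter_homD /= !(comp_lfunE, id_lfunE) /= fu lfun0.
Qed.

End KrullSchmidt.

(** * Decompositions into indecomposables and basic modules *)

Section Decomposition.
Variables (k : fieldType) (Q : quiver).
Implicit Types A B C E K L M N T : rep k Q.

Lemma iter_hom_fix M (f : hom M M) v (u : M v) n :
  f v u = u -> iter_hom n f v u = u.
Proof. by move=> fu; elim: n => [|n IH]; rewrite /= !(comp_lfunE, id_lfunE) // IH. Qed.

(* The endomorphism ring of an indecomposable representation is local. *)
Lemma add_hom_mono M (f g : hom M M) : indecomposable M ->
  mono (add_hom f g) -> mono f \/ mono g.
Proof.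
move=> Mi fg0; have [h hE] := mono_endo_inv fg0.
case: (fitting (comp_hom h f) Mi) => [hf0|[n hfn]].
  by left=> v u fu; apply: (hf0 v); rewrite homE fu lfun0.
(* As hf + hg = 1, the nilpotent hf fixes the kernel of [g] pointwise, so this kernel is zero. *)
right=> v u gu; rewrite -(hfn v u) iter_hom_fix // homE.
by have := (hE v).1 u; rewrite homE gu addr0.
Qed.

Lemma sum_hom_mono M n (F : 'I_n -> hom M M) (h : hom M M) :
  indecomposable M -> mono h -> (forall v u, h v u = \sum_i F i v u) ->
  exists i, mono (F i).
Proof.
move=> Mi; elim: n F h => [|n IH] F h h0 hE.
  by case: Mi.1 => v u; apply: (h0 v); rewrite hE big_ord0.
pose r := comp_hom (cotuple_hom (fun i => F (lift ord0 i)))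
  (tuple_hom (fun i : 'I_n => id_hom M)).
have rE v u : r v u = \sum_i F (lift ord0 i) v u.
  rewrite homE cotuple_homE; apply: eq_bigr => i _.
  by rewrite tuple_homE homE.
case: (@add_hom_mono _ (F ord0) r Mi).
- move=> v u; rewrite homE rE => E; apply: (h0 v).
  by rewrite hE big_ord_recl; exact: E.
- by move=> F0; exists ord0.
- by move=> r0; have [i Fi] := IH _ _ r0 rE; exists (lift ord0 i).
Qed.

Lemma retract_through K M (p : hom K M) (q : hom M K) :
  mono (comp_hom q p) -> retract K M.
Proof.
move=> qp0; have [h hE] := mono_endo_inv qp0.
exists p, (comp_hom h q) => v u; rewrite homE.
by have := (hE v).1 u; rewrite homE.
Qed.

(** The identity of [K] is a sum of [n] endomorphisms that factor through [T]; by locality one of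
    them is invertible. *)
Lemma retract_pow_indecomposable K n T : indecomposable K ->
  retract K (pow_rep 'I_n T) -> retract K T.
Proof.
move=> Ki [s [r rs]].
pose F i := comp_hom (comp_hom r (pow_inj T i)) (comp_hom (pow_proj T i) s).
have [i Fi] : exists i, mono (F i).
  apply: (sum_hom_mono (h := id_hom K)) => // [v u|v u]; rewrite homE //.
  rewrite -[LHS]rs {1}[s v u]pow_sum linear_sum; apply: eq_bigr => i _.
  by rewrite !homE pow_projE.
exact: retract_through Fi.
Qed.

Lemma retract_dsum_indecomposable K A B : indecomposable K ->
  retract K (dsum A B) -> retract K A \/ retract K B.
Proof.
move=> Ki [s [r rs]].
pose f := comp_hom (comp_hom r (inl_hom A B)) (comp_hom (fst_hom A B) s).
pose g := comp_hom (comp_hom r (inr_hom A B)) (comp_hom (snd_hom A B) s).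
case: (@add_hom_mono _ f g Ki) => [v u|f0|g0].
- rewrite !homE !dsumE -lfunD => su; rewrite -[LHS]rs -[RHS]su.
  by congr (r v _); case: (s v u) => x y; congr pair; rewrite ?addr0 ?add0r.
- by left; apply: retract_through f0.
- by right; apply: retract_through g0.
Qed.

Definition dsums (s : seq (rep k Q)) : rep k Q :=
  foldr (@dsum k Q) (zero_rep k Q) s.

Definition total_dim M := (\sum_v \dim (fullv : {vspace M v}))%N.

Lemma total_dim_iso M N : iso M N -> total_dim M = total_dim N.
Proof.
move=> MN; apply: eq_bigr => v _; apply/eqP; rewrite eqn_leq.
have [s s0] := retract_mono (iso_retract MN).
have [r r0] := retract_mono (iso_retract (iso_sym MN)).
by rewrite (mono_dim v s0) (mono_dim v r0).
Qed.

Lemma total_dim_dsum M N : total_dim (dsum M N) = (total_dim M + total_dim N)%N.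
Proof.
by rewrite /total_dim -big_split; apply: eq_bigr => v _; rewrite !dimvf.
Qed.

Lemma total_dim_gt0 M : ~ is_zero M -> (0 < total_dim M)%N.
Proof.
move=> M0; rewrite lt0n; apply/negP => /eqP d0; apply: M0 => v u.
apply/eqP; rewrite -memv0.
suff /eqP <- : (fullv : {vspace M v}) == 0%VS by rewrite memvf.
rewrite -dimv_eq0 -leqn0 -d0.
by rewrite /total_dim (bigD1 v) //= leq_addr.
Qed.

Lemma dsums_cat s t : iso (dsums (s ++ t)) (dsum (dsums s) (dsums t)).
Proof.
elim: s => [|K s IH] /=.
  by apply: iso_sym; apply: zero_dsum; apply: zero_repP.
apply: iso_trans (iso_sym (dsumA _ _ _)).
exact: iso_dsum (iso_refl K) IH.
Qed.

Lemma indecomposable_decomposition M : exists s,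
  (forall K, List.In K s -> indecomposable K) /\ iso M (dsums s).
Proof.
have [n] := ubnP (total_dim M); elim: n M => // n IH M; rewrite ltnS => ltn.
case: (classic (is_zero M)) => [M0|M0].
  exists nil; split=> //.
  by apply: retract_anti; apply: retract_zero => //; apply: zero_repP.
case: (classic (indecomposable M)) => [Mi|Mn].
  exists [:: M]; split=> [K [<-|[]]//|].
  by apply: iso_sym; apply: dsum_zero; apply: zero_repP.
have [A [B [MAB A0 B0]]] : exists A B,
    [/\ iso M (dsum A B), ~ is_zero A & ~ is_zero B].
  apply: NNPP => no; apply: Mn; split=> // A B MAB.
  case: (classic (is_zero A)) => [|A0]; first by left.
  case: (classic (is_zero B)) => [|B0]; first by right.
  by case: no; exists A, B.
have dE : total_dim M = (total_dim A + total_dim B)%N.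
  by rewrite (total_dim_iso MAB) total_dim_dsum.
have [s [si As]] : exists s, (forall K, List.In K s -> indecomposable K) /\
    iso A (dsums s).
  apply: IH; apply: (leq_trans _ ltn); rewrite dE -addn1.
  by rewrite leq_add2l total_dim_gt0.
have [t [ti Bt]] : exists s, (forall K, List.In K s -> indecomposable K) /\
    iso B (dsums s).
  apply: IH; apply: (leq_trans _ ltn); rewrite dE addnC -addn1.
  by rewrite leq_add2l total_dim_gt0.
exists (s ++ t); split=> [K Kst|].
  by case: (List.in_app_or s t K Kst); [apply: si|apply: ti].
apply: iso_trans MAB (iso_trans (iso_dsum As Bt) _).
exact: iso_sym (dsums_cat s t).
Qed.

Lemma in_dsums_retract K s : List.In K s -> retract K (dsums s).
Proof.
elim: s => [//|L s IH] /= [->|/IH Ks]; first exact: retract_inl.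
exact: retract_trans Ks (retract_inr _ _).
Qed.

Lemma retract_dsums_in K s : (forall L, List.In L s -> indecomposable L) ->
  indecomposable K -> retract K (dsums s) -> exists2 L, List.In L s & iso K L.
Proof.
move=> si Ki; elim: s si => [|L s IH] si /=.
  by move=> K0; case: (Ki.1 (zero_retract K0 (@zero_repP k Q))).
case/(retract_dsum_indecomposable Ki) => [KL|/IH[M|M Ms KM]].
- exists L; first by left.
  by apply: indecomposable_retract KL; [apply: si; left|exact: Ki.1].
- by move=> Ms; apply: si; right.
- by exists M => //; right.
Qed.

(** Allows a property stable under direct sums to be checked on indecomposable summands, where
    locality is available. *)
Lemma additive_property (P : rep k Q -> Prop) T :
  (forall M N, iso M N -> P M -> P N) -> P (zero_rep k Q) ->
  (forall A B, P A -> P B -> P (dsum A B)) ->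
  (forall K, indecomposable K -> retract K T -> P K) -> P T.
Proof.
move=> Piso P0 Psum PK; have [s [si Ts]] := indecomposable_decomposition T.
apply: (Piso _ _ (iso_sym Ts)).
have {}PK K : List.In K s -> P K.
  move=> Ks; apply: PK; first exact: si.
  exact: retract_trans (in_dsums_retract Ks) (iso_retract (iso_sym Ts)).
elim: s {Ts si} PK => [//|K s IH] PK /=; apply: Psum.
  by apply: PK; left.
by apply: IH => L Ls; apply: PK; right.
Qed.

Lemma dsum_cancel K A B : indecomposable K ->
  iso (dsum K A) (dsum K B) -> iso A B.
Proof.
(* It suffices that the component [K -> K] of the isomorphism is invertible. *)
move=> Ki.
have cancel_unit (f : hom (dsum K A) (dsum K B)) (g : hom (dsum K B) (dsum K A)) :
    (forall v, cancel (f v) (g v) /\ cancel (g v) (f v)) ->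
    mono (comp_hom (comp_hom (fst_hom K B) f) (inl_hom K A)) -> iso A B.
  move=> fg a0; pose b := comp_hom (comp_hom (fst_hom K B) f) (inr_hom K A).
  have [h hE] := mono_endo_inv a0.
  (* The graph of the pairs [(d y, y)] is isomorphic to [A] and is exactly the preimage under [f] of
     the summand [B]. *)
  have [d dE] : exists d : hom A K, forall v y, d v y = - h v (b v y).
    by exists (opp_hom (comp_hom h b)) => v y; rewrite opp_homE comp_homE.
  have fd v y : (f v (d v y, y)).1 = 0.
    have := (hE v).2 (b v y); set z := h v (b v y) => E.
    have -> : (d v y, y) = inr_hom K A v y - inl_hom K A v z.
      by rewrite dE !dsumE -/z; congr pair; rewrite /=; zmod.
    rewrite lfunB /=; move: E; rewrite /b !homE !dsumE => <-.
    exact: subrr.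
  have gd v z : (g v (0, z)).1 = d v (g v (0, z)).2.
    have := (fg v).2 (0, z); set w := g v (0, z) => fw.
    apply: (lfunB0_inj (@a0 v)); rewrite !homE !dsumE.
    have E : (f v (d v w.2, w.2)).1 = (f v w).1 by rewrite fd fw.
    have -> : ((d v w.2, 0) : dsum K A v) = (d v w.2, w.2) - (0, w.2).
      by congr pair; rewrite /=; zmod.
    have -> : ((w.1, 0) : dsum K A v) = w - (0, w.2).
      by case: (w) => x y; congr pair; rewrite /=; zmod.
    by rewrite !lfunB /= E.
  exists (comp_hom (comp_hom (snd_hom K B) f) (pair_hom d (id_hom A))).
  exists (comp_hom (comp_hom (snd_hom K A) g) (inr_hom K B)).
  move=> v; split=> y; rewrite !(homE, dsumE, pair_homE) /=.
    have -> : (0, (f v (d v y, y)).2) = f v (d v y, y).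
      by rewrite [RHS]surjective_pairing fd.
    by rewrite (fg v).1.
  by rewrite -(gd v y) -surjective_pairing (fg v).2.
case=> f [g fg].
pose a := comp_hom (comp_hom (fst_hom K B) f) (inl_hom K A).
case: (classic (mono a)) => [|an]; first exact: cancel_unit fg.
(* Otherwise compose with the shear [(x, y) |-> (x + b' y, y)], where [b'] is
   the component [B -> K] of the inverse. *)
have [a' a'E] : exists a' : hom K K, forall v u, a' v u = (g v (u, 0)).1.
  exists (comp_hom (comp_hom (fst_hom K A) g) (inl_hom K B)) => v u.
  by rewrite !(homE, dsumE).
have [b' b'E] : exists b' : hom B K, forall v u, b' v u = (g v (0, u)).1.
  exists (comp_hom (comp_hom (fst_hom K A) g) (inr_hom K B)) => v u.
  by rewrite !(homE, dsumE).
have [c cE] : exists c : hom K B, forall v u, c v u = (f v (u, 0)).2.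
  exists (comp_hom (comp_hom (snd_hom K B) f) (inl_hom K A)) => v u.
  by rewrite !(homE, dsumE).
have aE v u : a v u = (f v (u, 0)).1 by rewrite !(homE, dsumE).
have abc v u : a' v (a v u) + b' v (c v u) = u.
  rewrite a'E aE b'E cE.
  have -> : (g v ((f v (u, 0)).1, 0)).1 + (g v (0, (f v (u, 0)).2)).1 =
    (g v (((f v (u, 0)).1, 0) + (0, (f v (u, 0)).2))).1 by rewrite lfunD.
  have -> : ((f v (u, 0)).1, 0) + (0, (f v (u, 0)).2) = f v (u, 0).
    by rewrite [RHS]surjective_pairing; congr pair; rewrite /=; zmod.
  by rewrite (fg v).1.
have bc0 : mono (comp_hom b' c).
  case: (@add_hom_mono _ (comp_hom a' a) (comp_hom b' c) Ki) => //.
    by move=> v u; rewrite add_homE 2!comp_homE abc.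
  by move=> a'a0; case: an => v u au; apply: (a'a0 v); rewrite homE au lfun0.
pose sh (b1 : hom B K) : hom (dsum K B) (dsum K B) :=
  pair_hom (copair_hom (id_hom K) b1) (snd_hom K B).
have shE b1 v u : sh b1 v u = (u.1 + b1 v u.2, u.2).
  by rewrite pair_homE copair_homE dsumE homE.
apply: (cancel_unit (comp_hom (sh b') f) (comp_hom g (sh (opp_hom b')))).
  move=> v; split=> u; rewrite !(comp_homE, shE, opp_homE) /=.
    by rewrite addrK -surjective_pairing (fg v).1.
  by rewrite (fg v).2 /= subrK -surjective_pairing.
case: (@add_hom_mono _ (comp_hom (comp_hom (fst_hom K B) (comp_hom (sh b') f))
    (inl_hom K A)) (opp_hom a) Ki) => //.
  move=> v u E; apply: (bc0 v); rewrite -[RHS]E.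
  rewrite add_homE opp_homE aE !comp_homE !dsumE shE /= cE.
  by zmod.
by move=> oa0; case: an => v u au; apply: (oa0 v); rewrite opp_homE au oppr0.
Qed.

Definition pairwise_noniso (s : seq (rep k Q)) :=
  forall i j, (i < j < size s)%N ->
  ~ iso (nth (zero_rep k Q) s i) (nth (zero_rep k Q) s j).

Lemma In_nth (s : seq (rep k Q)) i : (i < size s)%N ->
  List.In (nth (zero_rep k Q) s i) s.
Proof. by elim: s i => [//|K s IH] [|i] /=; [left|move/IH; right]. Qed.

Lemma In_nth_ex (s : seq (rep k Q)) K : List.In K s ->
  exists2 i, (i < size s)%N & nth (zero_rep k Q) s i = K.
Proof.
elim: s => [//|L s IH] /= [->|/IH[i lt_i <-]]; first by exists 0%N.
by exists i.+1.
Qed.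

Lemma pairwise_noniso_cons K s : pairwise_noniso (K :: s) <->
  (forall L, List.In L s -> ~ iso K L) /\ pairwise_noniso s.
Proof.
split=> [h|[h1 h2] [|i] [|j] //= lt_ij].
  split=> [L /In_nth_ex[j lt_j <-]|i j lt_ij]; first exact: (h 0%N j.+1).
  exact: (h i.+1 j.+1).
- by apply: h1; apply: In_nth.
- exact: h2.
Qed.

(** Cancellation bounds the multiplicity of [K]. If the head of [s] is [K], cancelling one copy
    leaves [K] in the tail, against [pairwise_noniso]; otherwise the head splits off the complement
    of the two copies and is cancelled. *)
Lemma noniso_no_double K s : (forall L, List.In L s -> indecomposable L) ->
  pairwise_noniso s -> indecomposable K -> ~ retract (dsum K K) (dsums s).
Proof.
move=> si sn Ki KK.
have [L Ls KL] := retract_dsums_in si Ki (retract_trans (retract_inl K K) KK).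
elim: s si sn KK Ls => [//|M s IH] si /pairwise_noniso_cons[Mn sn] KK Ls.
have Mi : indecomposable M by apply: si; left.
have {}si N : List.In N s -> indecomposable N by move=> Ns; apply: si; right.
case: (classic (iso K M)) => [KM|KM].
  have [N /= sN] := retract_compl KK.
  have : iso (dsum K (dsums s)) (dsum K (dsum K N)).
    apply: iso_trans (dsumA _ _ _); apply: iso_trans sN.
    exact: iso_dsum KM (iso_refl _).
  move=> /(dsum_cancel Ki)/iso_sym/iso_retract sKN.
  have [L' L's KL'] := retract_dsums_in si Ki
    (retract_trans (retract_inl K N) sKN).
  exact: Mn L's (iso_trans (iso_sym KM) KL').
have {}Ls : List.In L s.
  by case: Ls => // ML; case: KM; rewrite ML.
apply: IH Ls => //.
have [N /= sN] := retract_compl KK.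
have MN : retract M N.
  have Mr : retract M (dsum (dsum K K) N).
    exact: retract_trans (retract_inl _ _) (iso_retract sN).
  have noK : ~ retract M K.
    by move/(indecomposable_retract Ki Mi.1)/iso_sym.
  by case/(retract_dsum_indecomposable Mi): Mr => //
     /(retract_dsum_indecomposable Mi)[].
have [N' NM] := retract_compl MN.
have : iso (dsum M (dsums s)) (dsum M (dsum (dsum K K) N')).
  apply: iso_trans sN (iso_trans (iso_dsum (iso_refl _) NM) _).
  apply: iso_trans (iso_trans (dsumC _ _) (dsumA _ _ _)) _.
  exact: iso_dsum (iso_refl _) (dsumC _ _).
move=> /(dsum_cancel Mi)/iso_sym/iso_retract.
exact: retract_trans (retract_inl _ _).
Qed.

Lemma dsums_double (t : seq (rep k Q)) i j : (i < j)%N -> (j < size t)%N ->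
  iso (nth (zero_rep k Q) t i) (nth (zero_rep k Q) t j) ->
  retract (dsum (nth (zero_rep k Q) t i) (nth (zero_rep k Q) t i)) (dsums t).
Proof.
elim: t i j => [//|M t IH] [|i] [|j] //= lt_ij lt_j ij.
  apply: (retract_dsum (retract_refl M)).
  by apply: retract_trans (iso_retract ij) (in_dsums_retract _); apply: In_nth.
exact: retract_trans (IH i j lt_ij lt_j ij) (retract_inr _ _).
Qed.

(** [basic] quantifies over all decompositions, so a repetition in any other decomposition [t] must
    be excluded by means of [s]. *)
Lemma basic_dsums s : (forall L, List.In L s -> indecomposable L) ->
  pairwise_noniso s -> basic (dsums s).
Proof.
move=> si sn t ti st i j /andP[lt_ij lt_j] ij.
have lt_i := ltn_trans lt_ij lt_j.
apply: (noniso_no_double si sn (ti i lt_i)).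
apply: (retract_trans _ (iso_retract (iso_sym st))).
exact: dsums_double ij.
Qed.

Lemma basic_pairwise_noniso T s :
  (forall L, List.In L s -> indecomposable L) -> iso T (dsums s) ->
  basic T -> pairwise_noniso s.
Proof.
by move=> si Ts Tb i j ij; apply: Tb => // n lt_n; apply: si; apply: In_nth.
Qed.

(** Summands found separately in [T] can be split off together: after the head [M] is removed, an
    indecomposable not isomorphic to [M] must be a summand of the complement. *)
Lemma noniso_dsums_retract s T :
  (forall L, List.In L s -> indecomposable L) -> pairwise_noniso s ->
  (forall L, List.In L s -> retract L T) -> retract (dsums s) T.
Proof.
elim: s T => [|M s IH] T si sn sT /=.
  by apply: retract_zero; apply: zero_repP.
have [Mn {}sn] := (pairwise_noniso_cons M s).1 sn.
have Mi : indecomposable M by apply: si; left.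
have [N TN] : exists N, iso T (dsum M N).
  by apply: retract_compl; apply: sT; left.
apply: retract_trans (iso_retract (iso_sym TN)).
apply: (retract_dsum (retract_refl M)); apply: IH => // [L Ls|L Ls].
  by apply: si; right.
have Li : indecomposable L by apply: si; right.
have : retract L (dsum M N).
  by apply: retract_trans (iso_retract TN); apply: sT; right.
case/(retract_dsum_indecomposable Li) => // LM.
by case: (Mn L Ls); apply/iso_sym/(indecomposable_retract Mi Li.1).
Qed.

Lemma basic_iso T T' : basic T -> basic T' ->
  (forall K, indecomposable K -> retract K T <-> retract K T') -> iso T T'.
Proof.
have half A B : basic A ->
    (forall K, indecomposable K -> retract K A -> retract K B) -> retract A B.
  move=> Ab AB; have [s [si As]] := indecomposable_decomposition A.
  apply: retract_trans (iso_retract As) (noniso_dsums_retract si _ _).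
    exact: basic_pairwise_noniso si As Ab.
  move=> L Ls; apply: AB (si _ Ls) _.
  exact: retract_trans (in_dsums_retract Ls) (iso_retract (iso_sym As)).
by move=> Tb Tb' TT'; apply: retract_anti; apply: half => // K Ki /TT'; apply.
Qed.

Lemma basic_version T : exists2 T', basic T' &
  forall K, indecomposable K -> retract K T <-> retract K T'.
Proof.
have [s [si Ts]] := indecomposable_decomposition T.
have [t [ts tn st]] : exists t, [/\ forall L, List.In L t -> List.In L s,
    pairwise_noniso t &
    forall L, List.In L s -> exists2 L', List.In L' t & iso L L'].
  elim: s {si Ts} => [|M s [t [ts tn st]]].
    by exists nil; split=> // i j; rewrite ltn0 andbF.
  case: (classic (exists2 L', List.In L' t & iso M L')) => [Mt|Mt].
    exists t; split=> // [L /ts Ls|L [<-|Ls]]; [by right|exact: Mt|exact: st].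
  exists (M :: t); split.
  - by move=> L [->|/ts]; [left|right].
  - by apply/pairwise_noniso_cons; split=> // L Lt ML; apply: Mt; exists L.
  - move=> L [->|/st[L' L't LL']].
      by exists L; [left|apply: iso_refl].
    by exists L' => //; right.
have ti L : List.In L t -> indecomposable L by move/ts/si.
exists (dsums t); first exact: basic_dsums.
have sT K : retract K T <-> retract K (dsums s).
  split=> KT; apply: (retract_trans KT); first exact: iso_retract.
  exact: iso_retract (iso_sym Ts).
move=> K Ki; rewrite sT; split=> [/(retract_dsums_in si Ki)|].
  case=> L /st[L' L't LL'] KL.
  exact: retract_trans (iso_retract (iso_trans KL LL')) (in_dsums_retract L't).
move=> /(retract_dsums_in ti Ki)[L Lt KL].
exact: retract_trans (iso_retract KL) (in_dsums_retract (ts L Lt)).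
Qed.

End Decomposition.

(** * Projective resolutions *)

Section ExtGroups.
Variables (k : fieldType) (Q : quiver).
Implicit Types A B C E M N T P : rep k Q.

(** The first components of a section trivialize the cochain of the extension. *)
Lemma ext_rep_section A C (g : forall a : arrow Q, 'Hom(C (src a), A (tgt a)))
    (s : hom C (ext_rep g)) :
  (forall v u, ext_proj g v (s v u) = u) ->
  exists f : (forall v, 'Hom(C v, A v)),
  forall a u, g a u = f (tgt a) (rmap C a u) - rmap A a (f (src a) u).
Proof.
move=> sE; exists (fun v => fst_lfun (A v) (C v) \o s v)%VF => a u.
rewrite !comp_lfunE !fst_lfunE.
have := hom_rmap s u; rewrite ext_rmapE => /(congr1 fst) /= E.
have := sE _ u; rewrite ext_projE => uE; rewrite uE in E.
zmod_from E.
Qed.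

Lemma projective_ext1 P N : projective P -> ext1_vanish P N.
Proof.
move=> Pp g; have [s sE] := Pp _ _ _ (id_hom P) (@ext_proj_epi k Q N P g).
by apply: (ext_rep_section (s := s)) => v u; rewrite sE homE.
Qed.

(** The map [f] factors through the image of [d0], and the obstruction to extending it to [A0] lies
    in Ext^1 of the image of [e], which vanishes with Ext^1(B, N). For degree 1 of a resolution [B]
    is the resolved module, for higher degrees it is a projective. *)
Lemma exact_hom_extend A2 A1 A0 B N (d1 : hom A2 A1) (d0 : hom A1 A0)
    (e : hom A0 B) (f : hom A1 N) :
  exact d1 d0 -> exact d0 e -> ext1_vanish B N ->
  (forall v u, f v (d1 v u) = 0) ->
  exists g : hom A0 N, forall v u, f v u = g v (d0 v u).
Proof.
move=> ex1 ex0 BN fd1.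
have [s sE] : exists s : (forall v, 'Hom(B v, A0 v)),
    forall v p, e v (s v (e v p)) = e v p.
  by exists (fun v => (e v)^-1%VF) => v p; apply: lfun_invK.
have [f' f'E] : exists f' : (forall v, 'Hom(A0 v, N v)),
    forall v x, f' v (d0 v x) = f v x.
  exists (fun v => (f v \o (d0 v)^-1)%VF) => v x; rewrite comp_lfunE.
  by apply: lfun_inv_factor => w /ex1[y <-].
(* The vertexwise extension p |-> f'(p - s (e p)) fails to commute with the arrows by a cochain
   pulled back from [B], and [h] trivializes that cochain. *)
have [h hE] := BN (fun a => f' (tgt a) \o
  ((rmap A0 a \o s (src a)) - (s (tgt a) \o rmap B a)))%VF.
have [g gE] : exists g : (forall v, 'Hom(A0 v, N v)),
    forall v p, g v p = f' v (p - s v (e v p)) - h v (e v p).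
  exists (fun v => (f' v \o (\1 - (s v \o e v))) - (h v \o e v))%VF => v p.
  by rewrite !lfE.
have gP a p : g (tgt a) (rmap A0 a p) = rmap N a (g (src a) p).
  rewrite !gE hom_rmap [in RHS]lfunB.
  have [x xE] : exists x, d0 (src a) x = p - s (src a) (e (src a) p).
    by apply/ex0; rewrite lfunB sE subrr.
  have E1 := hE a (e (src a) p).
  rewrite !lfE lfunB in E1.
  have E2 : rmap N a (f' (src a) (p - s (src a) (e (src a) p))) =
      f' (tgt a) (rmap A0 a p) -
      f' (tgt a) (rmap A0 a (s (src a) (e (src a) p))).
    by rewrite -xE f'E -hom_rmap -f'E hom_rmap xE !lfunB.
  by rewrite E2 lfunB; zmod_from E1.
exists (Hom gP) => v u; rewrite /= gE.
have -> : e v (d0 v u) = 0 by apply/ex0; exists u.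
by rewrite !lfun0 !subr0 f'E.
Qed.

Lemma ext1_Ext_pos M N : ext1_vanish M N -> Ext_pos_zero M N.
Proof.
move=> MN [|n] P f fd.
  have ex1 : exact (res_d P 1) (res_d P 0) by apply: res_exactS.
  have ex0 : exact (res_d P 0) (res_aug P) by apply: res_exact0.
  exact: exact_hom_extend ex1 ex0 MN fd.
have ex1 : exact (res_d P n.+2) (res_d P n.+1) by apply: res_exactS.
have ex0 : exact (res_d P n.+1) (res_d P n) by apply: res_exactS.
apply: exact_hom_extend ex1 ex0 _ fd.
by apply: projective_ext1; apply: res_proj.
Qed.

(** The augmentation lifts to a map [l] into the extension with cochain [g]. On [P 1] it induces a
    cocycle [f] with values in [N]; writing [f] as [g'] after the differential, [l] corrected by
    [g'] descends to a section over [M]. *)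
Lemma Ext_pos_ext1 M N :
  inhabited (proj_resolution M) -> Ext_pos_zero M N -> ext1_vanish M N.
Proof.
case=> P MN g.
have [l lE] := @res_proj k Q M P 0%N _ _ (ext_proj g) (res_aug P)
  (@ext_proj_epi k Q N M g).
have ex0 : exact (res_d P 0) (res_aug P) by apply: res_exact0.
have i0 := @ext_incl_mono k Q N M g; have ig := @ext_exact k Q N M g.
have ld v u : ext_proj g v (comp_hom l (res_d P 0) v u) = 0.
  by rewrite homE lE; apply/ex0; exists u.
have [f fE] := exact_factor_left i0 ig ld.
have fd v x : f v (res_d P 1 v x) = 0.
  apply: (i0 v); rewrite fE homE.
  have -> : res_d P 0 v (res_d P 1 v x) = 0 by apply/res_exactS; exists x.
  exact: lfun0.
have [g' g'E] := MN 0%N P f fd.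
pose l' := add_hom l (opp_hom (comp_hom (ext_incl g) g')).
have l'd v u : l' v (res_d P 0 v u) = 0.
  by rewrite !homE -g'E fE homE subrr.
have [s sE] := exact_factor_right (res_aug_epi P) ex0 l'd.
apply: (ext_rep_section (s := s)) => v u.
have [p <-] := res_aug_epi P u.
rewrite sE !homE lfunB lE.
have -> : ext_proj g v (ext_incl g v (g' v p)) = 0 by apply/ig; exists (g' v p).
by rewrite subr0.
Qed.

End ExtGroups.

(** * Enough projectives from the path algebra *)

Section PathAlgebra.
Variables (k : fieldType) (Q : quiver) (h : vertex Q -> nat).
Hypothesis h_lt : forall a : arrow Q, (h (src a) < h (tgt a))%N.

(* Paths are listed from their last arrow to their first one. *)
Fixpoint path_to (v : vertex Q) (p : seq (arrow Q)) : bool :=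
  if p is a :: q then (tgt a == v) && path_to (src a) q else true.

Lemma path_to_size v p : path_to v p -> (size p <= h v)%N.
Proof.
elim: p v => [//|a p IH] v /= /andP[/eqP <- /IH]; rewrite -ltnS => le_p.
exact: leq_trans le_p (h_lt a).
Qed.

Definition height := (\max_v h v)%N.
(** Bounded sequences make this a finite type, and by [path_to_size] no path exceeds [height]. *)
Definition path_type v := {p : height.-bseq (arrow Q) | path_to v p}.
Definition path_seq v (p : path_type v) : seq (arrow Q) := val (val p).

Lemma path_seq_inj v : injective (@path_seq v).
Proof. by move=> p q /val_inj/val_inj. Qed.

Lemma path_seqP v (p : path_type v) : path_to v (path_seq p).
Proof. exact: (valP p). Qed.

Lemma path_seq_ex v p : path_to v p -> exists q : path_type v, path_seq q = p.
Proof.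
move=> pv; have le_p : (size p <= height)%N.
  exact: leq_trans (path_to_size pv) (leq_bigmax v).
by exists (Sub (Bseq le_p) pv).
Qed.

Section Free.
Variable W : vectType k.

(** The free module kQ tensor W, whose space at [v] has one copy of [W] for each path ending at [v].
    An arrow prepends itself to a path, so at most one [q] contributes to the coordinate at [p]. *)
Definition free_rep : rep k Q :=
  {| space := fun v => {ffun path_type v -> W};
     rmap := fun a => linfun (fun phi : {ffun path_type (src a) -> W} =>
       [ffun p : path_type (tgt a) =>
         \sum_(q | a :: path_seq q == path_seq p) phi q]) |}.

Lemma free_rmapE a (phi : {ffun path_type (src a) -> W})
    (p : path_type (tgt a)) :
  (rmap free_rep a phi : {ffun _}) p =
  \sum_(q | a :: path_seq q == path_seq p) phi q.
Proof.
rewrite /= linfun_apply ?ffunE // => c x y; apply/ffunP => q.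
rewrite !ffunE scaler_sumr -big_split; apply: eq_bigr => i _.
by rewrite !ffunE.
Qed.

Definition single v (p : path_type v) : 'Hom(W, free_rep v) :=
  linfun (fun w => [ffun q => if q == p then w else 0] : {ffun path_type v -> W}).

Lemma singleE v (p q : path_type v) w :
  (single p w : {ffun _}) q = if q == p then w else 0.
Proof.
rewrite /single linfun_apply ?ffunE // => c x y; apply/ffunP => r.
by rewrite !ffunE; case: eqP; rewrite // scaler0 addr0.
Qed.

Lemma single_sum v (phi : free_rep v) :
  phi = \sum_p single p ((phi : {ffun _}) p).
Proof.
apply/ffunP => q; rewrite sum_ffunE (bigD1 q) //= singleE eqxx.
by rewrite big1 ?addr0 // => p /negPf pq; rewrite singleE eq_sym pq.
Qed.

Lemma free_rmap_single a (q : path_type (src a)) (p : path_type (tgt a)) w :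
  path_seq p = a :: path_seq q -> rmap free_rep a (single q w) = single p w.
Proof.
move=> pE; apply/ffunP => r; rewrite free_rmapE singleE.
case: (r =P p) => [->|rp].
  rewrite (big_pred1 q) ?singleE ?eqxx // => q' /=.
  by rewrite pE eqseq_cons eqxx /= (inj_eq (@path_seq_inj _)).
apply: big1 => q' /eqP q'r; rewrite singleE; case: eqP => // q'q.
by case: rp; apply: path_seq_inj; rewrite pE -q'r q'q.
Qed.

Section Eval.
Variables (M : rep k Q) (gen : forall v, 'Hom(W, M v)).

(** The action of a path on the generators. A mismatched vertex gives the dummy value 0; otherwise
    [eq_rect] moves the result to the space at [v]. *)
Fixpoint path_eval (p : seq (arrow Q)) (v : vertex Q) : 'Hom(W, M v) :=
  if p is a :: q then
    if tgt a =P v is ReflectT e then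
      eq_rect (tgt a) (fun w => 'Hom(W, M w))
        (rmap M a \o path_eval q (src a))%VF v e
    else 0
  else gen v.

Lemma path_eval_cons a q w :
  path_eval (a :: q) (tgt a) w = rmap M a (path_eval q (src a) w).
Proof. by rewrite /=; case: eqP => // e; rewrite eq_axiomK /= comp_lfunE. Qed.

Definition eval_at v : 'Hom(free_rep v, M v) :=
  linfun (fun phi : {ffun path_type v -> W} =>
    \sum_p path_eval (path_seq p) v (phi p)).

Lemma eval_atE v (phi : {ffun path_type v -> W}) :
  eval_at v phi = \sum_p path_eval (path_seq p) v (phi p).
Proof.
rewrite /eval_at linfun_apply // => c x y.
rewrite scaler_sumr -big_split; apply: eq_bigr => p _.
by rewrite !ffunE linearP.
Qed.

Lemma eval_hom_subproof a (phi : free_rep (src a)) :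
  eval_at (tgt a) (rmap free_rep a phi) = rmap M a (eval_at (src a) phi).
Proof.
rewrite !eval_atE linear_sum.
under eq_bigr => p _ do rewrite free_rmapE linear_sum.
rewrite (exchange_big_dep xpredT) //=; apply: eq_bigr => q _.
have [p pE] : exists p : path_type (tgt a), path_seq p = a :: path_seq q.
  by apply: path_seq_ex; rewrite /= eqxx path_seqP.
rewrite (big_pred1 p) ?pE -?path_eval_cons // => p' /=.
by rewrite -pE eq_sym (inj_eq (@path_seq_inj _)).
Qed.

Definition eval_hom : hom free_rep M :=
  @Hom k Q free_rep M eval_at eval_hom_subproof.

Lemma eval_single v (p : path_type v) w :
  eval_hom v (single p w) = path_eval (path_seq p) v w.
Proof.
rewrite [LHS]eval_atE (bigD1 p) //= singleE eqxx big1 ?addr0 // => q /negPf qp.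
by rewrite singleE qp lfun0.
Qed.

End Eval.

Lemma trivial_path_ex v : exists p : path_type v, path_seq p = [::].
Proof. exact: path_seq_ex. Qed.

(** A map out of the free module is determined by its values on the trivial paths [p0], and these
    values lift linearly along [g]. *)
Lemma free_projective : projective free_rep.
Proof.
move=> A B g f g1.
have /fin_all_exists[p0 p0E] := trivial_path_ex.
have [gen genE] : exists gen : (forall v, 'Hom(W, A v)),
    forall v w, g v (gen v w) = f v (single (p0 v) w).
  exists (fun v => (g v)^-1 \o (f v \o single (p0 v)))%VF => v w.
  rewrite comp_lfunE lfun_inv_section ?comp_lfunE //; exact: g1.
exists (eval_hom gen).
have ev (p : seq (arrow Q)) v (q : path_type v) w : path_seq q = p ->
    g v (path_eval gen p v w) = f v (single q w).
  elim: p v q => [|a p IH] v q qE.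
    by rewrite genE; do 2 congr (_ _); congr single; apply: path_seq_inj;
       rewrite p0E.
  have := path_seqP q; rewrite qE /= => /andP[/eqP va pa].
  case: v / va q qE => q qE; rewrite -[LHS]/(g _ (path_eval gen (a :: p) _ w)).
  have [q' q'E] := path_seq_ex pa.
  rewrite path_eval_cons hom_rmap (IH _ q' q'E) -hom_rmap.
  by rewrite (free_rmap_single (p := q)) // qE q'E.
move=> v phi; rewrite {1}[phi]single_sum linear_sum linear_sum.
rewrite [in RHS](single_sum phi) linear_sum; apply: eq_bigr => p _ /=.
by have := eval_single gen p ((phi : {ffun _}) p) => /= ->; apply: ev.
Qed.

End Free.

(** An epimorphism from a projective, with no minimality: each vertex receives [D] generators,
    enough to reach a basis of every [M v]. It is a sigma type because the objects of a resolution
    are data. *)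
Lemma projective_cover M :
  {P : rep k Q & {f : hom P M | projective P /\ epi f}}.
Proof.
pose D := (\max_v \dim (fullv : {vspace M v}))%N.
pose gen v : 'Hom('rV[k]_D, M v) := linfun (fun r : 'rV[k]_D =>
  \sum_(j < D) r 0 j *: (vbasis (fullv : {vspace M v}))`_j).
have genE v r : gen v r =
    \sum_(j < D) r 0 j *: (vbasis (fullv : {vspace M v}))`_j.
  rewrite /gen linfun_apply // => c x y; rewrite scaler_sumr -big_split.
  by apply: eq_bigr => j _; rewrite !mxE scalerDl scalerA.
exists (free_rep 'rV[k]_D), (eval_hom gen); split; first exact: free_projective.
move=> v y; have [p pE] := trivial_path_ex v.
have dimD : (\dim (fullv : {vspace M v}) <= D)%N.
  exact: (leq_bigmax (F := fun v => \dim (fullv : {vspace M v}))).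
have [c cE] := vbasis_coords y dimD.
exists (single 'rV[k]_D p (\row_j c j)); rewrite eval_single pE /= genE cE.
by apply: eq_bigr => j _; rewrite mxE.
Qed.

Definition cover_rep M := projT1 (projective_cover M).
Definition cover_hom M : hom (cover_rep M) M :=
  proj1_sig (projT2 (projective_cover M)).
Lemma cover_projective M : projective (cover_rep M).
Proof. exact: (proj1 (proj2_sig (projT2 (projective_cover M)))). Qed.
Lemma cover_epi M : epi (cover_hom M).
Proof. exact: (proj2 (proj2_sig (projT2 (projective_cover M)))). Qed.

Fixpoint syzygy n M : rep k Q :=
  if n is n'.+1 then ker_rep (cover_hom (syzygy n' M)) else M.

Lemma resolution_exists (M : rep k Q) : inhabited (proj_resolution M).
Proof.
pose K n := syzygy n M.
pose i n : hom (K n.+1) (cover_rep (K n)) := ker_incl (cover_hom (K n)).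
have iE n : exact (i n) (cover_hom (K n)) by apply: ker_incl_exact.
have i0 n : mono (i n) by apply: ker_incl_mono.
constructor.
apply: (@ProjResolution k Q M (fun n => cover_rep (K n))
  (fun n => comp_hom (i n) (cover_hom (K n.+1))) (cover_hom M)).
- by move=> n; apply: cover_projective.
- exact: cover_epi.
- move=> v x; split=> [/(iE 0%N)[y <-]|[y <-]].
    by have [z <-] := cover_epi y; exists z; rewrite homE.
  by apply/(iE 0%N); rewrite homE; eexists.
- move=> n v x; split=> [|[y <-]]; rewrite homE.
    move/i0/(iE n.+1) => [y <-].
    by have [z <-] := cover_epi y; exists z; rewrite homE.
  rewrite homE.
  suff -> : cover_hom (K n.+1) v (i n.+1 v (cover_hom (K n.+2) v y)) = 0.
    by rewrite lfun0.
  by apply/(iE n.+1); eexists.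
Qed.

Lemma Ext_pos_zeroE (M N : rep k Q) : Ext_pos_zero M N <-> ext1_vanish M N.
Proof.
by split; [apply: Ext_pos_ext1; apply: resolution_exists|apply: ext1_Ext_pos].
Qed.

End PathAlgebra.

(** * Generation of the derived category *)

Section TotalHom.
Variables (k : fieldType) (Q : quiver) (M : rep k Q).
Implicit Types A B C N T : rep k Q.

(* Exactness in one degree of the total complex of
   [\prod_v Hom(X v, M v) -> \prod_a Hom(X (src a), M (tgt a))], which computes
   [RHom(X, M)]. *)
Definition total_exact A0 A1 A2 A3
    (d0 : hom A0 A1) (d1 : hom A1 A2) (d2 : hom A2 A3) :=
  forall (al : forall v, 'Hom(A1 v, M v))
    (be : forall a : arrow Q, 'Hom(A2 (src a), M (tgt a))),
  (forall v u, al v (d0 v u) = 0) ->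
  (forall a u, al (tgt a) (rmap A1 a u) - rmap M a (al (src a) u) =
    be a (d1 (src a) u)) ->
  exists (al' : forall v, 'Hom(A2 v, M v))
    (be' : forall a : arrow Q, 'Hom(A3 (src a), M (tgt a))),
  (forall v u, al v u = al' v (d1 v u)) /\
  (forall a u, be a u = al' (tgt a) (rmap A2 a u) - rmap M a (al' (src a) u) +
    be' a (d2 (src a) u)).

(** RHom(X, M) = 0, degree by degree. A cochain pairs a map on one degree of [X] with maps on the
    next, and a coboundary reaches one degree further, whence three consecutive differentials. *)
Definition orthogonal_cplx (X : cplx k Q) := forall i,
  total_exact (cdiff X i) (cdiff X (i + 1)) (cdiff X (i + 1 + 1)).

Lemma total_exact_opp A0 A1 A2 A3 (d0 e0 : hom A0 A1) (d1 e1 : hom A1 A2)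
    (d2 e2 : hom A2 A3) :
  (forall v u, e0 v u = - d0 v u) -> (forall v u, e1 v u = - d1 v u) ->
  (forall v u, e2 v u = - d2 v u) ->
  total_exact d0 d1 d2 -> total_exact e0 e1 e2.
Proof.
move=> E0 E1 E2 d al be ald bed.
have [||al' [be' [al'E be'E]]] := d al (fun a => - be a).
- by move=> v u; have := ald v u; rewrite E0 lfunN => /eqP; rewrite oppr_eq0 => /eqP.
- by move=> a u; rewrite bed E1 lfunN opp_lfunE.
exists (fun v => - al' v), be'; split=> [v u|a u].
  by rewrite E1 opp_lfunE lfunN opprK.
have := be'E a u; rewrite !opp_lfunE !lfunN E2 lfunN => E.
zmod_from E.
Qed.

(** Over a field both rows of the double complex inherit exactness, hence so does the total
    complex. *)
Lemma total_exact_acyclic A0 A1 A2 A3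
    (d0 : hom A0 A1) (d1 : hom A1 A2) (d2 : hom A2 A3) :
  exact d0 d1 -> exact d1 d2 -> total_exact d0 d1 d2.
Proof.
move=> ex1 ex2 al be ald bed.
have [al' al'E] : exists al' : (forall v, 'Hom(A2 v, M v)),
    forall v u, al' v (d1 v u) = al v u.
  exists (fun v => (al v \o (d1 v)^-1)%VF) => v u; rewrite comp_lfunE.
  by apply: lfun_inv_factor => w /ex1[y <-].
pose ga a : 'Hom(A2 (src a), M (tgt a)) :=
  be a - (al' (tgt a) \o rmap A2 a)%VF + (rmap M a \o al' (src a))%VF.
exists al', (fun a => (ga a \o (d2 (src a))^-1)%VF); split=> // a u.
rewrite comp_lfunE lfun_inv_factor; first by rewrite /ga !lfE; zmod.
move=> w /ex2[y <-]; rewrite /ga !lfE -bed -hom_rmap !al'E.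
by zmod.
Qed.

(** This lemma and the next treat the two degrees that matter for a stalk: in one the cochain is a
    homomorphism [al], in the other it represents a class [be] in Ext^1. *)
Lemma total_exact_hom A0 A1 A2 A3
    (d0 : hom A0 A1) (d1 : hom A1 A2) (d2 : hom A2 A3) :
  is_zero A2 -> hom_vanish A1 M -> total_exact d0 d1 d2.
Proof.
move=> A20 A1M al be _ bed.
have alP a u : al (tgt a) (rmap A1 a u) = rmap M a (al (src a) u).
  by apply/eqP; rewrite -subr_eq0 bed (A20 _ (d1 _ u)) lfun0.
exists (fun=> 0), (fun=> 0); split=> [v u|a u].
  by rewrite zero_lfunE; exact: (A1M (Hom alP)).
by rewrite (A20 _ u) !lfun0 subrr addr0.
Qed.

Lemma total_exact_ext A0 A1 A2 A3
    (d0 : hom A0 A1) (d1 : hom A1 A2) (d2 : hom A2 A3) :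
  is_zero A1 -> ext1_vanish A2 M -> total_exact d0 d1 d2.
Proof.
move=> A10 A2M al be _ _; have [f fE] := A2M be.
exists f, (fun=> 0); split=> [v u|a u].
  by rewrite (A10 _ u) !lfun0.
by rewrite fE zero_lfunE addr0.
Qed.

Lemma zero_hom_vanish N : is_zero N -> hom_vanish N M.
Proof. by move=> N0 f v u; rewrite (N0 _ u) lfun0. Qed.

Lemma zero_ext1 N : is_zero N -> ext1_vanish N M.
Proof.
move=> N0 g; exists (fun=> 0) => a u.
by rewrite (N0 _ u) !lfun0 subrr.
Qed.

Lemma orthogonal_stalk N :
  hom_vanish N M -> ext1_vanish N M -> orthogonal_cplx (stalk N).
Proof.
move=> NM1 NM2 i.
have st0 j : j != 0 -> is_zero (stalk N j).
  by move=> /negPf j0; rewrite /= j0; apply: zero_repP.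
have stE j : stalk N j = if j == 0 then N else zero_rep k Q by [].
have [i0|i0] := eqVneq (i + 1) 0.
  apply: total_exact_hom; first by apply: st0; rewrite i0.
  by rewrite stE; case: ifP => // _; apply: zero_hom_vanish; apply: zero_repP.
apply: total_exact_ext; first exact: st0.
by rewrite stE; case: ifP => // _; apply: zero_ext1; apply: zero_repP.
Qed.

Lemma orthogonal_shift X : orthogonal_cplx X <-> orthogonal_cplx (shift X).
Proof.
split=> XM i.
  by apply: total_exact_opp (XM (i + 1)) => v u /=; rewrite opp_lfunE.
have := XM (i - 1); rewrite /shift /= subrK.
by apply: total_exact_opp => v u /=; rewrite opp_lfunE opprK.
Qed.

Definition copair_lfun (U V W : vectType k) (f : 'Hom(U, W)) (g : 'Hom(V, W)) :
    'Hom((U * V)%type, W) := (f \o fst_lfun U V)%VF + (g \o snd_lfun U V)%VF.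
Lemma copair_lfunE (U V W : vectType k) (f : 'Hom(U, W)) (g : 'Hom(V, W)) u :
  copair_lfun f g u = f u.1 + g u.2.
Proof. by rewrite !lfE fst_lfunE snd_lfunE. Qed.

Definition left_lfun (U V W : vectType k) (f : 'Hom((U * V)%type, W)) :
    'Hom(U, W) := (f \o pair_lfun \1 0)%VF.
Definition right_lfun (U V W : vectType k) (f : 'Hom((U * V)%type, W)) :
    'Hom(V, W) := (f \o pair_lfun 0 \1)%VF.
Lemma left_lfunE (U V W : vectType k) (f : 'Hom((U * V)%type, W)) u :
  left_lfun f u = f (u, 0).
Proof. by rewrite comp_lfunE pair_lfunE id_lfunE zero_lfunE. Qed.
Lemma right_lfunE (U V W : vectType k) (f : 'Hom((U * V)%type, W)) u :
  right_lfun f u = f (0, u).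
Proof. by rewrite comp_lfunE pair_lfunE id_lfunE zero_lfunE. Qed.

Lemma pair_split (U V W : vectType k) (f : 'Hom((U * V)%type, W)) x y :
  f (x, y) = left_lfun f x + right_lfun f y.
Proof.
rewrite left_lfunE right_lfunE -lfunD; congr (f _).
by congr pair; rewrite /= ?addr0 ?add0r.
Qed.

(** * Two out of three for cones *)

Section Cone.
Variables (X Y : cplx k Q) (f : chain_map X Y).

Lemma cone_rmap i a (u : cone f i (src a)) :
  rmap (cone f i) a u = (rmap (X (i + 1)) a u.1, rmap (Y i) a u.2).
Proof. exact: dsum_rmapE. Qed.

Lemma cone_diffE i v (u : cone f i v) : cdiff (cone f) i v u =
  (- cdiff X (i + 1) v u.1, f (i + 1) v u.1 + cdiff Y i v u.2).
Proof. exact: cone_diff_atE. Qed.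

Lemma split_family i (al : forall v, 'Hom(cone f i v, M v)) :
  exists (al1 : forall v, 'Hom(X (i + 1) v, M v))
    (al2 : forall v, 'Hom(Y i v, M v)),
  forall v x y, al v (x, y) = al1 v x + al2 v y.
Proof.
exists (fun v => left_lfun (al v)), (fun v => right_lfun (al v)) => v x y.
exact: pair_split.
Qed.

Lemma split_arrow_family i
    (be : forall a : arrow Q, 'Hom(cone f i (src a), M (tgt a))) :
  exists (be1 : forall a : arrow Q, 'Hom(X (i + 1) (src a), M (tgt a)))
    (be2 : forall a : arrow Q, 'Hom(Y i (src a), M (tgt a))),
  forall a x y, be a (x, y) = be1 a x + be2 a y.
Proof.
exists (fun a => left_lfun (be a)), (fun a => right_lfun (be a)) => a x y.
exact: pair_split.
Qed.

(** The long exact sequence of RHom(-, M) on the triangle X -> Y -> cone, chased on components. *)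
Lemma orthogonal_cone :
  orthogonal_cplx X -> orthogonal_cplx Y -> orthogonal_cplx (cone f).
Proof.
move=> XM YM i al be ald bed.
have [al1 [al2 alE]] := split_family al.
have [be1 [be2 beE]] := split_arrow_family be.
have al2d v y : al2 v (cdiff Y i v y) = 0.
  have := ald v (0, y); rewrite cone_diffE /= alE !lfun0 oppr0 lfun0.
  by rewrite !add0r.
have al1d v x : al1 v (cdiff X (i + 1) v x) = al2 v (f (i + 1) v x).
  have := ald v (x, 0); rewrite cone_diffE /= alE lfunN lfun0 addr0.
  by rewrite addrC => /eqP; rewrite subr_eq0 => /eqP->.
have al2b a y : al2 (tgt a) (rmap (Y (i + 1)) a y) -
    rmap M a (al2 (src a) y) = be2 a (cdiff Y (i + 1) (src a) y).
  have := bed a (0, y); rewrite cone_rmap cone_diffE /= !alE beE.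
  by rewrite !lfun0 oppr0 lfun0 !add0r.
have al1b a x : al1 (tgt a) (rmap (X (i + 1 + 1)) a x) -
    rmap M a (al1 (src a) x) = - be1 a (cdiff X (i + 1 + 1) (src a) x) +
    be2 a (f (i + 1 + 1) (src a) x).
  have := bed a (x, 0); rewrite cone_rmap cone_diffE /= !alE beE.
  by rewrite lfunN !lfun0 !addr0.
have [al2' [be2' [al2E be2E]]] := YM i al2 be2 al2d al2b.
(* Comparing the solution on [Y], pulled back along [f], with the given components on [X] leaves the
   pair [ga], [ep], again a cocycle. *)
pose ga v : 'Hom(X (i + 1 + 1) v, M v) :=
  (al2' v \o f (i + 1 + 1) v)%VF - al1 v.
pose ep a : 'Hom(X (i + 1 + 1 + 1) (src a), M (tgt a)) :=
  be1 a - (be2' a \o f (i + 1 + 1 + 1) (src a))%VF.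
have gad v x : ga v (cdiff X (i + 1) v x) = 0.
  by rewrite !lfE al1d al2E cm_comm subrr.
have gab a x : ga (tgt a) (rmap (X (i + 1 + 1)) a x) -
    rmap M a (ga (src a) x) = ep a (cdiff X (i + 1 + 1) (src a) x).
  rewrite !lfE !lfunB cm_comm; have := al1b a x; rewrite be2E hom_rmap => E.
  zmod_from E.
have [al1' [be1' [gaE epE]]] := XM (i + 1) ga ep gad gab.
exists (fun v => copair_lfun (al1' v) (al2' v)).
exists (fun a => copair_lfun (- be1' a) (be2' a)).
split=> [v [x y]|a [x y]].
  rewrite cone_diffE copair_lfunE /= alE al2E lfunD lfunN -gaE !lfE.
  by zmod.
rewrite cone_rmap cone_diffE !copair_lfunE /= beE be2E !lfunD lfunN !lfE.
have := epE a x; rewrite !lfE => E.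
zmod_from E.
Qed.

Lemma orthogonal_cone_source :
  orthogonal_cplx (cone f) -> orthogonal_cplx Y -> orthogonal_cplx X.
Proof.
(* The cone has [X] shifted by one degree, so [i] is first written as a successor. *)
move=> CM YM i; rewrite -(subrK 1 i); move: (i - 1) => {}i al be ald bed.
have [||al' [be' [al'E be'E]]] := CM i
  (fun v => copair_lfun (al v) 0) (fun a => copair_lfun (- be a) 0).
- move=> v [x y]; rewrite cone_diffE copair_lfunE /= lfunN ald oppr0.
  by rewrite zero_lfunE addr0.
- move=> a [x y]; rewrite cone_rmap cone_diffE !copair_lfunE /=.
  by rewrite !zero_lfunE !addr0 opp_lfunE lfunN opprK bed.
have [al1 [al2 alE]] := split_family al'.
have [be1 [be2 beE]] := split_arrow_family be'.
have al2d v y : al2 v (cdiff Y (i + 1) v y) = 0.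
  have := al'E v (0, y); rewrite cone_diffE copair_lfunE /= alE.
  by rewrite !lfun0 oppr0 lfun0 !add0r zero_lfunE => <-.
have alE1 v x : al v x = - al1 v (cdiff X (i + 1 + 1) v x) +
    al2 v (f (i + 1 + 1) v x).
  have := al'E v (x, 0); rewrite cone_diffE copair_lfunE /= alE.
  by rewrite !lfun0 !addr0 lfunN => <-.
have al2b a y : al2 (tgt a) (rmap (Y (i + 1 + 1)) a y) -
    rmap M a (al2 (src a) y) = (- be2 a) (cdiff Y (i + 1 + 1) (src a) y).
  have := be'E a (0, y); rewrite cone_rmap cone_diffE copair_lfunE /= !alE beE.
  rewrite !lfun0 oppr0 !lfun0 !add0r zero_lfunE opp_lfunE => E.
  zmod_from E.
have beE1 a x : - be a x = al1 (tgt a) (rmap (X (i + 1 + 1 + 1)) a x) -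
    rmap M a (al1 (src a) x) - be1 a (cdiff X (i + 1 + 1 + 1) (src a) x) +
    be2 a (f (i + 1 + 1 + 1) (src a) x).
  have := be'E a (x, 0); rewrite cone_rmap cone_diffE copair_lfunE /= !alE beE.
  rewrite !lfun0 !addr0 lfunN opp_lfunE => E.
  zmod_from E.
(* The [Y] components of the solution need not vanish, but up to sign they form a cocycle on [Y].
   Its trivialization, pulled back along [f], corrects the [X] components. *)
have [al3 [be3 [al3E be3E]]] := YM (i + 1) al2 (fun a => - be2 a) al2d al2b.
exists (fun v => - al1 v + (al3 v \o f (i + 1 + 1 + 1) v)%VF).
exists (fun a => be1 a + (be3 a \o f (i + 1 + 1 + 1 + 1) (src a))%VF).
split=> [v x|a x].
  by rewrite alE1 al3E !lfE cm_comm.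
have E1 := be3E a (f (i + 1 + 1 + 1) (src a) x).
rewrite opp_lfunE -cm_comm in E1.
have E2 := beE1 a x; rewrite !lfE !lfunD lfunN -hom_rmap in E1 *.
have -> : be a x = - (al1 (tgt a) (rmap (X (i + 1 + 1 + 1)) a x) -
    rmap M a (al1 (src a) x) - be1 a (cdiff X (i + 1 + 1 + 1) (src a) x) +
    be2 a (f (i + 1 + 1 + 1) (src a) x)) by rewrite -E2 opprK.
zmod_from E1.
Qed.

Lemma orthogonal_cone_target :
  orthogonal_cplx (cone f) -> orthogonal_cplx X -> orthogonal_cplx Y.
Proof.
move=> CM XM i al be ald bed.
have [||al1 [be1 [al1E be1E]]] := XM i (fun v => (al v \o f (i + 1) v)%VF)
    (fun a => (be a \o f (i + 1 + 1) (src a))%VF).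
- by move=> v u; rewrite comp_lfunE cm_comm ald.
- by move=> a u; rewrite !comp_lfunE cm_comm -bed hom_rmap.
(* The cocycle on [Y] becomes a coboundary on [X] after [f]; the pair [al1], [be1] extends it to a
   cocycle on the cone. *)
have [||al' [be' [al'E be'E]]] := CM i
  (fun v => copair_lfun (al1 v) (al v)) (fun a => copair_lfun (be1 a) (be a)).
- move=> v [x y]; rewrite cone_diffE copair_lfunE /= lfunN -al1E comp_lfunE.
  by rewrite lfunD ald addr0 addNr.
- move=> a [x y]; rewrite cone_rmap cone_diffE !copair_lfunE /= !lfunD lfunN.
  have := be1E a x; rewrite comp_lfunE -bed => ->.
  by zmod.
have [al1' [al2' alE]] := split_family al'.
have [be1' [be2' beE]] := split_arrow_family be'.
exists al2', be2'; split=> [v y|a y].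
  have := al'E v (0, y); rewrite cone_diffE copair_lfunE /= alE.
  by rewrite !lfun0 oppr0 lfun0 !add0r.
have := be'E a (0, y); rewrite cone_rmap cone_diffE copair_lfunE /= !alE beE.
by rewrite !lfun0 oppr0 !lfun0 !add0r.
Qed.

Lemma cone_acyclic : quasi_iso f -> forall i,
  exact (cdiff (cone f) i) (cdiff (cone f) (i + 1)).
Proof.
move=> qf i v u; split=> [|[w <-]]; last exact: cdiff2.
case: u => x y; rewrite cone_diffE /= => -[/eqP]; rewrite oppr_eq0 => /eqP dx.
move=> fxdy.
have [inj_i _] := qf (i + 1) v; have [_ surj_i] := qf i v.
have [x' x'E] : exists x', cdiff X (i + 1) v x' = x.
  apply: inj_i => //; exists (- y); rewrite lfunN.
  by apply/eqP; rewrite eq_sym -addr_eq0 fxdy.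
have cyc : cdiff Y (i + 1) v (y + f (i + 1) v x') = 0.
  by rewrite lfunD -cm_comm x'E; zmod_from fxdy.
have [x2 [y' [dx2 yE]]] := surj_i _ cyc.
exists (x2 - x', y'); rewrite cone_diffE /= !lfunB dx2 x'E; congr pair.
  by zmod.
zmod_from yE.
Qed.

End Cone.

Lemma orthogonal_qis (X Y : cplx k Q) (f : chain_map X Y) : quasi_iso f ->
  orthogonal_cplx X <-> orthogonal_cplx Y.
Proof.
move=> qf; have CM : orthogonal_cplx (cone f).
  by move=> i; apply: total_exact_acyclic; apply: cone_acyclic.
by split; [apply: orthogonal_cone_target|apply: orthogonal_cone_source].
Qed.

Lemma orthogonal_triangulated : triangulated_subcat orthogonal_cplx.
Proof.
split.
- apply: orthogonal_stalk; first exact/zero_hom_vanish/zero_repP.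
  exact/zero_ext1/zero_repP.
- by move=> X Y f _ _; apply: orthogonal_qis.
- by move=> X _; apply: orthogonal_shift.
- by move=> X Y f _ _; apply: orthogonal_cone.
Qed.

(** The identity of [M] is a cocycle, and as a coboundary it factors through the zero differential
    of the stalk. The argument [-1] places it in degree 0, since [total_exact] concerns degree i +
    1. *)
Lemma orthogonal_self : orthogonal_cplx (stalk M) -> is_zero M.
Proof.
move=> MM v u.
have [||al [be [alE _]]] := MM (-1) (fun v => \1%VF) (fun=> 0).
- by move=> w x; rewrite id_lfunE; apply: zero_homE.
- by move=> a x; rewrite !id_lfunE zero_lfunE subrr.
by have := alE v u; rewrite id_lfunE /= zero_lfunE lfun0.
Qed.

End TotalHom.

Lemma stalk_bounded (k : fieldType) (Q : quiver) (M : rep k Q) :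
  bounded (stalk M).
Proof.
exists 0%N => i i0 /=; rewrite (_ : (i == 0) = false); first exact: zero_repP.
by apply/negbTE; rewrite -absz_gt0.
Qed.

Lemma generates_perp_trivial (k : fieldType) (Q : quiver) (T : rep k Q) :
  generates_Db (fun M => is_summand M T) -> perp_trivial T.
Proof.
move=> gen M TM1 TM2; apply: orthogonal_self.
apply: (gen _ (orthogonal_triangulated M)) (stalk_bounded M).
move=> N /summand_retract NT; apply: orthogonal_stalk.
  exact: hom_vanish_retract_left NT TM1.
exact: ext1_retract_left NT TM2.
Qed.

(** * Closure properties of triangulated subcategories *)

Section Complexes.
Variables (k : fieldType) (Q : quiver).
Implicit Types (A B M N K T : rep k Q) (X Y Z : cplx k Q).

Lemma dsum_is_zero A B : is_zero A -> is_zero B -> is_zero (dsum A B).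
Proof. by move=> A0 B0 v [x y]; rewrite (A0 _ x) (B0 _ y). Qed.

Lemma bounded_shift X : bounded X -> bounded (shift X).
Proof. by case=> n Xn; exists n.+1 => i lt_i; apply: Xn; lia. Qed.

Lemma bounded_cone X Y (f : chain_map X Y) :
  bounded X -> bounded Y -> bounded (cone f).
Proof.
case=> n Xn [m Ym]; exists (n + m).+1 => i lt_i.
by apply: dsum_is_zero; [apply: Xn|apply: Ym]; lia.
Qed.

Lemma iso_quasi_iso X Y (f : chain_map X Y) :
  (forall i, mono (f i)) -> (forall i, epi (f i)) -> quasi_iso f.
Proof.
move=> f0 f1 i v; split=> [x dx [y yE]|y dy].
  have [x' x'E] := f1 i v y; exists x'.
  by apply: (lfunB0_inj (@f0 (i + 1) v)); rewrite cm_comm x'E.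
have [x xE] := f1 (i + 1) v y; exists x, 0; split; last first.
  by rewrite lfun0 addr0 xE.
by apply: (f0 (i + 1 + 1) v); rewrite cm_comm xE.
Qed.

Section ShortExactCplx.
Variables (X Y Z : cplx k Q) (f : chain_map X Y) (g : chain_map Y Z).
Hypotheses (f0 : forall i, mono (f i)) (g1 : forall i, epi (g i)).
Hypothesis fg : forall i, exact (f i) (g i).

Let gf i v x : g i v (f i v x) = 0.
Proof. by apply/fg; exists x. Qed.

Lemma cone_to_subproof (i : int) v (x : cone f i v) :
  comp_hom (g (i + 1)) (snd_hom (X (i + 1 + 1)) (Y (i + 1))) v
    (cdiff (cone f) i v x) =
  cdiff Z i v (comp_hom (g i) (snd_hom (X (i + 1)) (Y i)) v x).
Proof.
by rewrite cone_diffE !comp_homE !snd_homE /= lfunD gf add0r cm_comm.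
Qed.
Definition cone_to : chain_map (cone f) Z :=
  @ChainMap k Q (cone f) Z
    (fun i => comp_hom (g i) (snd_hom (X (i + 1)) (Y i))) cone_to_subproof.

(** [triangulated_subcat] speaks of cones only; this makes the quotient in a short exact sequence of
    complexes accessible to it. *)
Lemma cone_to_quasi_iso : quasi_iso cone_to.
Proof.
have toE i v u : cone_to i v u = g i v u.2.
  by rewrite [LHS]comp_homE snd_homE.
move=> i v; split=> [[x y]|z dz].
  rewrite cone_diffE toE /= => -[/eqP]; rewrite oppr_eq0 => /eqP dx fxdy [z].
  have [y0 <-] := @g1 i v z; rewrite -cm_comm => gE.
  have [x0 x0E] : exists x0, f (i + 1) v x0 = y - cdiff Y i v y0.
    by apply/fg; rewrite lfunB gE subrr.
  exists (x0, y0); rewrite cone_diffE /=; congr pair; last first.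
    by rewrite x0E subrK.
  apply: (lfunB0_inj (@f0 (i + 1 + 1) v)); rewrite lfunN cm_comm x0E.
  by rewrite lfunB cdiff2; zmod_from fxdy.
have [y yE] := @g1 (i + 1) v z.
have [x xE] : exists x, f (i + 1 + 1) v x = cdiff Y (i + 1) v y.
  by apply/fg; rewrite cm_comm yE.
have dx : cdiff X (i + 1 + 1) v x = 0.
  by apply: (@f0 (i + 1 + 1 + 1) v); rewrite cm_comm xE cdiff2.
exists (- x, y), 0; rewrite cone_diffE toE /= yE lfun0 addr0; split=> //.
by rewrite !lfunN dx xE addNr !oppr0.
Qed.

Lemma shift_to_subproof (i : int) v (x : shift X i v) :
  comp_hom (inl_hom (Y (i + 1 + 1)) (Z (i + 1))) (f (i + 1 + 1)) v
    (cdiff (shift X) i v x) =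
  cdiff (cone g) i v (comp_hom (inl_hom (Y (i + 1)) (Z i)) (f (i + 1)) v x).
Proof.
rewrite cone_diffE !comp_homE !inl_homE /= opp_lfunE lfunN cm_comm gf.
by rewrite lfun0 addr0.
Qed.
Definition shift_to : chain_map (shift X) (cone g) :=
  @ChainMap k Q (shift X) (cone g)
    (fun i => comp_hom (inl_hom (Y (i + 1)) (Z i)) (f (i + 1)))
    shift_to_subproof.

(** The companion of [cone_to_quasi_iso] that recovers the subcomplex, up to a shift, from the other
    two terms. *)
Lemma shift_to_quasi_iso : quasi_iso shift_to.
Proof.
have toE i v u : shift_to i v u = (f (i + 1) v u, 0).
  by rewrite [LHS]comp_homE inl_homE.
have dE i v x : cdiff (shift X) i v x = - cdiff X (i + 1) v x.
  exact: opp_lfunE.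
move=> i v; split=> [x|[y z]].
  rewrite dE toE => /eqP; rewrite oppr_eq0 => /eqP dx [[y z]].
  rewrite cone_diffE /= => -[fE gE].
  have [y0 y0E] := @g1 i v z.
  have [x0 x0E] : exists x0, f (i + 1) v x0 = y + cdiff Y i v y0.
    by apply/fg; rewrite lfunD cm_comm y0E.
  exists x0; rewrite dE; apply: (lfunB0_inj (@f0 (i + 1 + 1) v)).
  by rewrite lfunN cm_comm x0E lfunD cdiff2 addr0.
rewrite cone_diffE /= => -[/eqP]; rewrite oppr_eq0 => /eqP dy gydz.
have [y0 y0E] := @g1 (i + 1) v z.
have [x xE] : exists x, f (i + 1 + 1) v x = y + cdiff Y (i + 1) v y0.
  by apply/fg; rewrite lfunD cm_comm y0E.
exists x, (y0, 0); rewrite dE toE cone_diffE /=; split.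
  suff -> : cdiff X (i + 1 + 1) v x = 0 by rewrite oppr0.
  apply: (@f0 (i + 1 + 1 + 1) v).
  by rewrite cm_comm xE lfunD dy cdiff2 addr0.
congr pair => /=; first by rewrite xE addrK.
by rewrite y0E lfun0 addr0 add0r.
Qed.

End ShortExactCplx.

Section Triangulated.
Variable C : cplx k Q -> Prop.
Hypothesis CT : triangulated_subcat C.

Section ShortExactClosure.
Variables (X Y Z : cplx k Q) (f : chain_map X Y) (g : chain_map Y Z).
Hypotheses (f0 : forall i, mono (f i)) (g1 : forall i, epi (g i)).
Hypothesis fg : forall i, exact (f i) (g i).
Hypotheses (Xb : bounded X) (Yb : bounded Y) (Zb : bounded Z).

Lemma tri_ses_right : C X -> C Y -> C Z.
Proof.
move=> CX CY; have := cone_to_quasi_iso f0 g1 fg.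
move=> /(tri_qis CT (bounded_cone f Xb Yb) Zb) <-.
exact: tri_cone CT _ _ _ Xb Yb CX CY.
Qed.

Lemma tri_ses_left : C Y -> C Z -> C X.
Proof.
move=> CY CZ; apply/(tri_shift CT Xb).
have := shift_to_quasi_iso f0 g1 fg.
move=> /(tri_qis CT (bounded_shift Xb) (bounded_cone g Yb Zb)) ->.
exact: tri_cone CT _ _ _ Yb Zb CY CZ.
Qed.

End ShortExactClosure.

Section ConeTriangle.
Variables (X Y : cplx k Q) (f : chain_map X Y).

Lemma cone_in_subproof (i : int) v (y : Y i v) :
  inr_hom (X (i + 1 + 1)) (Y (i + 1)) v (cdiff Y i v y) =
  cdiff (cone f) i v (inr_hom (X (i + 1)) (Y i) v y).
Proof. by rewrite cone_diffE !inr_homE /= !lfun0 oppr0 add0r. Qed.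
Definition cone_in : chain_map Y (cone f) :=
  @ChainMap k Q Y (cone f) (fun i => inr_hom (X (i + 1)) (Y i))
    cone_in_subproof.

Lemma cone_out_subproof (i : int) v (x : cone f i v) :
  fst_hom (X (i + 1 + 1)) (Y (i + 1)) v (cdiff (cone f) i v x) =
  cdiff (shift X) i v (fst_hom (X (i + 1)) (Y i) v x).
Proof. by rewrite cone_diffE !fst_homE /= opp_lfunE. Qed.
Definition cone_out : chain_map (cone f) (shift X) :=
  @ChainMap k Q (cone f) (shift X) (fun i => fst_hom (X (i + 1)) (Y i))
    cone_out_subproof.

(** Y -> cone -> X[1] is a short exact sequence of complexes. *)
Lemma tri_cone_target : bounded X -> bounded Y -> C X -> C (cone f) -> C Y.
Proof.
move=> Xb Yb CX Cf; apply: (@tri_ses_left _ _ _ cone_in cone_out).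
- by move=> i v y; rewrite [cone_in i v y]inr_homE => -[].
- by move=> i v x; exists (x, 0); rewrite [LHS]fst_homE.
- move=> i v [x y]; rewrite [cone_out i v _]fst_homE /=; split=> [->|[y']].
    by exists y; rewrite [LHS]inr_homE.
  by rewrite [cone_in i v _]inr_homE => -[].
- exact: Yb.
- exact: bounded_cone.
- exact: bounded_shift.
- exact: Cf.
- exact/(tri_shift CT Xb).
Qed.

End ConeTriangle.

Lemma tri_ses_middle X Y Z (f : chain_map X Y) (g : chain_map Y Z) :
  (forall i, mono (f i)) -> (forall i, epi (g i)) ->
  (forall i, exact (f i) (g i)) -> bounded X -> bounded Y -> bounded Z ->
  C X -> C Z -> C Y.
Proof.
move=> f0 g1 fg Xb Yb Zb CX CZ; apply: (tri_cone_target (f := f)) => //.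
exact/(tri_qis CT (bounded_cone f Xb Yb) Zb (cone_to_quasi_iso f0 g1 fg)).
Qed.

Definition keep (b : bool) M := if b then M else zero_rep k Q.

Definition keep_hom b c M N (f : hom M N) : hom (keep b M) (keep c N) :=
  match b, c with
  | true, true => f
  | b, c => zero_hom (keep b M) (keep c N)
  end.

Lemma keep_zero b M : ~~ b -> is_zero (keep b M).
Proof. by case: b => // _; apply: zero_repP. Qed.

Lemma zero_rep_eq v (x y : zero_rep k Q v) : x = y.
Proof. by rewrite (@zero_repP k Q v x) (@zero_repP k Q v y). Qed.

Lemma keep_mono b M N (f : hom M N) : mono f -> mono (keep_hom b b f).
Proof. by case: b => // _ v u _; apply: zero_rep_eq. Qed.
Lemma keep_epi b M N (f : hom M N) : epi f -> epi (keep_hom b b f).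
Proof. by case: b => // _ v u; exists 0; apply: zero_rep_eq. Qed.
Lemma keep_exact b M N K (f : hom M N) (g : hom N K) :
  exact f g -> exact (keep_hom b b f) (keep_hom b b g).
Proof.
case: b => // _ v u; split=> [_|_]; last exact: zero_rep_eq.
by exists 0; apply: zero_rep_eq.
Qed.

(** [stalk_at 0 M] is convertible to [stalk M], and the two are used interchangeably. *)
Definition stalk_at (a : int) M : cplx k Q :=
  let F := fun i : int => keep (i == a) M in
  {| cobj := F;
     cdiff := fun i => zero_hom (F i) (F (i + 1));
     cdiff2 := stalk_subproof (F := F) |}.

Lemma stalk_at_bounded a M : bounded (stalk_at a M).
Proof.
by exists `|a|%N => i lt_i; apply: keep_zero; apply/negP => /eqP; lia.
Qed.

Lemma stalk_map_subproof a M N (f : hom M N) (i : int) v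
    (x : stalk_at a M i v) :
  keep_hom (i + 1 == a) (i + 1 == a) f v (cdiff (stalk_at a M) i v x) =
  cdiff (stalk_at a N) i v (keep_hom (i == a) (i == a) f v x).
Proof. by rewrite /= !zero_lfunE lfun0. Qed.
Definition stalk_map a M N (f : hom M N) :
    chain_map (stalk_at a M) (stalk_at a N) :=
  @ChainMap k Q (stalk_at a M) (stalk_at a N)
    (fun i => keep_hom (i == a) (i == a) f)
    (@stalk_map_subproof a M N f).

Lemma stalk_shift_subproof a M (i : int) v (x : stalk_at (a - 1) M i v) :
  keep_hom (i + 1 == a - 1) (i + 1 + 1 == a) (id_hom M) v
    (cdiff (stalk_at (a - 1) M) i v x) =
  cdiff (shift (stalk_at a M)) i v
    (keep_hom (i == a - 1) (i + 1 == a) (id_hom M) v x).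
Proof. by rewrite /= opp_lfunE !zero_lfunE lfun0 oppr0. Qed.
Definition stalk_shift a M :
    chain_map (stalk_at (a - 1) M) (shift (stalk_at a M)) :=
  @ChainMap k Q (stalk_at (a - 1) M) (shift (stalk_at a M))
    (fun i => keep_hom (i == a - 1) (i + 1 == a) (id_hom M))
    (@stalk_shift_subproof a M).

Lemma stalk_shift_quasi_iso a M : quasi_iso (stalk_shift a M).
Proof.
have eb (i : int) : (i + 1 == a) = (i == a - 1).
  by apply/eqP/eqP => [<-|->]; rewrite ?addrK ?subrK.
have idm : mono (id_hom M) by move=> v u; rewrite id_homE.
have ide : epi (id_hom M) by move=> v u; exists u; rewrite id_homE.
apply: iso_quasi_iso => i /=; rewrite eb.
  exact: keep_mono.
exact: keep_epi.
Qed.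

Lemma tri_stalk_at a M : C (stalk_at 0 M) -> C (stalk_at a M).
Proof.
have step b : C (stalk_at b M) <-> C (stalk_at (b - 1) M).
  rewrite (tri_shift CT (stalk_at_bounded b M)).
  symmetry; apply: (tri_qis CT (stalk_at_bounded _ _)
    (bounded_shift (stalk_at_bounded _ _)) (stalk_shift_quasi_iso b M)).
case: a => n CM.
  elim: n => [//|n IH]; apply: (proj2 (step _)).
  by have -> : n.+1%:Z - 1 = n%:Z by lia.
elim: n => [|n IH]; first exact: (proj1 (step 0)).
have -> : Negz n.+1 = Negz n - 1 by lia.
exact: (proj1 (step _)).
Qed.

Lemma tri_stalk_iso M N : iso M N -> C (stalk_at 0 M) -> C (stalk_at 0 N).
Proof.
case=> f [g fg]; apply: (proj1 (tri_qis CT (f := stalk_map 0 f) _ _ _)).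
- exact: stalk_at_bounded.
- exact: stalk_at_bounded.
apply: iso_quasi_iso => i /=.
  by apply: keep_mono => v u fu; rewrite -((fg v).1 u) fu lfun0.
by apply: keep_epi => v u; exists (g v u); rewrite (fg v).2.
Qed.

Lemma tri_stalk_ses A B M (f : hom A B) (g : hom B M) :
  mono f -> epi g -> exact f g ->
  [/\ C (stalk A) -> C (stalk B) -> C (stalk M),
      C (stalk B) -> C (stalk M) -> C (stalk A) &
      C (stalk A) -> C (stalk M) -> C (stalk B)].
Proof.
move=> f0 g1 fg.
have f0' i : mono (stalk_map 0 f i) by apply: keep_mono.
have g1' i : epi (stalk_map 0 g i) by apply: keep_epi.
have fg' i : exact (stalk_map 0 f i) (stalk_map 0 g i) by apply: keep_exact.
have [Ab Bb] := (stalk_at_bounded 0 A, stalk_at_bounded 0 B).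
have Mb := stalk_at_bounded 0 M.
by split; [exact: tri_ses_right f0' g1' fg' Ab Bb Mb|
  exact: tri_ses_left f0' g1' fg' Ab Bb Mb|
  exact: tri_ses_middle f0' g1' fg' Ab Bb Mb].
Qed.

Lemma tri_stalk_dsum A B : C (stalk A) -> C (stalk B) -> C (stalk (dsum A B)).
Proof.
have [_ _] := tri_stalk_ses (@inl_hom_mono k Q A B) (@snd_hom_epi k Q A B)
  (@dsum_exact k Q A B).
exact.
Qed.

Section FromStalks.
Hypothesis CM : forall M, C (stalk M).

(** [X] is a stalk only up to isomorphism: its terms away from [a] are zero without being
    [zero_rep]. *)
Lemma tri_concentrated X a :
  (forall i, i != a -> is_zero (X i)) -> C X.
Proof.
move=> Xa.
have Xb : bounded X by exists `|a|%N => i lt_i; apply: Xa; apply/eqP; lia.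
have F i : {f : hom (X i) (stalk_at a (X a) i) | mono f /\ epi f}.
  rewrite /=; case: (i =P a) => [->|ia].
    by exists (id_hom _); split=> v u; [rewrite id_homE|exists u; rewrite id_homE].
  exists (zero_hom _ _); split=> v u; first by move=> _; apply: Xa; apply/eqP.
  by exists 0; apply: zero_rep_eq.
have comm i v x : sval (F (i + 1)) v (cdiff X i v x) =
    cdiff (stalk_at a (X a)) i v (sval (F i) v x).
  rewrite /= zero_lfunE.
  have [ia|ia] := eqVneq i a.
    rewrite (_ : cdiff X i v x = 0) ?lfun0 //; apply: Xa; apply/eqP; lia.
  by rewrite (Xa i ia v x) !lfun0.
apply/(tri_qis CT (f := @ChainMap k Q X (stalk_at a (X a)) (fun i => sval (F i)) comm) Xb (stalk_at_bounded _ _)).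
  by apply: iso_quasi_iso => i /=; case: (svalP (F i)).
by apply: tri_stalk_at; apply: CM.
Qed.

Lemma truncation_subproof (p : pred int) X (i : int) v
   (x : keep (p i) (X i) v) :
  keep_hom (p (i + 1)) (p (i + 1 + 1)) (cdiff X (i + 1)) v
    (keep_hom (p i) (p (i + 1)) (cdiff X i) v x) = 0.
Proof.
case: (p i) x => x; case: (p (i + 1)); case: (p (i + 1 + 1)) => /=;
  by rewrite ?zero_lfunE ?lfun0 ?cdiff2 ?zero_lfunE.
Qed.
Definition truncation (p : pred int) X : cplx k Q :=
  @Cplx k Q (fun i => keep (p i) (X i))
    (fun i => keep_hom (p i) (p (i + 1)) (cdiff X i))
    (@truncation_subproof p X).

Lemma truncation_bounded p X : bounded X -> bounded (truncation p X).
Proof.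
case=> n Xn; exists n => i /Xn X0 /=; case: (p i) => //.
exact: zero_repP.
Qed.

(* For [p] an up-closed set of degrees, the brutal truncation to [p] is a
   subcomplex whose quotient is the truncation to the complement. *)
Lemma tri_truncation (p : pred int) X : (forall i, p i -> p (i + 1)) -> bounded X ->
  C (truncation p X) -> C (truncation (predC p) X) -> C X.
Proof.
move=> pS Xb.
have inP i v x : keep_hom (p (i + 1)) true (id_hom (X (i + 1))) v
    (cdiff (truncation p X) i v x) =
    cdiff X i v (keep_hom (p i) true (id_hom (X i)) v x).
  move: x; rewrite /=; have := pS i; case: (p i); case: (p (i + 1)) => /= h x;
    rewrite ?id_lfunE ?zero_lfunE ?lfun0 //.
  by have := h isT.
have outP i v x : keep_hom true (~~ p (i + 1)) (id_hom (X (i + 1))) v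
    (cdiff X i v x) =
    cdiff (truncation (predC p) X) i v (keep_hom true (~~ p i) (id_hom (X i)) v x).
  rewrite /=; have := pS i; case: (p i); case: (p (i + 1)) => /= h;
    rewrite ?id_lfunE ?zero_lfunE ?lfun0 //.
  by have := h isT.
apply: (tri_ses_middle (f := @ChainMap k Q (truncation p X) X _ inP)
  (g := @ChainMap k Q X (truncation (predC p) X) _ outP)).
- move=> i v /= u; case: (p i) u => u /=; first by rewrite id_lfunE.
  by move=> _; apply: zero_rep_eq.
- move=> i v /=; case: (p i) => /= u; last by exists u; rewrite id_lfunE.
  by exists 0; apply: zero_rep_eq.
- move=> i v u /=; case: (p i) => /=.
    by split=> [_|_]; [exists u; rewrite id_lfunE|apply: zero_rep_eq].
  split=> [|[y <-]]; last by rewrite zero_lfunE lfun0.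
  by rewrite id_lfunE => ->; exists 0; rewrite lfun0.
- exact: truncation_bounded.
- exact: Xb.
- exact: truncation_bounded.
Qed.

(** Induction on the width, splitting off the lowest degree [a] by a brutal truncation. *)
Lemma tri_interval n X (a : int) :
  (forall i, ~~ (a <= i < a + n%:Z) -> is_zero (X i)) -> C X.
Proof.
elim: n X a => [|n IH] X a Xa.
  by apply: (@tri_concentrated X 0) => i _; apply: Xa; lia.
have Xb : bounded X by exists (`|a| + n.+1)%N => i lt_i; apply: Xa; lia.
apply: (@tri_truncation (fun i => a < i) X _ Xb).
- by move=> i /= lt_ai; lia.
- apply: (IH _ (a + 1)) => i iP /=; case: (boolP (a < i)) => lt_ai;
    last exact: keep_zero.
  by apply: Xa; lia.
- apply: (@tri_concentrated _ a) => i ia /=; case: (boolP (a < i)) => lt_ai;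
    first exact: keep_zero.
  by apply: Xa; lia.
Qed.

Lemma tri_bounded X : bounded X -> C X.
Proof.
case=> n Xn; apply: (@tri_interval (n + n).+1 X (- n%:Z)) => i iP.
by apply: Xn; lia.
Qed.

End FromStalks.

Lemma tri_tilting T : ext1_vanish T T -> perp_trivial T ->
  (forall M, is_summand M T -> C (stalk M)) -> forall M, C (stalk M).
Proof.
move=> TT T0 CTs.
(* [C] is not assumed to be closed under direct summands. The Krull-Schmidt theorem makes up for
   this: every indecomposable summand of a power of [T] is a summand of [T] itself. *)
have powT n M : retract M (pow_rep 'I_n T) -> C (stalk M).
  move=> Mr; apply: (@additive_property k Q (fun N => C (stalk N))) => [A B|||K Ki KM].
  - exact: tri_stalk_iso.
  - exact: tri_zero.
  - exact: tri_stalk_dsum.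
  - apply: CTs; apply/summand_retract.
    exact: retract_pow_indecomposable Ki (retract_trans KM Mr).
have perpT E : ext1_vanish T E -> C (stalk E).
  move=> TE; have [n [m [K [i [p [i0 p1 ip Kr]]]]]] := perp_resolution TT T0 TE.
  have [+ _ _] := tri_stalk_ses i0 p1 ip; apply; first exact: powT Kr.
  exact: powT (retract_refl _).
move=> M; have [n [E [i [p [i0 p1 ip TE]]]]] := universal_extension M TT.
have [_ + _] := tri_stalk_ses i0 p1 ip; apply; first exact: perpT.
exact: powT (retract_refl _).
Qed.

End Triangulated.

Lemma perp_trivial_generates T : ext1_vanish T T -> perp_trivial T ->
  generates_Db (fun M => is_summand M T).
Proof.
by move=> TT T0 C CT CTs X; apply: (tri_bounded CT (tri_tilting CT TT T0 CTs)).
Qed.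

End Complexes.

(** * Flip-flops of preorders *)

(* [Z] is the poset of equivalence classes of the preorder [le] on [P]. *)
Record poset_reflection (A : Type) (P : A -> Prop) (le : A -> A -> Prop)
    (Z : Type) (leZ : Z -> Z -> Prop) (r : Z -> A) : Prop := PosetReflection {
  refl_mem : forall z, P (r z);
  refl_le : forall z z', leZ z z' <-> le (r z) (r z');
  refl_surj : forall a, P a -> exists z, le a (r z) /\ le (r z) a;
  refl_anti : forall z z', leZ z z' -> leZ z' z -> z = z' }.

Record preorder_on (A : Type) (P : A -> Prop) (le : A -> A -> Prop) : Prop :=
  PreorderOn {
  pre_refl : forall a, P a -> le a a;
  pre_trans : forall a b c, P a -> P b -> P c -> le a b -> le b c -> le a c }.

Section ReflectionClass.
Variables (A : Type) (P : A -> Prop) (le : A -> A -> Prop).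
Variables (Z : Type) (leZ : Z -> Z -> Prop) (r : Z -> A).
Hypothesis rZ : poset_reflection P le leZ r.

Definition refl_class (a : A) (Pa : P a) : Z :=
  proj1_sig (constructive_indefinite_description _ (refl_surj rZ Pa)).

Lemma refl_classP (a : A) (Pa : P a) :
  le a (r (refl_class Pa)) /\ le (r (refl_class Pa)) a.
Proof.
exact: (proj2_sig (constructive_indefinite_description _ (refl_surj rZ Pa))).
Qed.

End ReflectionClass.

Lemma reflection_order A P le Z leZ r : preorder_on P le ->
  @poset_reflection A P le Z leZ r -> Relation_Definitions.order Z leZ.
Proof.
move=> Ppre [rP rle rs ra]; split=> [z|x y z|x y]; last exact: ra.
  by apply/rle; apply: pre_refl Ppre _ (rP z).
rewrite !rle; exact: (pre_trans Ppre (rP x) (rP y) (rP z)).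
Qed.

Lemma off_part_eq (Z : Type) (leZ : Z -> Z -> Prop) (p : Z -> Prop)
    (x w : {z | p z}) :
  (forall z z', leZ z z' -> leZ z' z -> z = z') ->
  leZ (sval x) (sval w) -> leZ (sval w) (sval x) -> x = w.
Proof.
case: x w => [z h] [z' h'] /= anti l1 l2; have E := anti _ _ l1 l2.
by case: _ / E h' {l1 l2} => h'; congr exist; apply: proof_irrelevance.
Qed.

(** * One side of a flip-flop from a Galois connection *)

Section HalfFlip.
Variables (A : Type) (P : A -> Prop) (le : A -> A -> Prop).
Variables (A0 : Type) (P0 : A0 -> Prop) (le0 : A0 -> A0 -> Prop).
Hypotheses (preA : preorder_on P le) (preA0 : preorder_on P0 le0).
Variables (Z Y : Type) (leZ : Z -> Z -> Prop) (leY : Y -> Y -> Prop).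
Variables (r : Z -> A) (r0 : Y -> A0).
Hypotheses (rZ : poset_reflection P le leZ r).
Hypotheses (rY : poset_reflection P0 le0 leY r0).
Variables (down : A -> A0) (up : A0 -> A) (p : A -> Prop).
Hypothesis downP : forall a, P a -> P0 (down a).
Hypothesis upP : forall u, P0 u -> P (up u).
Hypothesis adj : forall a u, P a -> P0 u -> le a (up u) <-> le0 (down a) u.
Hypothesis down_up : forall u, P0 u -> le0 (down (up u)) u /\ le0 u (down (up u)).
Hypothesis p_up : forall u, P0 u -> p (up u).
Hypothesis p_closed : forall a, P a -> p a -> le (up (down a)) a.
Hypothesis p_upward : forall a b, P a -> P b -> p a -> le a b -> p b.

Lemma le_up_down a : P a -> le a (up (down a)).
Proof.
move=> Pa; apply: (proj2 (adj Pa (downP Pa))).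
exact: pre_refl preA0 _ (downP Pa).
Qed.

Lemma down_mono a b : P a -> P b -> le a b -> le0 (down a) (down b).
Proof.
move=> Pa Pb ab; apply: (proj1 (adj Pa (downP Pb))).
exact: (pre_trans preA Pa Pb (upP (downP Pb)) ab (le_up_down Pb)).
Qed.

Lemma up_mono u w : P0 u -> P0 w -> le0 u w -> le (up u) (up w).
Proof.
move=> Pu Pw uw; apply: (proj2 (adj (upP Pu) Pw)).
apply: (pre_trans preA0 (downP (upP Pu)) Pu Pw _ uw).
by case: (down_up Pu).
Qed.

Definition off_part := {z : Z | ~ p (r z)}.

Definition off_le (x x' : off_part) := leZ (sval x) (sval x').

Definition down_class (z : Z) : Y := refl_class rY (downP (refl_mem rZ z)).

Lemma down_classP z :
  le0 (down (r z)) (r0 (down_class z)) /\ le0 (r0 (down_class z)) (down (r z)).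
Proof. exact: (refl_classP rY (downP (refl_mem rZ z))). Qed.

Lemma down_class_le z z' :
  leY (down_class z) (down_class z') <-> le0 (down (r z)) (down (r z')).
Proof.
have Pz := downP (refl_mem rZ z); have Pz' := downP (refl_mem rZ z').
have [h1 h2] := down_classP z; have [h1' h2'] := down_classP z'.
have R := refl_mem rY.
rewrite (refl_le rY); split=> h.
  apply: (pre_trans preA0 Pz (R _) Pz' h1).
  exact: (pre_trans preA0 (R _) (R _) Pz' h h2').
apply: (pre_trans preA0 (R _) Pz (R _) h2).
exact: (pre_trans preA0 Pz Pz' (R _) h h1').
Qed.

Definition off_map (x : off_part) : Y := down_class (sval x).

Lemma off_map_mono x x' : off_le x x' -> leY (off_map x) (off_map x').
Proof.
move=> /(refl_le rZ) h; apply/down_class_le.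
by apply: down_mono => //; apply: refl_mem rZ _.
Qed.

Definition split_class (z : Z) : off_part + Y :=
  match excluded_middle_informative (p (r z)) with
  | left _ => inr (down_class z)
  | right n => inl (exist _ z n)
  end.

Definition unsplit_class (u : off_part + Y) : Z :=
  match u with
  | inl x => sval x
  | inr y => refl_class rZ (upP (refl_mem rY y))
  end.

Lemma p_unsplit y : p (r (unsplit_class (inr y))).
Proof.
have Py := refl_mem rY y; have [h1 h2] := refl_classP rZ (upP (refl_mem rY y)).
exact: p_upward (upP Py) (refl_mem rZ _) (p_up Py) h1.
Qed.

Lemma up_down_le z : p (r z) -> le (up (down (r z))) (r z).
Proof. by move=> pz; apply: p_closed => //; apply: refl_mem rZ _. Qed.

(** The elements satisfying [p] are, up to equivalence, the [up u], and they form a copy of [Y]. The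
    adjunction turns [le a (up u)] into [le0 (down a) u], and since [p] is upward closed no element
    of [Y] lies below one of [off_part]. *)
Lemma half_flip : order_iso leZ (flip_plus off_le leY off_map).
Proof.
have R := refl_mem rZ; have R0 := refl_mem rY.
exists split_class; split.
  exists unsplit_class => [z|[[z pz]|y]].
  - rewrite /split_class; case: excluded_middle_informative => //= pz.
    have Pd := downP (R z); have Py := R0 (down_class z).
    have [h1 h2] := refl_classP rZ (upP (refl_mem rY (down_class z))).
    have [d1 d2] := down_classP z.
    apply: (refl_anti rZ); apply/(refl_le rZ).
      apply: (pre_trans preA (R _) (upP Py) (R _) h2).
      apply: (pre_trans preA (upP Py) (upP Pd) (R _)); last exact: up_down_le.
      exact: up_mono.
    apply: (pre_trans preA (R _) (upP Py) (R _) _ h1).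
    apply: (pre_trans preA (R _) (upP Pd) (upP Py)); first exact: le_up_down.
    exact: up_mono.
  - rewrite /split_class /=; case: excluded_middle_informative => // pz'.
    by congr inl; congr exist; apply: proof_irrelevance.
  - rewrite /split_class; case: excluded_middle_informative => [pz|np];
      last by case: (np (p_unsplit y)).
    congr inr; set z := unsplit_class _ in pz *.
    have [h1 h2] := refl_classP rZ (upP (refl_mem rY y)).
    have [u1 u2] := down_up (R0 y).
    have Pd := downP (R z); have [d1 d2] := down_classP z.
    have Pdu := downP (upP (R0 y)).
    apply: (refl_anti rY); apply/(refl_le rY).
      apply: (pre_trans preA0 (R0 _) Pd (R0 _) d2).
      apply: (pre_trans preA0 Pd Pdu (R0 _)); last exact: u1.
      exact: down_mono (R _) (upP (R0 y)) h2.
    apply: (pre_trans preA0 (R0 _) Pd (R0 _) _ d1).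
    apply: (pre_trans preA0 (R0 _) Pdu Pd); first exact: u2.
    exact: down_mono (upP (R0 y)) (R _) h1.
move=> z z'; rewrite /split_class.
case: excluded_middle_informative => pz;
  case: excluded_middle_informative => pz' //=.
- rewrite down_class_le (refl_le rZ); split; first exact: down_mono.
  move=> h; have [Pd Pd'] := (downP (R z), downP (R z')).
  apply: (pre_trans preA (R z) (upP Pd) (R z')); first exact: le_up_down.
  apply: (pre_trans preA (upP Pd) (upP Pd') (R z')); last exact: up_down_le.
  exact: up_mono.
- split=> // /(refl_le rZ) h; apply: pz'.
  exact: p_upward pz h.
- rewrite /off_map /= down_class_le (refl_le rZ); split; first exact: down_mono.
  move=> /(adj (R z) (downP (R z'))) h.
  apply: (pre_trans preA (R z) (upP (downP (R z'))) (R z') h).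
  exact: up_down_le.
Qed.

End HalfFlip.

(** Reversing all orders turns [flip_plus] into [flip_minus], so [half_flip] also serves the sink
    side. *)
Lemma opp_reflection A P le Z leZ r :
  @poset_reflection A P le Z leZ r ->
  poset_reflection P (fun a b => le b a) (fun x y => leZ y x) r.
Proof.
case=> rP rle rs ra; split=> [z|z z'|a Pa|z z' h h'].
- exact: rP.
- exact: rle.
- by have [z [h1 h2]] := rs a Pa; exists z.
- exact: ra.
Qed.

Lemma opp_preorder A P le : @preorder_on A P le ->
  preorder_on P (fun a b => le b a).
Proof.
case=> re tr; split=> [|a b c Pa Pb Pc ab bc]; first exact: re.
exact: tr Pc Pb Pa bc ab.
Qed.

Lemma reflection_transfer A P le A1 P1 le1 Z leZ r (F : A -> A1) :
  @poset_reflection A P le Z leZ r -> preorder_on P1 le1 ->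
  (forall a, P a -> P1 (F a)) ->
  (forall a b, P a -> P b -> le a b <-> le1 (F a) (F b)) ->
  (forall b, P1 b -> exists a, [/\ P a, le1 b (F a) & le1 (F a) b]) ->
  @poset_reflection A1 P1 le1 Z leZ (F \o r).
Proof.
case=> rP rle rs ra pre1 FP Fle Fs; split=> [z|z z'|b Pb|] //=.
- exact: FP.
- by rewrite rle Fle.
- have [a [Pa ba ab]] := Fs b Pb; have [z [az za]] := rs a Pa.
  exists z; have [PF Pz] := (FP a Pa, FP _ (rP z)).
  split; first by apply: (pre_trans pre1 Pb PF Pz ba); apply/Fle.
  by apply: (pre_trans pre1 Pz PF Pb _ ab); apply/Fle.
Qed.

Section FlipFlop.
Variables (A A' A0 : Type) (P : A -> Prop) (P' : A' -> Prop) (P0 : A0 -> Prop).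
Variables (le : A -> A -> Prop) (le' : A' -> A' -> Prop) (le0 : A0 -> A0 -> Prop).
Hypotheses (preA : preorder_on P le) (preA' : preorder_on P' le').
Hypothesis preA0 : preorder_on P0 le0.
Variables (Z Z' Y : Type).
Variables (leZ : Z -> Z -> Prop) (leZ' : Z' -> Z' -> Prop) (leY : Y -> Y -> Prop).
Variables (r : Z -> A) (r' : Z' -> A') (r0 : Y -> A0).
Hypotheses (rZ : poset_reflection P le leZ r).
Hypotheses (rZ' : poset_reflection P' le' leZ' r').
Hypotheses (rY : poset_reflection P0 le0 leY r0).
Variables (down : A -> A0) (up : A0 -> A) (p : A -> Prop).
Hypothesis downP : forall a, P a -> P0 (down a).
Hypothesis upP : forall u, P0 u -> P (up u).
Hypothesis adj : forall a u, P a -> P0 u -> le a (up u) <-> le0 (down a) u.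
Hypothesis down_up : forall u, P0 u -> le0 (down (up u)) u /\ le0 u (down (up u)).
Hypothesis p_up : forall u, P0 u -> p (up u).
Hypothesis p_closed : forall a, P a -> p a -> le (up (down a)) a.
Hypothesis p_upward : forall a b, P a -> P b -> p a -> le a b -> p b.
Variables (down' : A' -> A0) (up' : A0 -> A') (p' : A' -> Prop).
Hypothesis downP' : forall a, P' a -> P0 (down' a).
Hypothesis upP' : forall u, P0 u -> P' (up' u).
Hypothesis adj' : forall a u, P' a -> P0 u -> le' (up' u) a <-> le0 u (down' a).
Hypothesis down_up' :
  forall u, P0 u -> le0 u (down' (up' u)) /\ le0 (down' (up' u)) u.
Hypothesis p_up' : forall u, P0 u -> p' (up' u).
Hypothesis p_closed' : forall a, P' a -> p' a -> le' a (up' (down' a)).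
Hypothesis p_downward : forall a b, P' a -> P' b -> p' a -> le' b a -> p' b.
Variable rel : A -> A' -> Prop.
Hypothesis rel_left : forall a, P a -> ~ p a ->
  exists a', [/\ P' a', ~ p' a' & rel a a'].
Hypothesis rel_right : forall a', P' a' -> ~ p' a' ->
  exists a, [/\ P a, ~ p a & rel a a'].
Hypothesis rel_le : forall a a' b b', P a -> P' a' -> P b -> P' b' ->
  rel a a' -> rel b b' -> le a b <-> le' a' b'.
Hypothesis rel_down : forall a a', P a -> P' a' -> rel a a' ->
  le0 (down a) (down' a') /\ le0 (down' a') (down a).

Let X := off_part r p.
Let X' := off_part r' p'.

(** [rel] is closed up to equivalence on both sides, because the representatives [r z] and [r' z']
    are arbitrary members of their classes. *)
Definition matched (x : X) (x' : X') := exists a a',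
  [/\ P a, P' a', rel a a', le a (r (sval x)) /\ le (r (sval x)) a &
      le' a' (r' (sval x')) /\ le' (r' (sval x')) a'].

Lemma matched_left x : exists x', matched x x'.
Proof.
case: x => z npz; have Pz := refl_mem rZ z.
have [a' [Pa' npa' zz']] := rel_left Pz npz.
have [z' [h1 h2]] := refl_surj rZ' Pa'.
have npz' : ~ p' (r' z').
  by move=> pz'; apply: npa'; apply: p_downward (refl_mem rZ' z') Pa' pz' h1.
exists (exist _ z' npz'), (r z), a'; split=> //.
by split; apply: pre_refl preA _ Pz.
Qed.

Lemma matched_right x' : exists x, matched x x'.
Proof.
case: x' => z' npz'; have Pz' := refl_mem rZ' z'.
have [a [Pa npa zz']] := rel_right Pz' npz'.
have [z [h1 h2]] := refl_surj rZ Pa.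
have npz : ~ p (r z).
  by move=> pz; apply: npa; apply: p_upward (refl_mem rZ z) Pa pz h2.
exists (exist _ z npz), a, (r' z'); split=> //.
by split; apply: pre_refl preA' _ Pz'.
Qed.

Lemma matched_le x x' w w' : matched x x' -> matched w w' ->
  leZ (sval x) (sval w) <-> leZ' (sval x') (sval w').
Proof.
have R := refl_mem rZ; have R' := refl_mem rZ'.
move=> [a [a' [Pa Pa' aa' [xa1 xa2] [xa1' xa2']]]].
move=> [b [b' [Pb Pb' bb' [wb1 wb2] [wb1' wb2']]]].
rewrite (refl_le rZ) (refl_le rZ'); split=> h.
  have /(rel_le Pa Pa' Pb Pb' aa' bb') h' : le a b.
    apply: (pre_trans preA Pa (R _) Pb xa1).
    exact: (pre_trans preA (R _) (R _) Pb h wb2).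
  apply: (pre_trans preA' (R' _) Pa' (R' _) xa2').
  exact: (pre_trans preA' Pa' Pb' (R' _) h' wb1').
have /(rel_le Pa Pa' Pb Pb' aa' bb') h' : le' a' b'.
  apply: (pre_trans preA' Pa' (R' _) Pb' xa1').
  exact: (pre_trans preA' (R' _) (R' _) Pb' h wb2').
apply: (pre_trans preA (R _) Pa (R _) xa2).
exact: (pre_trans preA Pa Pb (R _) h' wb1).
Qed.

Lemma leZ_refl z : leZ z z.
Proof. by apply/(refl_le rZ); apply: pre_refl preA _ (refl_mem rZ z). Qed.
Lemma leZ'_refl z : leZ' z z.
Proof. by apply/(refl_le rZ'); apply: pre_refl preA' _ (refl_mem rZ' z). Qed.

Lemma flip_flop : related_by_flip_flop leZ leZ'.
Proof.
have R := refl_mem rZ; have R' := refl_mem rZ'; have R0 := refl_mem rY.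
have iso1 := half_flip preA preA0 rZ rY downP upP adj down_up p_up p_closed p_upward.
have rY' := opp_reflection rY.
have [h2 [h2b h2E]] := half_flip (opp_preorder preA') (opp_preorder preA0)
  (opp_reflection rZ') rY' downP' upP' adj' down_up' p_up'
  p_closed' p_downward.
exists X, Y, (@off_le A Z leZ r p), leY, (off_map rZ rY downP (p := p)).
split=> //.
- split; last exact: reflection_order preA0 rY.
  have [Zr Zt _] := reflection_order preA rZ.
  split=> [x|x y z|x y]; [exact: Zr|exact: Zt|].
  exact: off_part_eq (refl_anti rZ).
- by move=> x y; apply: (off_map_mono preA preA0 rZ rY downP upP adj).
pose phi x' : X := proj1_sig (constructive_indefinite_description _ (matched_right x')).
have phiP x' : matched (phi x') x'.
  exact: proj2_sig (constructive_indefinite_description _ (matched_right x')).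
pose psi x : X' := proj1_sig (constructive_indefinite_description _ (matched_left x)).
have psiP x : matched x (psi x).
  exact: proj2_sig (constructive_indefinite_description _ (matched_left x)).
have psiK : cancel psi phi.
  move=> x; apply: (off_part_eq (refl_anti rZ)).
    by apply: (proj2 (matched_le (phiP (psi x)) (psiP x))); apply: leZ'_refl.
  by apply: (proj2 (matched_le (psiP x) (phiP (psi x)))); apply: leZ'_refl.
have phiK : cancel phi psi.
  move=> x; apply: (off_part_eq (refl_anti rZ')).
    by apply: (proj1 (matched_le (psiP (phi x)) (phiP x))); apply: leZ_refl.
  by apply: (proj1 (matched_le (phiP x) (psiP (phi x)))); apply: leZ_refl.
(* By [rel_down] the two maps to [Y] agree along the matching, so that one function serves both
   orders. *)
have phi_map x' : off_map rZ rY downP (p := p) (phi x') =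
    off_map (opp_reflection rZ') rY' downP' (p := p') x'.
  have [a [a' [Pa Pa' aa' [xa1 xa2] [xa1' xa2']]]] := phiP x'.
  have [d1 d2] := rel_down Pa Pa' aa'.
  rewrite /off_map.
  have [c1 c2] := down_classP rZ rY downP (sval (phi x')).
  have [c1' c2'] := down_classP (opp_reflection rZ') rY' downP' (sval x').
  have Pd := downP (R (sval (phi x'))); have Pd' := downP' (R' (sval x')).
  have Pda := downP Pa; have Pda' := downP' Pa'.
  have e1 := down_mono preA preA0 downP upP adj (R (sval (phi x'))) Pa xa2.
  have e2 := down_mono preA preA0 downP upP adj Pa (R (sval (phi x'))) xa1.
  have e1' := down_mono (opp_preorder preA') (opp_preorder preA0) downP' upP' adj'
    (R' (sval x')) Pa' xa1'.
  have e2' := down_mono (opp_preorder preA') (opp_preorder preA0) downP' upP' adj'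
    Pa' (R' (sval x')) xa2'.
  apply: (refl_anti rY); apply/(refl_le rY).
    apply: (pre_trans preA0 (R0 _) Pd (R0 _) c2).
    apply: (pre_trans preA0 Pd Pda (R0 _) e1).
    apply: (pre_trans preA0 Pda Pda' (R0 _) d1).
    exact: (pre_trans preA0 Pda' Pd' (R0 _) e1' c2').
  apply: (pre_trans preA0 (R0 _) Pd' (R0 _) c1').
  apply: (pre_trans preA0 Pd' Pda' (R0 _) e2').
  apply: (pre_trans preA0 Pda' Pda (R0 _) d2).
  exact: (pre_trans preA0 Pda Pd (R0 _) e2 c1).
pose g (u : X' + Y) : X + Y := match u with inl x => inl (phi x) | inr y => inr y end.
exists (g \o h2); split.
  apply: bij_comp h2b.
  exists (fun u : X + Y => match u with inl x => inl (psi x) | inr y => inr y end).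
    by case=> //= x; rewrite phiK.
  by case=> //= x; rewrite psiK.
(* The arguments are exchanged because [h2] was obtained for the reversed orders. *)
move=> z w; rewrite (h2E w z) /=.
case: (h2 z) => [x|y]; case: (h2 w) => [x'|y'] //=.
  by rewrite /off_le (matched_le (phiP x) (phiP x')).
by rewrite phi_map.
Qed.

End FlipFlop.

(** * Tilting classes *)

Section TiltingPreorder.
Variables (k : fieldType) (Q : quiver).
Implicit Types K M N T : rep k Q.

Definition rigid_generator T := ext1_vanish T T /\ perp_trivial T.

Lemma tilt_preorder :
  preorder_on rigid_generator (@ext1_vanish k Q).
Proof.
split=> [T []//|T T' T'' _ [TT' T0'] _ TT1 TT2].
exact: ext1_tilting_trans TT' T0' TT1 TT2.
Qed.

Lemma ext1_of_indecomposables T N :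
  (forall K, indecomposable K -> retract K T -> ext1_vanish K N) ->
  ext1_vanish T N.
Proof.
apply: (@additive_property k Q (fun K => ext1_vanish K N)).
- by move=> A B /iso_sym/iso_retract; apply: ext1_retract_left.
- exact/zero_ext1/zero_repP.
- move=> A B; apply: ext1_middle_left (@dsum_exact k Q A B) _ _.
  exact: inl_hom_mono.
Qed.

Lemma hom_vanish_of_indecomposables T N :
  (forall K, indecomposable K -> retract K T -> hom_vanish K N) ->
  hom_vanish T N.
Proof.
apply: (@additive_property k Q (fun K => hom_vanish K N)).
- by move=> A B /iso_sym/iso_retract; apply: hom_vanish_retract_left.
- exact/zero_hom_vanish/zero_repP.
- move=> A B; apply: hom_middle_left (@dsum_exact k Q A B).
  exact: snd_hom_epi.
Qed.

Lemma ext1_target_indecomposables T N :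
  (forall K, indecomposable K -> retract K T -> ext1_vanish N K) ->
  ext1_vanish N T.
Proof.
apply: (@additive_property k Q (fun K => ext1_vanish N K)).
- by move=> A B /iso_sym/iso_retract; apply: ext1_retract_right.
- by move=> g; exists (fun=> 0) => a u; apply: zero_rep_eq.
- move=> A B; apply: ext1_middle_right (@dsum_exact k Q A B) _ _.
  exact: snd_hom_epi.
Qed.

(** In the usual notation add T = add T'; this is what survives the passage to a basic module. *)
Definition same_indecomposables T T' :=
  forall K, indecomposable K -> retract K T <-> retract K T'.

Lemma same_indecomposables_ext1 T T' N : same_indecomposables T T' ->
  ext1_vanish T N -> ext1_vanish T' N.
Proof.
move=> TT' TN; apply: ext1_of_indecomposables => K Ki /TT' KT.
exact: ext1_retract_left (KT Ki) TN.
Qed.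

Lemma same_indecomposables_ext1_target T T' N : same_indecomposables T T' ->
  ext1_vanish N T -> ext1_vanish N T'.
Proof.
move=> TT' NT; apply: ext1_target_indecomposables => K Ki /TT' KT.
exact: ext1_retract_right (KT Ki) NT.
Qed.

Lemma same_indecomposables_sym T T' :
  same_indecomposables T T' -> same_indecomposables T' T.
Proof. by move=> TT' K Ki; rewrite TT'. Qed.

Lemma same_indecomposables_tilt T T' : same_indecomposables T T' ->
  rigid_generator T -> rigid_generator T'.
Proof.
move=> TT' [TT T0]; split.
  apply: (same_indecomposables_ext1 TT').
  exact: same_indecomposables_ext1_target TT' TT.
have T'T := same_indecomposables_sym TT'.
move=> M HM EM; apply: T0.
  apply: hom_vanish_of_indecomposables => K Ki /T'T KT.
  exact: hom_vanish_retract_left (KT Ki) HM.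
exact: same_indecomposables_ext1 T'T EM.
Qed.

Lemma iso_same_indecomposables T T' : iso T T' -> same_indecomposables T T'.
Proof.
by move=> TT' K _; split=> KT; apply: (retract_trans KT); apply: iso_retract;
   [|apply: iso_sym].
Qed.

Lemma tilt_ext1_retract T T' K : rigid_generator T -> ext1_vanish T' T' ->
  ext1_vanish T T' -> ext1_vanish T' T -> indecomposable K ->
  retract K T' -> retract K T.
Proof.
move=> [TT T0] TT' T_T' T'_T Ki KT'.
have [n T'n] := ext1_tilting_retract TT T0 T'_T T_T'.
exact: retract_pow_indecomposable Ki (retract_trans KT' T'n).
Qed.

End TiltingPreorder.

Section TiltingClasses.
Variables (k : fieldType) (Q : quiver) (h : vertex Q -> nat).
Hypothesis h_lt : forall a : arrow Q, (h (src a) < h (tgt a))%N.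
Implicit Types K M N T : rep k Q.

Lemma tiltingE T : tilting T <-> rigid_generator T.
Proof.
split=> [[TT gen]|[TT T0]].
  by split; [apply/(Ext_pos_zeroE h_lt)|apply: generates_perp_trivial gen].
by split; [apply/(Ext_pos_zeroE h_lt)|apply: perp_trivial_generates].
Qed.

Definition class_rep (C : tilting_class k Q) : rep k Q :=
  proj1_sig (constructive_indefinite_description _ (proj2_sig C)).

Lemma class_repP (C : tilting_class k Q) :
  [/\ tilting (class_rep C), basic (class_rep C) &
      sval C = (fun M => iso (class_rep C) M)].
Proof.
exact: (proj2_sig (constructive_indefinite_description _ (proj2_sig C))).
Qed.

Lemma class_eq (C C' : tilting_class k Q) :
  iso (class_rep C) (class_rep C') -> C = C'.
Proof.
move=> CC'; have [_ _ CE] := class_repP C; have [_ _ CE'] := class_repP C'.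
have : sval C = sval C'.
  rewrite CE CE'; apply: functional_extensionality => M.
  apply: propositional_extensionality.
  by split; apply: iso_trans => //; apply: iso_sym.
case: C {CC' CE} => C HC; case: C' {CE'} => C' HC' /= E.
by case: _ / E HC' => HC'; congr exist; apply: proof_irrelevance.
Qed.

Lemma tilting_leE (C C' : tilting_class k Q) :
  tilting_le C C' <-> ext1_vanish (class_rep C) (class_rep C').
Proof.
have [Ct _ CE] := class_repP C; have [C't _ CE'] := class_repP C'.
have [[TT T0] [TT' T0']] := ((tiltingE _).1 Ct, (tiltingE _).1 C't).
split=> [[T [T' [CT CT' perpTT']]]|CC'].
  rewrite CE in CT; rewrite CE' in CT'.
  have T'T' : ext1_vanish T' (class_rep C').
    exact: ext1_retract_left (iso_retract (iso_sym CT')) TT'.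
  (* The inclusion of perpendicular classes is tested on the tilting module, which lies in its
     own. *)
  have /(Ext_pos_zeroE h_lt) : perp T (class_rep C').
    by apply/perpTT'/(Ext_pos_zeroE h_lt).
  exact: ext1_retract_left (iso_retract CT).
exists (class_rep C), (class_rep C'); split; rewrite ?CE ?CE'; try exact: iso_refl.
move=> M /(Ext_pos_zeroE h_lt) C'M; apply/(Ext_pos_zeroE h_lt).
exact: ext1_tilting_trans TT' T0' CC' C'M.
Qed.

(** Every tilting module is equivalent to its basic version. For antisymmetry, [tilt_ext1_retract]
    shows that equivalent tilting modules have the same indecomposable summands, and basic ones are
    then isomorphic. *)
Lemma tilting_reflection :
  poset_reflection (@rigid_generator k Q) (@ext1_vanish k Q)
    (@tilting_le k Q) class_rep.
Proof.
have tilt_rep C : rigid_generator (class_rep C).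
  by have [/tiltingE] := class_repP C.
split; [exact: tilt_rep|exact: tilting_leE|move=> T Tt|move=> C C'].
  have [T' Tb' TT'] := basic_version T.
  have Tt' := same_indecomposables_tilt TT' Tt.
  pose C : tilting_class k Q := exist _ (fun M => iso T' M)
    (ex_intro _ T' (And3 ((tiltingE T').2 Tt') Tb' erefl)).
  exists C; have [_ _ /= CE] := class_repP C.
  have T'C : iso T' (class_rep C).
    (* The chosen [class_rep C] need not be [T']; the equality of predicates is evaluated at it. *)
    by have /= -> := congr1 (@^~ (class_rep C)) CE; apply: iso_refl.
  have TC : same_indecomposables T (class_rep C).
    by move=> K Ki; rewrite (TT' K Ki); apply: iso_same_indecomposables T'C K Ki.
  split; first exact: same_indecomposables_ext1_target TC Tt.1.
  exact: same_indecomposables_ext1 TC Tt.1.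
move=> /tilting_leE CC' /tilting_leE C'C; apply: class_eq.
have [[_ Cb _] [_ Cb' _]] := (class_repP C, class_repP C').
have [Ct Ct'] := (tilt_rep C, tilt_rep C').
apply: basic_iso Cb Cb' _ => K Ki; split.
  exact: tilt_ext1_retract Ct' Ct.1 C'C CC' Ki.
exact: tilt_ext1_retract Ct Ct'.1 CC' C'C Ki.
Qed.

End TiltingClasses.

(** * Quivers with a distinguished source or sink *)

Section DependentProduct.
Variables (k : fieldType) (I : finType) (V : I -> vectType k).

(** The factors have different types, so the product is built from nested pairs along an enumeration
    of the indices. *)
Fixpoint prod_seq (s : seq I) : vectType k :=
  if s is i :: s' then (V i * prod_seq s')%type else 'rV[k]_0.

Fixpoint proj_seq (s : seq I) (i : I) : 'Hom(prod_seq s, V i) :=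
  match s return 'Hom(prod_seq s, V i) with
  | [::] => 0
  | j :: s' =>
    if j =P i is ReflectT ji then
      eq_rect j (fun i => 'Hom((V j * prod_seq s')%type, V i))
        (fst_lfun (V j) (prod_seq s')) i ji
    else (proj_seq s' i \o snd_lfun (V j) (prod_seq s'))%VF
  end.

Fixpoint tuple_seq (W : vectType k) (f : forall i, 'Hom(W, V i)) (s : seq I) :
    'Hom(W, prod_seq s) :=
  match s return 'Hom(W, prod_seq s) with
  | [::] => 0
  | i :: s' => pair_lfun (f i) (tuple_seq f s')
  end.

Lemma proj_seq_cons j s u : proj_seq (j :: s) j u = u.1.
Proof. by rewrite /=; case: eqP => // ?; rewrite eq_axiomK /= fst_lfunE. Qed.

Lemma proj_seq_cons_neq j s i u : j != i ->
  proj_seq (j :: s) i u = proj_seq s i u.2.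
Proof. by rewrite /=; case: eqP => // _ _; rewrite comp_lfunE snd_lfunE. Qed.

Lemma proj_tuple_seq (W : vectType k) (f : forall i, 'Hom(W, V i)) s i w :
  i \in s -> proj_seq s i (tuple_seq f s w) = f i w.
Proof.
elim: s => [//|j s IH]; rewrite inE.
have [->|ij] := eqVneq i j.
  by move=> _; rewrite proj_seq_cons pair_lfunE.
move=> /= si; rewrite [LHS]proj_seq_cons_neq 1?eq_sym //.
by rewrite pair_lfunE /= IH.
Qed.

Lemma proj_seq_inj s u : uniq s ->
  (forall i, i \in s -> proj_seq s i u = 0) -> u = 0.
Proof.
elim: s u => [u _ _|j s IH [x y] /= /andP[js us] u0].
  by apply/rowP => -[].
have x0 := u0 j (mem_head j s); rewrite [LHS]proj_seq_cons /= in x0.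
rewrite x0 (IH y) // => i si.
have ji : j != i by apply: contraNneq js => ->.
have := u0 i; rewrite inE si orbT => /(_ isT) <-.
by rewrite [RHS]proj_seq_cons_neq.
Qed.

Definition prod_vect := prod_seq (enum I).
Definition pr (i : I) : 'Hom(prod_vect, V i) := proj_seq (enum I) i.
Definition tup (W : vectType k) (f : forall i, 'Hom(W, V i)) :
  'Hom(W, prod_vect) := tuple_seq f (enum I).

Lemma pr_tup (W : vectType k) (f : forall i, 'Hom(W, V i)) i w :
  pr i (tup f w) = f i w.
Proof. by apply: proj_tuple_seq; rewrite mem_enum. Qed.

Lemma pr_inj u u' : (forall i, pr i u = pr i u') -> u = u'.
Proof.
move=> uu'; apply/eqP; rewrite -subr_eq0; apply/eqP.
apply: (@proj_seq_inj (enum I)); first exact: enum_uniq.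
by move=> i _; rewrite lfunB; apply/eqP; rewrite subr_eq0; apply/eqP/uu'.
Qed.

Definition inc (i : I) : 'Hom(V i, prod_vect) :=
  tup (fun j => if i =P j is ReflectT ij then
    eq_rect i (fun j => 'Hom(V i, V j)) \1%VF j ij else 0).

Lemma pr_inc i u : pr i (inc i u) = u.
Proof. by rewrite pr_tup; case: eqP => // ?; rewrite eq_axiomK /= id_lfunE. Qed.

Lemma pr_inc_neq i j u : i != j -> pr j (inc i u) = 0.
Proof. by rewrite pr_tup; case: eqP => // _; rewrite zero_lfunE. Qed.

Lemma inc_sum u : u = \sum_i inc i (pr i u).
Proof.
apply: pr_inj => j; rewrite linear_sum (bigD1 j) //= pr_inc big1 ?addr0 //.
by move=> i ij; rewrite pr_inc_neq.
Qed.

Lemma inc_ext (W : vectType k) (f g : 'Hom(prod_vect, W)) :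
  (forall i u, f (inc i u) = g (inc i u)) -> forall u, f u = g u.
Proof.
move=> fg u; rewrite [u]inc_sum !linear_sum; apply: eq_bigr => i _.
exact: fg.
Qed.

End DependentProduct.

(** * One-vertex extensions of a quiver *)

Section StarQuivers.
Variables (k : fieldType) (Q0 : quiver) (B : finType) (e : B -> vertex Q0).

(* [Q0] with a new vertex [None] which is a source (resp. a sink), and an arrow
   between [None] and [e b] for each [b]. *)
Definition out_quiver : quiver :=
  @Quiver (option (vertex Q0)) (arrow Q0 + B)%type
    (fun a => match a with inl a => Some (src a) | inr b => None end)
    (fun a => match a with inl a => Some (tgt a) | inr b => Some (e b) end).
Definition in_quiver : quiver :=
  @Quiver (option (vertex Q0)) (arrow Q0 + B)%type
    (fun a => match a with inl a => Some (src a) | inr b => Some (e b) end)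
    (fun a => match a with inl a => Some (tgt a) | inr b => None end).

(** Indexed by arrows and not by their ends, so that parallel arrows give repeated factors. *)
Definition star (U : vertex Q0 -> vectType k) : vectType k :=
  prod_vect (fun b => U (e b)).

Definition star_map (U U' : vertex Q0 -> vectType k)
    (f : forall v, 'Hom(U v, U' v)) : 'Hom(star U, star U') :=
  tup (fun b => f (e b) \o pr (fun b => U (e b)) b)%VF.

Lemma star_mapE (U U' : vertex Q0 -> vectType k) (f : forall v, 'Hom(U v, U' v)) b p :
  pr (fun b => U' (e b)) b (star_map f p) =
  f (e b) (pr (fun b => U (e b)) b p).
Proof. by rewrite pr_tup comp_lfunE. Qed.

Lemma star_map_inc (U U' : vertex Q0 -> vectType k) (f : forall v, 'Hom(U v, U' v)) b u :
  star_map f (inc (fun b => U (e b)) b u) =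
  inc (fun b => U' (e b)) b (f (e b) u).
Proof.
apply: pr_inj => c; rewrite star_mapE; have [<-|bc] := eqVneq b c.
  by rewrite !pr_inc.
by rewrite !pr_inc_neq // lfun0.
Qed.

Definition out_restr (M : rep k out_quiver) : rep k Q0 :=
  @Rep k Q0 (fun v => M (Some v)) (fun a => rmap M (inl a : arrow out_quiver)).
Definition in_restr (M : rep k in_quiver) : rep k Q0 :=
  @Rep k Q0 (fun v => M (Some v)) (fun a => rmap M (inl a : arrow in_quiver)).

(** A representation amounts to its restriction to [Q0] together with this single map, which
    assembles the maps along the new arrows. *)
Definition out_map (M : rep k out_quiver) :
    'Hom(M None, star (fun v => M (Some v))) :=
  tup (V := fun b => M (Some (e b))) (W := M None)
    (fun b => rmap M (inr b : arrow out_quiver)).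
Definition in_map (M : rep k in_quiver) :
    'Hom(star (fun v => M (Some v)), M None) :=
  \sum_b ((rmap M (inr b : arrow in_quiver) : 'Hom(M (Some (e b)), M None))
    \o pr (fun b => M (Some (e b))) b)%VF.

Lemma out_mapE (M : rep k out_quiver) b u :
  pr (fun b => M (Some (e b))) b (out_map M u) =
  rmap M (inr b : arrow out_quiver) u.
Proof. exact: pr_tup. Qed.

Lemma in_mapE (M : rep k in_quiver) b u :
  in_map M (inc (fun b => M (Some (e b))) b u) =
  rmap M (inr b : arrow in_quiver) u.
Proof.
rewrite sum_lfunE (bigD1 b) //= comp_lfunE pr_inc big1 ?addr0 // => c cb.
by rewrite comp_lfunE pr_inc_neq 1?eq_sym // lfun0.
Qed.

Definition delta (U U' : rep k Q0) (f : forall v, 'Hom(U v, U' v)) a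
    (u : U (src a)) : U' (tgt a) :=
  f (tgt a) (rmap U a u) - rmap U' a (f (src a) u).

Lemma ext1_outP (M N : rep k out_quiver) : ext1_vanish M N <->
  forall (g : forall a, 'Hom(out_restr M (src a), out_restr N (tgt a)))
    (g1 : 'Hom(M None, star (out_restr N))),
  exists (f : forall v, 'Hom(out_restr M v, out_restr N v))
    (f1 : 'Hom(M None, N None)),
  (forall a u, g a u = delta f u) /\
  (forall u, g1 u = star_map f (out_map M u) - out_map N (f1 u)).
Proof.
split=> [MN g g1|MN g].
  pose gg (a : arrow out_quiver) : 'Hom(M (src a), N (tgt a)) :=
    match a with
    | inl a => g a
    | inr b => (pr (fun b => N (Some (e b))) b \o g1)%VF
    end.
  have [f fE] := MN gg.
  exists (fun v => f (Some v)), (f None); split=> [a u|u].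
    exact: (fE (inl a)).
  apply: pr_inj => b; rewrite lfunB star_mapE !out_mapE.
  by have := fE (inr b) u; rewrite /= comp_lfunE.
have [f [f1 [fE f1E]]] := MN (fun a => g (inl a))
  (tup (V := fun b => N (Some (e b))) (W := M None) (fun b => g (inr b))).
exists (fun v => match v with Some v => f v | None => f1 end) => -[a|b] u.
  exact: fE.
have := congr1 (pr (fun b => N (Some (e b))) b) (f1E u).
by rewrite pr_tup lfunB star_mapE !out_mapE.
Qed.

Lemma ext1_inP (M N : rep k in_quiver) : ext1_vanish M N <->
  forall (g : forall a, 'Hom(in_restr M (src a), in_restr N (tgt a)))
    (g1 : 'Hom(star (in_restr M), N None)),
  exists (f : forall v, 'Hom(in_restr M v, in_restr N v))
    (f1 : 'Hom(M None, N None)),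
  (forall a u, g a u = delta f u) /\
  (forall p, g1 p = f1 (in_map M p) - in_map N (star_map f p)).
Proof.
split=> [MN g g1|MN g].
  pose gg (a : arrow in_quiver) : 'Hom(M (src a), N (tgt a)) :=
    match a with
    | inl a => g a
    | inr b => (g1 \o inc (fun b => M (Some (e b))) b)%VF
    end.
  have [f fE] := MN gg.
  exists (fun v => f (Some v)), (f None); split=> [a u|p].
    exact: (fE (inl a)).
  have -> : f None (in_map M p) - in_map N (star_map (fun v => f (Some v)) p) =
    ((f None \o in_map M) - (in_map N \o star_map (fun v => f (Some v))))%VF p.
    by rewrite !lfE.
  apply: inc_ext => b u; rewrite !lfE star_map_inc !in_mapE.
  by have := fE (inr b) u; rewrite /= comp_lfunE.
pose g1 : 'Hom(star (in_restr M), N None) :=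
  \sum_b ((g (inr b) : 'Hom(M (Some (e b)), N None))
    \o pr (fun b => M (Some (e b))) b)%VF.
have g1E b u : g1 (inc (fun b => M (Some (e b))) b u) = g (inr b) u.
  rewrite sum_lfunE (bigD1 b) //= comp_lfunE pr_inc big1 ?addr0 // => c cb.
  by rewrite comp_lfunE pr_inc_neq 1?eq_sym // lfun0.
have [f [f1 [fE f1E]]] := MN (fun a => g (inl a)) g1.
exists (fun v => match v with Some v => f v | None => f1 end) => -[a|b] u.
  exact: fE.
have := f1E (inc (fun b => M (Some (e b))) b u).
by rewrite star_map_inc !in_mapE g1E.
Qed.

Lemma out_hom_subproof (M N : rep k out_quiver)
    (f : hom (out_restr M) (out_restr N)) (f1 : 'Hom(M None, N None)) :
  (forall u, out_map N (f1 u) = star_map f (out_map M u)) ->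
  forall (a : arrow out_quiver) (u : M (src a)),
  (fun v => match v return 'Hom(M v, N v) with
            | Some v => f v | None => f1 end) (tgt a) (rmap M a u) =
  rmap N a ((fun v => match v return 'Hom(M v, N v) with
            | Some v => f v | None => f1 end) (src a) u).
Proof.
move=> ff1 [a|b] u; first exact: (hom_rmap f (a := a)).
have := congr1 (pr (fun b => N (Some (e b))) b) (ff1 u).
by rewrite star_mapE !out_mapE => ->.
Qed.

Lemma out_hom_ex (M N : rep k out_quiver)
    (f : hom (out_restr M) (out_restr N)) (f1 : 'Hom(M None, N None)) :
  (forall u, out_map N (f1 u) = star_map f (out_map M u)) ->
  exists F : hom M N, (forall v u, F (Some v) u = f v u) /\
    (forall u, F None u = f1 u).
Proof. by move=> ff1; exists (Hom (out_hom_subproof ff1)). Qed.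

Lemma in_hom_subproof (M N : rep k in_quiver)
    (f : hom (in_restr M) (in_restr N)) (f1 : 'Hom(M None, N None)) :
  (forall p, f1 (in_map M p) = in_map N (star_map f p)) ->
  forall (a : arrow in_quiver) (u : M (src a)),
  (fun v => match v return 'Hom(M v, N v) with
            | Some v => f v | None => f1 end) (tgt a) (rmap M a u) =
  rmap N a ((fun v => match v return 'Hom(M v, N v) with
            | Some v => f v | None => f1 end) (src a) u).
Proof.
move=> ff1 [a|b] u; first exact: (hom_rmap f (a := a)).
have := ff1 (inc (fun b => M (Some (e b))) b u).
by rewrite star_map_inc !in_mapE.
Qed.

Lemma in_hom_ex (M N : rep k in_quiver)
    (f : hom (in_restr M) (in_restr N)) (f1 : 'Hom(M None, N None)) :
  (forall p, f1 (in_map M p) = in_map N (star_map f p)) ->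
  exists F : hom M N, (forall v u, F (Some v) u = f v u) /\
    (forall u, F None u = f1 u).
Proof. by move=> ff1; exists (Hom (in_hom_subproof ff1)). Qed.

Definition out_restr_hom (M N : rep k out_quiver) (f : hom M N) :
    hom (out_restr M) (out_restr N) :=
  @Hom k Q0 (out_restr M) (out_restr N) (fun v => f (Some v))
    (fun a u => @hom_rmap k out_quiver M N f (inl a) u).
Definition in_restr_hom (M N : rep k in_quiver) (f : hom M N) :
    hom (in_restr M) (in_restr N) :=
  @Hom k Q0 (in_restr M) (in_restr N) (fun v => f (Some v))
    (fun a u => @hom_rmap k in_quiver M N f (inl a) u).

Lemma out_hom_star (M N : rep k out_quiver) (f : hom M N) u :
  out_map N (f None u) = star_map (out_restr_hom f) (out_map M u).
Proof.
apply: pr_inj => b; rewrite star_mapE !out_mapE.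
by have := @hom_rmap k out_quiver M N f (inr b) u.
Qed.

Lemma in_hom_star (M N : rep k in_quiver) (f : hom M N) p :
  f None (in_map M p) = in_map N (star_map (in_restr_hom f) p).
Proof.
have -> : f None (in_map M p) = (f None \o in_map M)%VF p by rewrite comp_lfunE.
have -> : in_map N (star_map (in_restr_hom f) p) =
  (in_map N \o star_map (in_restr_hom f))%VF p by rewrite comp_lfunE.
apply: inc_ext => b u; rewrite !comp_lfunE star_map_inc !in_mapE.
by have := @hom_rmap k in_quiver M N f (inr b) u.
Qed.

Section Extend.
Variables (U : rep k Q0) (W : vectType k).

Definition star_space (v : option (vertex Q0)) : vectType k :=
  if v is Some v then U v else W.

Definition out_rep (i : 'Hom(W, star U)) : rep k out_quiver :=
  @Rep k out_quiver star_space (fun a : arrow out_quiver =>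
    match a with
    | inl a => rmap U a
    | inr b => (pr (fun b => U (e b)) b \o i)%VF
    end).

Definition in_rep (q : 'Hom(star U, W)) : rep k in_quiver :=
  @Rep k in_quiver star_space (fun a : arrow in_quiver =>
    match a with
    | inl a => rmap U a
    | inr b => (q \o inc (fun b => U (e b)) b)%VF
    end).

Lemma out_map_rep i u : out_map (out_rep i) u = i u.
Proof.
apply: pr_inj => b; rewrite [LHS]out_mapE /= [LHS]comp_lfunE.
by [].
Qed.

Lemma in_map_rep q p : in_map (in_rep q) p = q p.
Proof.
apply: (inc_ext (f := in_map (in_rep q)) (g := q)) => b u.
by rewrite [LHS]in_mapE /= comp_lfunE.
Qed.

End Extend.

End StarQuivers.

Section Functionals.
Variables (k : fieldType) (V : vectType k).

Lemma functional_ex (u : V) : u != 0 -> exists f : 'Hom(V, k^o), f u != 0.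
Proof.
move=> u0; apply: NNPP => no; case/eqP: u0.
rewrite (coord_vbasis (memvf u)) big1 // => i _.
suff -> : coord (vbasis (fullv : {vspace V})) i u = 0 by rewrite scale0r.
apply/eqP; apply: contra_notT no => ui.
exists (linfun (coord (vbasis (fullv : {vspace V})) i : V -> k^o)).
by rewrite linfun_apply // => c x y; rewrite linearP.
Qed.

Lemma line_ex (u : V) : exists f : 'Hom(k^o, V), forall c : k, f c = c *: u.
Proof.
exists (linfun (fun c : k^o => (c : k) *: u)) => c.
by rewrite linfun_apply // => a x y; rewrite scalerDl scalerA.
Qed.

End Functionals.

Section Sincere.
Variables (k : fieldType) (Q : quiver).

(** Every [M] embeds in some [E] that is a quotient of a power of [T], so it vanishes wherever [T]
    does. Applied to a simple module, this shows that tilting modules are sincere. *)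
Lemma rigid_generator_sincere (T : rep k Q) v : rigid_generator T ->
  (forall u : T v, u = 0) -> forall (M : rep k Q) (u : M v), u = 0.
Proof.
move=> [TT T0] Tv M u.
have [n [E [i [p [i0 _ _ TE]]]]] := universal_extension M TT.
have [m [K [j [q [_ q1 _ _]]]]] := perp_approximation TT T0 TE.
apply: (i0 v); have [w <-] := q1 v (i v u).
suff -> : w = 0 by rewrite lfun0.
by apply/ffunP => l; rewrite ffunE; apply: Tv.
Qed.

Lemma rigid_generator_iso (M N : rep k Q) :
  iso M N -> rigid_generator M -> rigid_generator N.
Proof. by move/iso_same_indecomposables/same_indecomposables_tilt. Qed.

Lemma ext1_iso (M M' N N' : rep k Q) : iso M M' -> iso N N' ->
  ext1_vanish M N <-> ext1_vanish M' N'.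
Proof.
move=> MM NN; split=> MN.
  apply: ext1_retract_left (iso_retract (iso_sym MM)) _.
  exact: ext1_retract_right (iso_retract (iso_sym NN)) MN.
apply: ext1_retract_left (iso_retract MM) _.
exact: ext1_retract_right (iso_retract NN) MN.
Qed.

Lemma ext1_dsum_left (A B N : rep k Q) :
  ext1_vanish A N -> ext1_vanish B N -> ext1_vanish (dsum A B) N.
Proof. exact: ext1_middle_left (@dsum_exact k Q A B) _ (@inl_hom_mono k Q A B). Qed.

Lemma ext1_dsum_right (A B N : rep k Q) :
  ext1_vanish N A -> ext1_vanish N B -> ext1_vanish N (dsum A B).
Proof. exact: ext1_middle_right (@dsum_exact k Q A B) _ (@snd_hom_epi k Q A B). Qed.

End Sincere.

(** * Restriction and induction of tilting modules *)

Section StarTilting.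
Variables (k : fieldType) (Q0 : quiver) (B : finType) (e : B -> vertex Q0).

Notation outq := (out_quiver e).
Notation inq := (in_quiver e).

Lemma star_zero (U : vertex Q0 -> vectType k) :
  (forall v (u : U v), u = 0) -> forall p : star e U, p = 0.
Proof. by move=> U0 p; apply: pr_inj => b; rewrite lfun0; apply: U0. Qed.

Lemma star_map_zero (U U' : vertex Q0 -> vectType k)
    (f : forall v, 'Hom(U v, U' v)) p :
  (forall v u, f v u = 0) -> star_map e f p = 0.
Proof. by move=> f0; apply: pr_inj => b; rewrite star_mapE f0 lfun0. Qed.

Lemma star_map_id (U : vertex Q0 -> vectType k)
    (f : forall v, 'Hom(U v, U v)) p :
  (forall v u, f v u = u) -> star_map e f p = p.
Proof. by move=> f1; apply: pr_inj => b; rewrite star_mapE f1. Qed.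

Definition out_simple : rep k outq :=
  out_rep (U := zero_rep k Q0) (0 : 'Hom(k^o, star e (zero_rep k Q0))).
Definition in_simple : rep k inq :=
  in_rep (U := zero_rep k Q0) (0 : 'Hom(star e (zero_rep k Q0), k^o)).

Lemma star_zero_rep (p : star e (zero_rep k Q0)) : p = 0.
Proof. exact: (star_zero (@zero_repP k Q0)). Qed.

(* The new vertex of [out_quiver] is a source: [out_simple] is injective. *)
Lemma ext1_out_simple_target (N : rep k outq) : ext1_vanish N out_simple.
Proof.
apply/ext1_outP => g g1; exists (fun=> 0), 0; split=> [a u|u].
  exact: zero_rep_eq.
by rewrite [LHS]star_zero_rep [RHS]star_zero_rep.
Qed.

(** Ext^1(S, N) is the cokernel of [out_map N], a cochain being given by a vector of [star]. *)
Lemma ext1_out_simple_source (N : rep k outq) :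
  ext1_vanish out_simple N <-> forall p, exists x, out_map N x = p.
Proof.
split=> [/ext1_outP SN p|surj].
  have [l lE] := line_ex p.
  have [f [f1 [_ f1E]]] := SN (fun=> 0) l.
  exists (- f1 1); have := f1E 1; rewrite lE scale1r => ->.
  rewrite lfunN.
  have -> : out_map out_simple 1 = 0 by apply: star_zero_rep.
  by rewrite lfun0 sub0r.
apply/ext1_outP => g g1.
exists (fun=> 0), (- ((out_map N)^-1 \o g1))%VF; split=> [a u|u].
  by rewrite /delta !zero_lfunE lfun0 subr0 (@zero_repP k Q0 _ u) lfun0.
rewrite opp_lfunE lfunN opprK comp_lfunE lfun_inv_section //.
by rewrite star_map_zero ?add0r // => v w; rewrite zero_lfunE.
Qed.

Lemma out_simple_hom (N : rep k outq) (u : N None) : out_map N u = 0 ->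
  exists f : hom out_simple N, forall c : k, f None c = c *: u.
Proof.
move=> u0; have [l lE] := line_ex u.
have cond c : out_map N (l c) =
    star_map e (zero_hom (out_restr out_simple) (out_restr N)) (out_map out_simple c).
  by rewrite lE linearZ /= u0 scaler0 star_map_zero // => v w; rewrite zero_lfunE.
have [F [_ FN]] := out_hom_ex (M := out_simple) (f1 := l) cond.
by exists F => c; rewrite FN.
Qed.

Lemma out_simple_mono (N : rep k outq) (u : N None) : out_map N u = 0 ->
  u != 0 -> exists f : hom out_simple N, mono f.
Proof.
move=> /out_simple_hom[f fE] u0; exists f => -[v|] c.
  by move=> _; apply: zero_repP.
by rewrite fE => /eqP; rewrite scaler_eq0 (negPf u0) orbF => /eqP.
Qed.

Lemma ext1_in_simple_source (N : rep k inq) : ext1_vanish in_simple N.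
Proof.
apply/ext1_inP => g g1; exists (fun=> 0), 0; split=> [a u|p].
  by rewrite /delta !zero_lfunE lfun0 subr0 (@zero_repP k Q0 _ u) lfun0.
rewrite (star_zero_rep p) lfun0 zero_lfunE star_map_zero ?lfun0 ?subr0 //.
by move=> v w; rewrite zero_lfunE.
Qed.

(** Ext^1(N, S) is dual to the kernel of [in_map N], and linear functionals detect that kernel. *)
Lemma ext1_in_simple_target (N : rep k inq) :
  ext1_vanish N in_simple <-> forall p, in_map N p = 0 -> p = 0.
Proof.
split=> [/ext1_inP NS p qp|inj].
  apply/eqP; apply: contra_eqT (erefl (0 : k)) => /functional_ex[l lp].
  have [f [f1 [_ f1E]]] := NS (fun=> 0) l.
  case/eqP: lp; rewrite f1E qp lfun0.
  have -> : star_map e f p = 0 by apply: star_zero_rep.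
  by rewrite lfun0 subr0.
apply/ext1_inP => g g1.
exists (fun=> 0), (g1 \o (in_map N)^-1)%VF; split=> [a u|p].
  exact: zero_rep_eq.
rewrite comp_lfunE lfun_inv_retract // star_map_zero ?lfun0 ?subr0 //.
by move=> v w; rewrite zero_lfunE.
Qed.

Lemma in_simple_epi (N : rep k inq) (f : 'Hom(N None, k^o)) (y : N None) :
  (forall p, f (in_map N p) = 0) -> f y != 0 ->
  exists g : hom N in_simple, epi g.
Proof.
move=> fq fy.
have cond p : f (in_map N p) =
    in_map in_simple (star_map e (zero_hom (in_restr N) (in_restr in_simple)) p).
  by rewrite fq star_map_zero ?lfun0 // => v w; rewrite zero_lfunE.
have [F [_ FN]] := in_hom_ex (N := in_simple) (f1 := f) cond.
exists F => -[v|] c; first by exists 0; apply: zero_rep_eq.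
by exists (((c : k) / f y) *: y); rewrite FN linearZ /= -[LHS]/(_ * _) divfK.
Qed.

(* Extension to the new vertex by the product over its arrows: the right
   adjoint of restriction for a source, the left adjoint for a sink. *)
Definition out_coind (U : rep k Q0) : rep k outq :=
  out_rep (U := U) (\1%VF : 'Hom(star e U, star e U)).
Definition in_ind (U : rep k Q0) : rep k inq :=
  in_rep (U := U) (\1%VF : 'Hom(star e U, star e U)).

Lemma out_coind_map (U : rep k Q0) p : out_map (out_coind U) p = p.
Proof. by rewrite [LHS]out_map_rep id_lfunE. Qed.
Lemma in_ind_map (U : rep k Q0) p : in_map (in_ind U) p = p.
Proof. by rewrite [LHS]in_map_rep id_lfunE. Qed.

(** As [out_map (out_coind U)] is the identity, the equation at the new vertex can be solved for
    [f1] whatever [f] is. *)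
Lemma ext1_out_coind (M : rep k outq) (U : rep k Q0) :
  ext1_vanish M (out_coind U) <-> ext1_vanish (out_restr M) U.
Proof.
split=> [/ext1_outP MU g|MU].
  by have [f [_ [fE _]]] := MU g 0; exists f.
apply/ext1_outP => g g1; have [f fE] := MU g.
exists f, (star_map e f \o out_map M - g1)%VF; split=> [a u|u].
  exact: fE.
by rewrite out_coind_map !lfE subKr.
Qed.

Lemma ext1_in_ind (M : rep k inq) (U : rep k Q0) :
  ext1_vanish (in_ind U) M <-> ext1_vanish U (in_restr M).
Proof.
split=> [/ext1_inP MU g|MU].
  by have [f [_ [fE _]]] := MU g 0; exists f.
apply/ext1_inP => g g1; have [f fE] := MU g.
exists f, (g1 + (in_map M \o star_map e f))%VF; split=> [a u|u].
  exact: fE.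
by rewrite in_ind_map !lfE addrK.
Qed.

Lemma ext1_out_restr (M N : rep k outq) :
  ext1_vanish M N -> ext1_vanish (out_restr M) (out_restr N).
Proof. by move=> /ext1_outP MN g; have [f [_ [fE _]]] := MN g 0; exists f. Qed.
Lemma ext1_in_restr (M N : rep k inq) :
  ext1_vanish M N -> ext1_vanish (in_restr M) (in_restr N).
Proof. by move=> /ext1_inP MN g; have [f [_ [fE _]]] := MN g 0; exists f. Qed.

(** If [M] is perpendicular to the restriction, then [out_coind M] is perpendicular to [T], by
    adjunction for Hom and for Ext^1. *)
Lemma out_restr_tilt (T : rep k outq) :
  rigid_generator T -> rigid_generator (out_restr T).
Proof.
move=> [TT T0]; split=> [|M HM EM]; first exact: ext1_out_restr.
have : is_zero (out_coind M); last by move=> M0 v; apply: (M0 (Some v)).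
apply: T0; last exact/ext1_out_coind.
have r0 (f : hom T (out_coind M)) v u : f (Some v) u = 0.
  pose f' := @Hom k Q0 (out_restr T) M (fun v => f (Some v))
    (fun a u => @hom_rmap k outq T (out_coind M) f (inl a) u).
  exact: (HM f').
move=> f [v|] u; first exact: r0.
rewrite -[LHS]out_coind_map [LHS]out_hom_star.
by apply: star_map_zero => v w; apply: r0.
Qed.

(** At a sink the right adjoint of restriction is extension by zero; [in_ind] is the left
    adjoint. *)
Definition in_zero (U : rep k Q0) : rep k inq :=
  in_rep (U := U) (0 : 'Hom(star e U, 'rV[k]_0)).

Lemma in_restr_tilt (T : rep k inq) :
  rigid_generator T -> rigid_generator (in_restr T).
Proof.
move=> [TT T0]; split=> [|M HM EM]; first exact: ext1_in_restr.
have : is_zero (in_zero M); last by move=> M0 v; apply: (M0 (Some v)).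
have all0 (x : 'rV[k]_0) : x = 0 by apply/rowP => -[].
apply: T0 => [f [v|] u|].
- pose f' := @Hom k Q0 (in_restr T) M (fun v => f (Some v))
    (fun a u => @hom_rmap k inq T (in_zero M) f (inl a) u).
  exact: (HM f').
- exact: all0.
apply/ext1_inP => g g1; have [f fE] := EM g.
exists f, 0; split=> [a u|p]; first exact: fE.
by rewrite [LHS]all0 [RHS]all0.
Qed.

(** Perpendicularity to the simple summand makes [out_map N] bijective: Hom gives injectivity and
    Ext^1 surjectivity. Maps from [U] to the restriction of [N] then extend to [out_coind U], so
    this restriction is perpendicular to [U]. *)
Lemma out_coind_tilt (U : rep k Q0) : rigid_generator U ->
  rigid_generator (dsum out_simple (out_coind U)).
Proof.
move=> [UU U0]; split.
  apply: ext1_dsum_right; first exact: ext1_out_simple_target.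
  apply: ext1_dsum_left; last exact/ext1_out_coind.
  by apply/ext1_out_simple_source => p; exists p; rewrite out_coind_map.
move=> N HN EN.
have HS := hom_vanish_retract_left (retract_inl _ _) HN.
have HU := hom_vanish_retract_left (retract_inr _ _) HN.
have ES := ext1_retract_left (retract_inl _ _) EN.
have EU := ext1_retract_left (retract_inr _ _) EN.
have inj u : out_map N u = 0 -> u = 0.
  move=> /out_simple_hom[f fE].
  by have := HS f None (1 : k); rewrite fE scale1r.
have surj := (ext1_out_simple_source N).1 ES.
have N0 : is_zero (out_restr N).
  apply: U0 => [f v u|]; last exact: ext1_out_restr EU.
  pose f' := @Hom k Q0 (out_restr (out_coind U)) (out_restr N) (fun v => f v)
    (fun a u => @hom_rmap k Q0 U (out_restr N) f a u).
  pose f1 := ((out_map N)^-1 \o star_map e f)%VF.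
  have cond p : out_map N (f1 p) = star_map e f' (out_map (out_coind U) p).
    by rewrite out_coind_map comp_lfunE lfun_inv_section.
  have [F [FS _]] := out_hom_ex (M := out_coind U) (f1 := f1) cond.
  by have := HU F (Some v) u; rewrite FS.
move=> [v|] u; first exact: N0.
by apply: inj; apply: star_zero.
Qed.

(** At a sink Hom(S, N) is the space of [N] at the new vertex. Once it vanishes, maps from [U] to
    the restriction of [N] extend by zero. *)
Lemma in_ind_tilt (U : rep k Q0) : rigid_generator U ->
  rigid_generator (dsum in_simple (in_ind U)).
Proof.
move=> [UU U0]; split.
  apply: ext1_dsum_left; first exact: ext1_in_simple_source.
  apply: ext1_dsum_right; last exact/ext1_in_ind.
  by apply/ext1_in_simple_target => p; rewrite in_ind_map.
move=> N HN EN.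
have HS := hom_vanish_retract_left (retract_inl _ _) HN.
have HU := hom_vanish_retract_left (retract_inr _ _) HN.
have EU := ext1_retract_left (retract_inr _ _) EN.
have N0 (u : N None) : u = 0.
  have [l lE] := line_ex u.
  have cond p : l (in_map in_simple p) =
      in_map N (star_map e (zero_hom (in_restr in_simple) (in_restr N)) p).
    rewrite (star_zero_rep p) lfun0 lfun0 star_map_zero ?lfun0 // => v w.
    by rewrite zero_lfunE.
  have [F [_ FN]] := in_hom_ex (M := in_simple) (f1 := l) cond.
  by have := HS F None (1 : k); rewrite FN lE scale1r.
move=> [v|]; last exact: N0.
have : is_zero (in_restr N); last exact.
apply: U0 => [f w u|]; last exact: ext1_in_restr EU.
pose f' := @Hom k Q0 (in_restr (in_ind U)) (in_restr N) (fun v => f v)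
  (fun a u => @hom_rmap k Q0 U (in_restr N) f a u).
have cond p : (0 : 'Hom(in_ind U None, N None)) (in_map (in_ind U) p) =
    in_map N (star_map e f' p) by rewrite [LHS]N0 [RHS]N0.
have [F [FS _]] := in_hom_ex (M := in_ind U) cond.
by have := HU F (Some w) u; rewrite FS.
Qed.

(** A linear section of the surjection [out_map T] embeds [out_coind (out_restr T)] into [T], and
    the vanishing of Ext^1(-, T) passes to subrepresentations. *)
Lemma out_coind_restr_le (T : rep k outq) : rigid_generator T ->
  ext1_vanish out_simple T ->
  ext1_vanish (dsum out_simple (out_coind (out_restr T))) T.
Proof.
move=> [TT _] ST; apply: ext1_dsum_left => //.
have surj := (ext1_out_simple_source T).1 ST.
pose f := @Hom k Q0 (out_restr (out_coind (out_restr T))) (out_restr T)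
  (fun v => \1%VF) (fun a u => @hom_rmap k Q0 _ _ (id_hom (out_restr T)) a u).
have cond p : out_map T ((out_map T)^-1%VF p) =
    star_map e f (out_map (out_coind (out_restr T)) p).
  rewrite out_coind_map lfun_inv_section // star_map_id //.
  by move=> v u; rewrite id_lfunE.
have [F [FS FN]] := out_hom_ex (M := out_coind (out_restr T))
  (f1 := ((out_map T)^-1)%VF) cond.
apply: (ext1_mono (i := F)) TT => -[v|] u; first by rewrite FS /= id_lfunE.
rewrite FN => u0; have := cond u; rewrite u0 lfun0 out_coind_map.
by rewrite star_map_id // => v w; rewrite id_lfunE.
Qed.

(** Dually, a linear retraction of the injective [in_map T] makes [in_ind (in_restr T)] a quotient
    of [T]. *)
Lemma in_ind_restr_le (T : rep k inq) : rigid_generator T ->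
  ext1_vanish T in_simple ->
  ext1_vanish T (dsum in_simple (in_ind (in_restr T))).
Proof.
move=> [TT _] TS; apply: ext1_dsum_right => //.
have inj := (ext1_in_simple_target T).1 TS.
pose f := @Hom k Q0 (in_restr T) (in_restr (in_ind (in_restr T)))
  (fun v => \1%VF) (fun a u => @hom_rmap k Q0 _ _ (id_hom (in_restr T)) a u).
have cond p : (in_map T)^-1%VF (in_map T p) =
    in_map (in_ind (in_restr T)) (star_map e f p).
  rewrite in_ind_map lfun_inv_retract // star_map_id //.
  by move=> v u; rewrite id_lfunE.
have [F [FS FN]] := in_hom_ex (N := in_ind (in_restr T))
  (f1 := ((in_map T)^-1)%VF) cond.
apply: (ext1_epi (p := F)) TT => -[v|] u; first by exists u; rewrite FS /= id_lfunE.
by exists (in_map T u); rewrite FN lfun_inv_retract.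
Qed.

End StarTilting.

(** * Reflection of tilting modules *)

Section Reflection.
Variables (k : fieldType) (Q0 : quiver) (B : finType) (e : B -> vertex Q0).

Notation outq := (out_quiver e).
Notation inq := (in_quiver e).
Notation out_simple := (out_simple k e).
Notation in_simple := (in_simple k e).

(* A short exact sequence [0 -> X -> \prod_b U (e b) -> Y -> 0]: the
   representations [(U, X)] and [(U, Y)] of the two star quivers correspond to
   each other under the reflection functors. *)
Record reflection_data := ReflectionData {
  rd_base : rep k Q0;
  rd_ker : vectType k;
  rd_coker : vectType k;
  rd_in : 'Hom(rd_ker, star e rd_base);
  rd_out : 'Hom(star e rd_base, rd_coker);
  rd_mono : forall u, rd_in u = 0 -> u = 0;
  rd_epi : forall y, exists p, rd_out p = y;
  rd_exact : forall p, rd_out p = 0 <-> exists u, rd_in u = p }.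

Definition data_out (d : reflection_data) : rep k outq := out_rep (rd_in d).
Definition data_in (d : reflection_data) : rep k inq := in_rep (rd_out d).

(* The condition for the vanishing of [Ext^1] that is common to both sides. *)
Definition relative_ext (d d' : reflection_data) :=
  forall (g : forall a, 'Hom(rd_base d (src a), rd_base d' (tgt a)))
    (c : 'Hom(rd_ker d, rd_coker d')),
  exists f : (forall v, 'Hom(rd_base d v, rd_base d' v)),
  (forall a u, g a u = delta f u) /\
  (forall u, c u = rd_out d' (star_map e f (rd_in d u))).

(** The free component [f1] absorbs whatever lies in the image of [rd_in d'], so by exactness only
    the image of the equation under [rd_out d'] remains. *)
Lemma ext1_data_out d d' :
  ext1_vanish (data_out d) (data_out d') <-> relative_ext d d'.
Proof.
rewrite ext1_outP; split=> H g c.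
  have [f [f1 [fE f1E]]] := H g ((rd_out d')^-1 \o c)%VF.
  exists f; split=> // u.
  have := congr1 (rd_out d') (f1E u); rewrite [out_map (data_out d) u]out_map_rep.
  rewrite [out_map _ _]out_map_rep lfunB comp_lfunE lfun_inv_section; last exact: rd_epi.
  have -> : rd_out d' (rd_in d' (f1 u)) = 0 by apply/rd_exact; exists (f1 u).
  by rewrite subr0.
have [f [fE cE]] := H g (rd_out d' \o c)%VF.
exists f, ((rd_in d')^-1 \o (star_map e f \o rd_in d - c))%VF; split=> // u.
rewrite [out_map (data_out d) u]out_map_rep [out_map _ _]out_map_rep comp_lfunE.
rewrite lfun_inv_section; first by rewrite !lfE subKr.
by apply/rd_exact; rewrite !lfE lfunB -cE comp_lfunE subrr.
Qed.

(** Here [f1] is a free map on the cokernel, so only the restriction of the equation along [rd_in d]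
    remains. The minus signs reflect the exchanged terms of the equation at a sink. *)
Lemma ext1_data_in d d' :
  ext1_vanish (data_in d) (data_in d') <-> relative_ext d d'.
Proof.
rewrite ext1_inP; split=> H g c.
  have [f [f1 [fE f1E]]] := H g (- (c \o (rd_in d)^-1))%VF.
  exists f; split=> // u.
  have := f1E (rd_in d u); rewrite [in_map (data_in d) _]in_map_rep.
  rewrite [in_map _ _]in_map_rep opp_lfunE comp_lfunE lfun_inv_retract; last exact: rd_mono.
  have -> : rd_out d (rd_in d u) = 0 by apply/rd_exact; exists u.
  by rewrite lfun0 sub0r => /oppr_inj.
have [f [fE cE]] := H g (- (c \o rd_in d))%VF.
pose f2 := (c + (rd_out d' \o star_map e f))%VF.
exists f, (f2 \o (rd_out d)^-1)%VF; split=> // p.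
rewrite [in_map (data_in d) _]in_map_rep [in_map _ _]in_map_rep comp_lfunE.
rewrite lfun_inv_factor; first by rewrite !lfE addrK.
move=> w /rd_exact[u <-]; rewrite !lfE -cE opp_lfunE comp_lfunE.
exact: subrr.
Qed.

Lemma ext1_data d d' :
  ext1_vanish (data_out d) (data_out d') <->
  ext1_vanish (data_in d) (data_in d').
Proof. by rewrite ext1_data_out ext1_data_in. Qed.

(** On both sides a homomorphism is a map of the bases whose [star_map] sends the kernel of
    [rd_out d] into that of [rd_out d']; its component at the new vertex is then determined. *)
Lemma hom_data_out_in d d' :
  hom_vanish (data_out d) (data_out d') -> hom_vanish (data_in d) (data_in d').
Proof.
move=> H F.
pose f := @Hom k Q0 (out_restr (data_out d)) (out_restr (data_out d'))
  (fun v => F (Some v))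
  (fun a u => @hom_rmap k inq (data_in d) (data_in d') F (inl a) u).
have FN p : F None (rd_out d p) = rd_out d' (star_map e f p).
  by have := in_hom_star F p;
     rewrite [in_map (data_in d) _]in_map_rep [in_map _ _]in_map_rep.
pose f1 := ((rd_in d')^-1 \o (star_map e f \o rd_in d))%VF.
have cond u : out_map (data_out d') (f1 u) = star_map e f (out_map (data_out d) u).
  rewrite [out_map (data_out d') _]out_map_rep [out_map _ _]out_map_rep.
  rewrite comp_lfunE lfun_inv_section comp_lfunE //.
  apply/rd_exact; rewrite -FN.
  have -> : rd_out d (rd_in d u) = 0 by apply/rd_exact; exists u.
  by rewrite lfun0.
have [G [GS _]] := out_hom_ex (M := data_out d) (N := data_out d')
  (f1 := f1) cond.
have f0 v u : f v u = 0 by have := H G (Some v) u; rewrite GS.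
move=> [v|] u; first exact: f0.
have [p <-] := rd_epi u.
by rewrite FN star_map_zero ?lfun0.
Qed.

Lemma hom_data_in_out d d' :
  hom_vanish (data_in d) (data_in d') -> hom_vanish (data_out d) (data_out d').
Proof.
move=> H F.
pose f := @Hom k Q0 (in_restr (data_in d)) (in_restr (data_in d'))
  (fun v => F (Some v))
  (fun a u => @hom_rmap k outq (data_out d) (data_out d') F (inl a) u).
have FN u : rd_in d' (F None u) = star_map e f (rd_in d u).
  by have := out_hom_star F u;
     rewrite [out_map (data_out d') _]out_map_rep [out_map _ _]out_map_rep.
pose f2 := (rd_out d' \o star_map e f)%VF.
pose f1 := (f2 \o (rd_out d)^-1)%VF.
have cond p : f1 (in_map (data_in d) p) = in_map (data_in d') (star_map e f p).
  rewrite [in_map (data_in d) _]in_map_rep [in_map _ _]in_map_rep comp_lfunE.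
  rewrite lfun_inv_factor; first by rewrite comp_lfunE.
  move=> w /rd_exact[u <-]; rewrite comp_lfunE -FN; apply/rd_exact.
  by exists (F None u).
have [G [GS _]] := in_hom_ex (M := data_in d) (N := data_in d')
  (f1 := f1) cond.
have f0 v u : f v u = 0 by have := H G (Some v) u; rewrite GS.
move=> [v|] u; first exact: f0.
apply: (rd_mono (r := d')).
by rewrite FN star_map_zero.
Qed.

Section FromOut.
Variable M : rep k outq.

Lemma out_image_exact p : quot_proj (limg (out_map M)) p = 0 <->
  exists u, sub_incl (limg (out_map M)) u = p.
Proof.
rewrite quot_proj_eq0; split=> [pM|[u <-]]; last exact: sub_incl_mem.
by exists (sub_proj _ p); rewrite sub_projK.
Qed.

(* The quotient of [M] by its largest subrepresentation at the source. *)
Definition out_image : reflection_data :=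
  @ReflectionData (out_restr M) _ _ (sub_incl (limg (out_map M)))
    (quot_proj (limg (out_map M))) (@sub_incl_inj _ _ _)
    (@quot_proj_surj _ _ _) out_image_exact.

Lemma out_image_epi : exists f : hom M (data_out out_image), epi f.
Proof.
pose f := @Hom k Q0 (out_restr M) (out_restr (data_out out_image))
  (fun v => \1%VF) (fun a u => @hom_rmap k Q0 _ _ (id_hom (out_restr M)) a u).
pose f1 := (sub_proj (limg (out_map M)) \o out_map M)%VF.
have cond u : out_map (data_out out_image) (f1 u) = star_map e f (out_map M u).
  rewrite [LHS]out_map_rep comp_lfunE sub_projK ?memv_img ?memvf //.
  by rewrite star_map_id // => v w; rewrite id_lfunE.
have [F [FS FN]] := out_hom_ex (M := M) (N := data_out out_image)
  (f1 := f1) cond.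
exists F => -[v|] u; first by exists u; rewrite FS /= id_lfunE.
have /memv_imgP[w _ wE] := sub_incl_mem u.
exists w; rewrite FN comp_lfunE -wE; apply/eqP; rewrite -subr_eq0; apply/eqP.
by apply: sub_incl_inj; rewrite lfunB sub_projK ?sub_incl_mem ?subrr.
Qed.

(** The simple module at a source is injective, so the kernel of the quotient map splits off. As a
    quotient and a subrepresentation, the image inherits the vanishing of both Ext^1(T, -) and
    Hom(T, -). *)
Lemma out_image_mono : exists f : hom (data_out out_image) M, mono f.
Proof.
pose f := @Hom k Q0 (out_restr (data_out out_image)) (out_restr M)
  (fun v => \1%VF) (fun a u => @hom_rmap k Q0 _ _ (id_hom (out_restr M)) a u).
pose f1 := ((out_map M)^-1 \o sub_incl (limg (out_map M)))%VF.
have f1E u : out_map M (f1 u) = sub_incl (limg (out_map M)) u.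
  rewrite comp_lfunE lfun_inv_section //.
  by have /memv_imgP[w _ wE] := sub_incl_mem u; exists w.
have cond u : out_map M (f1 u) = star_map e f (out_map (data_out out_image) u).
  rewrite f1E [out_map (data_out out_image) u]out_map_rep star_map_id //.
  by move=> v w; rewrite id_lfunE.
have [F [FS FN]] := out_hom_ex (M := data_out out_image) (N := M)
  (f1 := f1) cond.
exists F => -[v|] u; first by rewrite FS /= id_lfunE.
by rewrite FN => u0; apply: sub_incl_inj; rewrite -f1E u0 lfun0.
Qed.

Lemma out_image_iso : (forall u, out_map M u = 0 -> u = 0) ->
  iso M (data_out out_image).
Proof.
move=> inj; have [f f1] := out_image_epi; have [g g0] := out_image_mono.
have g1 : epi g.
  apply: mono_dim_epi g0 _ => -[v|]; first exact: leqnn.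
  have := limg_dim_eq (f := out_map M) (U := fullv).
  rewrite (eqP (_ : lker (out_map M) == 0%VS)) => [/(_ (capv0 _)) <-|].
    by rewrite [X in (_ <= X)%N]dimvf /dim /=.
  rewrite -subv0; apply/subvP => u.
  by rewrite memv_ker memv0 => /eqP/inj->.
have [h hE] := mono_epi_inv g0 g1; apply: iso_sym.
by exists g, h.
Qed.

End FromOut.

Section FromIn.
Variable M : rep k inq.

Definition in_image_out : 'Hom(star e (in_restr M), subvs_of (limg (in_map M))) :=
  (sub_proj (limg (in_map M)) \o in_map M)%VF.

Lemma in_image_outE p : sub_incl _ (in_image_out p) = in_map M p.
Proof. by rewrite comp_lfunE sub_projK // memv_img ?memvf. Qed.

Lemma in_image_surj y : exists p, in_image_out p = y.
Proof.
have /memv_imgP[p _ pE] := sub_incl_mem y; exists p.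
by apply: (lfunB0_inj (@sub_incl_inj _ _ _)); rewrite in_image_outE.
Qed.

Lemma in_image_exact p : in_image_out p = 0 <->
  exists u, sub_incl (lker (in_map M)) u = p.
Proof.
split=> [p0|[u <-]].
  exists (sub_proj _ p); rewrite sub_projK // memv_ker.
  by rewrite -in_image_outE p0 lfun0.
apply: sub_incl_inj; rewrite in_image_outE; apply/eqP.
by rewrite -memv_ker sub_incl_mem.
Qed.

(* The subrepresentation of [M] generated by its restriction. *)
Definition in_image : reflection_data :=
  @ReflectionData (in_restr M) _ _ (sub_incl (lker (in_map M))) in_image_out
    (@sub_incl_inj _ _ _) in_image_surj in_image_exact.

Lemma in_image_mono : exists f : hom (data_in in_image) M, mono f.
Proof.
pose f := @Hom k Q0 (in_restr (data_in in_image)) (in_restr M)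
  (fun v => \1%VF) (fun a u => @hom_rmap k Q0 _ _ (id_hom (in_restr M)) a u).
have cond p : sub_incl (limg (in_map M)) (in_map (data_in in_image) p) =
    in_map M (star_map e f p).
  rewrite [in_map (data_in in_image) p]in_map_rep in_image_outE star_map_id //.
  by move=> v w; rewrite id_lfunE.
have [F [FS FN]] := in_hom_ex (M := data_in in_image) (N := M)
  (f1 := sub_incl (limg (in_map M))) cond.
exists F => -[v|] u; first by rewrite FS /= id_lfunE.
by rewrite FN; apply: sub_incl_inj.
Qed.

(** The simple module at a sink is projective, so the subrepresentation generated by the restriction
    is also a quotient. *)
Lemma in_image_epi : exists f : hom M (data_in in_image), epi f.
Proof.
pose f := @Hom k Q0 (in_restr M) (in_restr (data_in in_image))
  (fun v => \1%VF) (fun a u => @hom_rmap k Q0 _ _ (id_hom (in_restr M)) a u).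
have cond p : sub_proj (limg (in_map M)) (in_map M p) =
    in_map (data_in in_image) (star_map e f p).
  rewrite [RHS]in_map_rep star_map_id; first by rewrite comp_lfunE.
  by move=> v w; rewrite id_lfunE.
have [F [FS FN]] := in_hom_ex (M := M) (N := data_in in_image)
  (f1 := sub_proj (limg (in_map M))) cond.
exists F => -[v|] u; first by exists u; rewrite FS /= id_lfunE.
have [p <-] := in_image_surj u.
by exists (in_map M p); rewrite FN comp_lfunE.
Qed.

Lemma in_image_iso : (forall y, exists p, in_map M p = y) ->
  iso M (data_in in_image).
Proof.
move=> surj; have [g g0] := in_image_mono; apply: iso_sym.
have g1 : epi g.
  apply: mono_dim_epi g0 _ => -[v|]; first exact: leqnn.
  rewrite [X in (_ <= X)%N](dimvf (subvs_of (limg (in_map M)))).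
  apply: dimvS; apply/subvP => y _.
  by have [p <-] := surj y; rewrite memv_img ?memvf.
have [h hE] := mono_epi_inv g0 g1.
by exists g, h.
Qed.

End FromIn.

(** Otherwise [rd_out d] would be injective and [rd_ker d] zero, whereas a tilting module is nonzero
    at every vertex. *)
Lemma data_in_no_simple d : rigid_generator (data_out d) ->
  ~ ext1_vanish (data_in d) in_simple.
Proof.
move=> Td /ext1_in_simple_target inj.
have X0 (u : data_out d None) : u = 0.
  apply: (rd_mono (r := d)); apply: inj; rewrite [LHS]in_map_rep.
  by apply/rd_exact; exists u.
have /eqP := rigid_generator_sincere Td X0 (M := out_simple) (1 : k).
by rewrite oner_eq0.
Qed.

Lemma data_out_no_simple d : rigid_generator (data_in d) ->
  ~ ext1_vanish out_simple (data_out d).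
Proof.
move=> Td /ext1_out_simple_source surj.
have Y0 (u : data_in d None) : u = 0.
  have [p <-] := rd_epi u; have [x xE] := surj p.
  by apply/rd_exact; exists x; rewrite -xE [RHS]out_map_rep.
have /eqP := rigid_generator_sincere Td Y0 (M := in_simple) (1 : k).
by rewrite oner_eq0.
Qed.

(** Reflecting [in_image N] back shows that a perpendicular [N] lives at the new vertex only. If
    nonzero, it has the simple module as a quotient, which contradicts [data_in_no_simple]. *)
Lemma data_in_tilt d :
  rigid_generator (data_out d) -> rigid_generator (data_in d).
Proof.
move=> Td; have [TT T0] := Td; split; first exact/ext1_data.
move=> N HN EN.
have [i i0] := in_image_mono N; have [q q1] := in_image_epi N.
have N0 : is_zero (data_out (in_image N)).
  apply: T0; first exact/hom_data_in_out/(hom_vanish_mono i0 HN).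
  exact/ext1_data/(ext1_epi q1 EN).
have NS v (u : N (Some v)) : u = 0 by exact: (N0 (Some v) u).
move=> [v|] y; first exact: NS.
apply/eqP; apply: contra_notT (data_in_no_simple Td) => /functional_ex[f fy].
have [g g1] : exists g : hom N in_simple, epi g.
  apply: in_simple_epi fy => p.
  by rewrite (@star_zero k Q0 B e (in_restr N) NS p) !lfun0.
exact: ext1_epi g1 EN.
Qed.

(** Again a perpendicular [N] lives at the new vertex. If it is nonzero, any functional on
    [rd_ker d] yields a map to it, so [rd_ker d] is zero and Ext^1 into the simple module vanishes
    on the other side. *)
Lemma data_out_tilt d : rigid_generator (data_in d) ->
  ~ ext1_vanish (data_in d) in_simple -> rigid_generator (data_out d).
Proof.
move=> Td noS; have [TT T0] := Td; split; first exact/ext1_data.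
move=> N HN EN.
have [i i0] := out_image_mono N; have [q q1] := out_image_epi N.
have N0 : is_zero (data_in (out_image N)).
  apply: T0; first exact/hom_data_out_in/(hom_vanish_mono i0 HN).
  exact/ext1_data/(ext1_epi q1 EN).
have NS v (u : N (Some v)) : u = 0 by exact: (N0 (Some v) u).
move=> [v|] y; first exact: NS.
have [//|y0] := eqVneq y 0.
have X0 (u : data_out d None) : u = 0.
  apply/eqP; apply: contraT => /functional_ex[f fu].
  have [l lE] := line_ex y.
  have cond w : out_map N ((l \o f)%VF w) =
      star_map e (zero_hom (out_restr (data_out d)) (out_restr N))
        (out_map (data_out d) w).
    by rewrite [LHS](@star_zero k Q0 B e (out_restr N) NS)
       [RHS](@star_zero k Q0 B e (out_restr N) NS).
  have [F [_ FN]] := out_hom_ex (M := data_out d) (N := N)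
    (f1 := (l \o f)%VF) cond.
  have := HN F None u; rewrite FN comp_lfunE lE => /eqP.
  by rewrite scaler_eq0 (negPf fu) (negPf y0).
case: noS; apply/ext1_in_simple_target => p; rewrite [LHS]in_map_rep.
by move/rd_exact => [u <-]; rewrite [u]X0 lfun0.
Qed.

End Reflection.

(** * Relabelling and the main theorem *)

(** The inverse bijection provides the family only at [phi (psi j)], whence a transport; on the
    image it disappears because equality on [J] is decidable. *)
Lemma transport_family (I : Type) (J : eqType) (phi : I -> J) (F : J -> Type)
    (g : forall i, F (phi i)) : bijective phi ->
  exists g' : (forall j, F j), forall i, g' (phi i) = g i.
Proof.
case=> psi phiK psiK.
exists (fun j => eq_rect (phi (psi j)) F (g (psi j)) j (psiK j)) => i.
by move: (psiK (phi i)); rewrite phiK => E; rewrite eq_axiomK.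
Qed.

Section Casts.
Variable k : fieldType.

(** Transport as a linear map, so that it composes with others and moves past families by
    naturality. *)
Definition cast_lfun (V W : vectType k) (E : V = W) : 'Hom(V, W) :=
  match E in _ = W return 'Hom(V, W) with erefl => \1%VF end.

Lemma cast_lfunK (V W : vectType k) (E : V = W) :
  cancel (cast_lfun E) (cast_lfun (esym E)).
Proof. by case: W / E => u; rewrite /= !id_lfunE. Qed.
Lemma cast_lfunKV (V W : vectType k) (E : V = W) :
  cancel (cast_lfun (esym E)) (cast_lfun E).
Proof. by case: W / E => u; rewrite /= !id_lfunE. Qed.

Lemma cast_lfun_natural (I : Type) (V W : I -> vectType k)
    (f : forall i, 'Hom(V i, W i)) i j (E : i = j) u :
  f j (cast_lfun (congr1 V E) u) = cast_lfun (congr1 W E) (f i u).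
Proof. by case: j / E; rewrite /= !id_lfunE. Qed.

Lemma cast_lfun_natural_sym (I : Type) (V W : I -> vectType k)
    (f : forall i, 'Hom(V i, W i)) i j (E : i = j) u :
  f i (cast_lfun (esym (congr1 V E)) u) =
  cast_lfun (esym (congr1 W E)) (f j u).
Proof. by case: j / E u => u; rewrite /= !id_lfunE. Qed.

End Casts.

Section Relabel.
Variables (k : fieldType) (Q1 Q2 : quiver).
Variables (phiV : vertex Q1 -> vertex Q2) (phiA : arrow Q1 -> arrow Q2).
Hypotheses (phiV_bij : bijective phiV) (phiA_bij : bijective phiA).
Hypothesis phi_src : forall a, src (phiA a) = phiV (src a).
Hypothesis phi_tgt : forall a, tgt (phiA a) = phiV (tgt a).
Implicit Types M N : rep k Q2.

(** The incidence equations are only propositional, so the maps are conjugated by casts. *)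
Definition pull M : rep k Q1 :=
  @Rep k Q1 (fun v => M (phiV v)) (fun a =>
    cast_lfun (congr1 M (phi_tgt a)) \o
    (rmap M (phiA a) \o cast_lfun (esym (congr1 M (phi_src a)))))%VF.

Lemma pull_rmapE M a u : rmap (pull M) a u =
  cast_lfun (congr1 M (phi_tgt a))
    (rmap M (phiA a) (cast_lfun (esym (congr1 M (phi_src a))) u)).
Proof. by rewrite /= !comp_lfunE. Qed.

Lemma surj_V w : exists v, phiV v = w.
Proof. by case: phiV_bij => psi _ psiK; exists (psi w). Qed.
Lemma surj_A b : exists a, phiA a = b.
Proof. by case: phiA_bij => psi _ psiK; exists (psi b). Qed.

Lemma ext1_pull M N : ext1_vanish (pull M) (pull N) <-> ext1_vanish M N.
Proof.
split=> H g.
  have [f fE] := H (fun a => cast_lfun (congr1 N (phi_tgt a)) \o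
    (g (phiA a) \o cast_lfun (esym (congr1 M (phi_src a)))))%VF.
  have [f' f'E] := transport_family (F := fun w => 'Hom(M w, N w)) f phiV_bij.
  exists f' => b u; have [a ab] := surj_A b; case: b / ab u => u.
  have := fE a (cast_lfun (congr1 M (phi_src a)) u).
  rewrite !pull_rmapE !comp_lfunE cast_lfunK -!f'E.
  rewrite !(cast_lfun_natural f') !cast_lfunK -lfunB.
  move/(congr1 (cast_lfun (esym (congr1 N (phi_tgt a))))).
  by rewrite !cast_lfunK.
have [g' g'E] := transport_family (F := fun b => 'Hom(M (src b), N (tgt b)))
  (fun a => cast_lfun (esym (congr1 N (phi_tgt a))) \o
    (g a \o cast_lfun (congr1 M (phi_src a))))%VF phiA_bij.
have [f fE] := H g'.
exists (fun v => f (phiV v)) => a u; rewrite !pull_rmapE.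
have := fE (phiA a) (cast_lfun (esym (congr1 M (phi_src a))) u).
rewrite g'E !comp_lfunE cast_lfunKV (cast_lfun_natural f).
rewrite (cast_lfun_natural_sym f) -lfunB.
by move=> <-; rewrite cast_lfunKV.
Qed.

Lemma hom_vanish_pull M N :
  hom_vanish (pull M) (pull N) -> hom_vanish M N.
Proof.
move=> H f w u; have [v vw] := surj_V w; case: w / vw u => u.
pose f1 v : 'Hom(pull M v, pull N v) := f (phiV v).
have f1P a x : f1 (tgt a) (rmap (pull M) a x) = rmap (pull N) a (f1 (src a) x).
  rewrite !pull_rmapE /f1 (cast_lfun_natural f) hom_rmap.
  by rewrite (cast_lfun_natural_sym f).
exact: (H (Hom f1P)).
Qed.

Lemma pull_iso_ex (N1 : rep k Q1) : exists N, iso (pull N) N1.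
Proof.
have [sp spE] := transport_family (F := fun=> vectType k) (space N1) phiV_bij.
have [rm rmE] := transport_family (F := fun b => 'Hom(sp (src b), sp (tgt b)))
  (fun a => cast_lfun (esym (congr1 sp (phi_tgt a))) \o
    (cast_lfun (esym (spE (tgt a))) \o (rmap N1 a \o
      (cast_lfun (spE (src a)) \o cast_lfun (congr1 sp (phi_src a))))))%VF
  phiA_bij.
exists (@Rep k Q2 sp rm); set N := Rep _.
pose f v : 'Hom(pull N v, N1 v) := cast_lfun (spE v).
pose g v : 'Hom(N1 v, pull N v) := cast_lfun (esym (spE v)).
have pullE a u : rmap (pull N) a u = g (tgt a) (rmap N1 a (f (src a) u)).
  by rewrite pull_rmapE /= rmE !comp_lfunE !cast_lfunKV.
have fK v : cancel (f v) (g v) by apply: cast_lfunK.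
have gK v : cancel (g v) (f v) by apply: cast_lfunKV.
have fP a u : f (tgt a) (rmap (pull N) a u) = rmap N1 a (f (src a) u).
  by rewrite pullE gK.
have gP a u : g (tgt a) (rmap N1 a u) = rmap (pull N) a (g (src a) u).
  by rewrite pullE gK.
by exists (Hom fP), (Hom gP).
Qed.

Lemma pull_tilt M : rigid_generator M -> rigid_generator (pull M).
Proof.
move=> [MM M0]; split=> [|N1 H E]; first exact/ext1_pull.
have [N NN1] := pull_iso_ex N1.
have NM : is_zero N.
  apply: M0; last exact/ext1_pull/(ext1_retract_right (iso_retract NN1) E).
  exact: hom_vanish_pull (hom_vanish_retract_right (iso_retract NN1) H).
apply: zero_retract (iso_retract (iso_sym NN1)) _ => v; exact: NM.
Qed.

Lemma pull_tilt_ex (N1 : rep k Q1) : rigid_generator N1 ->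
  exists N, rigid_generator N /\ iso (pull N) N1.
Proof.
move=> N1t; have [N NN1] := pull_iso_ex N1.
have [EE E0] := rigid_generator_iso (iso_sym NN1) N1t.
exists N; split=> //; split=> [|M H E]; first exact/ext1_pull.
have PM : is_zero (pull M); last first.
  by move=> w u; have [v vw] := surj_V w; case: w / vw u; apply: PM.
apply: E0; last exact/ext1_pull.
move=> f v u.
have [f' f'E] := transport_family (F := fun w => 'Hom(N w, M w)) f phiV_bij.
have f'P b x : f' (tgt b) (rmap N b x) = rmap M b (f' (src b) x).
  have [a ab] := surj_A b; case: b / ab x => x.
  have := hom_rmap f (cast_lfun (congr1 N (phi_src a)) x).
  rewrite !pull_rmapE cast_lfunK -!f'E !(cast_lfun_natural f') cast_lfunK.
  move/(congr1 (cast_lfun (esym (congr1 M (phi_tgt a))))).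
  by rewrite !cast_lfunK.
by rewrite -f'E; exact: (H (Hom f'P)).
Qed.

Lemma pull_reflection (Z : Type) (leZ : Z -> Z -> Prop) r :
  poset_reflection (@rigid_generator k Q2) (@ext1_vanish k Q2) leZ r ->
  poset_reflection (@rigid_generator k Q1) (@ext1_vanish k Q1) leZ (pull \o r).
Proof.
move=> R; apply: (reflection_transfer R (@tilt_preorder k Q1)).
- exact: pull_tilt.
- by move=> M N _ _; rewrite ext1_pull.
move=> N1 N1t; have [N [Nt NN1]] := pull_tilt_ex N1t; exists N; split=> //.
  exact: ext1_retract_right (iso_retract NN1) N1t.1.
exact: ext1_retract_left (iso_retract NN1) N1t.1.
Qed.

End Relabel.

Section Height.
Variable Q : quiver.
Hypothesis Q_acyclic : acyclic Q.

Let edge : rel (vertex Q) := fun u v => [exists a, (src a == u) && (tgt a == v)].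
Let next : rel (arrow Q) := fun a b => tgt a == src b.

(** [acyclic] speaks of cycles of arrows, while [connect] produces paths of vertices. *)
Lemma arrow_path (a0 : arrow Q) p : path edge (tgt a0) p ->
  exists2 s, path next a0 s & tgt (last a0 s) = last (tgt a0) p.
Proof.
elim: p a0 => [|v p IH] a0 /=; first by exists nil.
case/andP=> /existsP[a /andP[/eqP sa /eqP ta]].
rewrite -ta => /IH[s s_path s_last].
by exists (a :: s); rewrite //= /next sa eqxx.
Qed.

(** The height counts the vertices with a path to [v]. It grows strictly along [a], since a path
    from [tgt a] back to [src a] would close a cycle. *)
Lemma acyclic_height :
  exists h : vertex Q -> nat, forall a, (h (src a) < h (tgt a))%N.
Proof.
exists (fun v => #|[set u | connect edge u v]|) => a.
have aE : edge (src a) (tgt a) by apply/existsP; exists a; rewrite !eqxx.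
apply: proper_card; apply/properP; split.
  apply/subsetP => u; rewrite !inE => /connect_trans; apply.
  exact: connect1.
exists (tgt a); rewrite !inE ?connect0 //; apply/negP => /connectP[p p_path p_last].
have [s s_path s_last] := arrow_path p_path.
case/negP: (@Q_acyclic (a :: s) isT).
by rewrite /= rcons_path s_path /= /next s_last -p_last.
Qed.

End Height.

Section Main.
Variables (k : fieldType) (Q0 : quiver) (B : finType) (e : B -> vertex Q0).

Definition matched_reps (T : rep k (out_quiver e)) (T' : rep k (in_quiver e)) :=
  exists d, iso T (data_out d) /\ iso T' (data_in d).

Lemma out_restr_iso (M N : rep k (out_quiver e)) :
  iso M N -> iso (out_restr M) (out_restr N).
Proof.
by case=> f [g fg]; exists (out_restr_hom f), (out_restr_hom g) => v;
   apply: (fg (Some v)).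
Qed.

Lemma in_restr_iso (M N : rep k (in_quiver e)) :
  iso M N -> iso (in_restr M) (in_restr N).
Proof.
by case=> f [g fg]; exists (in_restr_hom f), (in_restr_hom g) => v;
   apply: (fg (Some v)).
Qed.

(** If [out_map T] were not injective, the simple module would embed in [T], and Ext^1(T, T) = 0
    would force the excluded vanishing. *)
Lemma matched_left_ex (T : rep k (out_quiver e)) : rigid_generator T ->
  ~ ext1_vanish (out_simple k e) T -> exists T',
  [/\ rigid_generator T', ~ ext1_vanish T' (in_simple k e) & matched_reps T T'].
Proof.
move=> Tt noS; have Td : iso T (data_out (out_image T)).
  apply: out_image_iso => u Tu; have [//|u0] := eqVneq u 0.
  have [f f0] := out_simple_mono Tu u0.
  by case: noS; apply: ext1_mono f0 Tt.1.
have dt := rigid_generator_iso Td Tt.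
exists (data_in (out_image T)); split; first exact: data_in_tilt.
  exact: data_in_no_simple.
by exists (out_image T); split=> //; apply: iso_refl.
Qed.

(** If [in_map T] were not surjective, a functional on its cokernel would make the simple module a
    quotient of [T]. *)
Lemma matched_right_ex (T : rep k (in_quiver e)) : rigid_generator T ->
  ~ ext1_vanish T (in_simple k e) -> exists T',
  [/\ rigid_generator T', ~ ext1_vanish (out_simple k e) T' & matched_reps T' T].
Proof.
move=> Tt noS; have Td : iso T (data_in (in_image T)).
  apply: in_image_iso => y.
  have [/quot_proj_eq0/memv_imgP[p _ ->]|] :=
    eqVneq (quot_proj (limg (in_map T)) y) 0; first by exists p.
  move=> /functional_ex[f fy].
  have [|g g1] := @in_simple_epi k Q0 B e T (f \o quot_proj (limg (in_map T)))%VF y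
    _ ltac:(by rewrite comp_lfunE).
    move=> p; rewrite comp_lfunE.
    have /quot_proj_eq0-> : in_map T p \in limg (in_map T).
      by rewrite memv_img ?memvf.
    exact: lfun0.
  by case: noS; apply: ext1_epi g1 Tt.1.
have dt := rigid_generator_iso Td Tt.
have noSd : ~ ext1_vanish (data_in (in_image T)) (in_simple k e).
  by move=> dS; apply: noS; apply: ext1_retract_left (iso_retract Td) dS.
exists (data_out (in_image T)); split; first exact: data_out_tilt.
  exact: data_out_no_simple.
by exists (in_image T); split=> //; apply: iso_refl.
Qed.

Lemma matched_reps_restr (T : rep k (out_quiver e)) (T' : rep k (in_quiver e)) :
  rigid_generator T -> matched_reps T T' ->
  ext1_vanish (out_restr T) (in_restr T') /\
  ext1_vanish (in_restr T') (out_restr T).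
Proof.
move=> /out_restr_tilt[TT _] [d [/out_restr_iso Td /in_restr_iso T'd]].
have TT' : iso (out_restr T) (in_restr T') by apply: iso_trans Td (iso_sym T'd).
split; first exact: ext1_retract_right (iso_retract (iso_sym TT')) TT.
exact: ext1_retract_left (iso_retract (iso_sym TT')) TT.
Qed.

Lemma out_restr_coind (U : rep k Q0) : ext1_vanish U U ->
  ext1_vanish U (out_restr (dsum (out_simple k e) (out_coind e U))).
Proof.
pose S := out_simple k e; pose C := out_coind e U.
pose f := @Hom k Q0 U (out_restr (dsum S C)) (fun v => inr_hom S C (Some v))
  (fun a u => @hom_rmap k _ _ _ (inr_hom S C) (inl a) u).
apply: (ext1_epi (p := f)) => v [x y]; exists y; rewrite [LHS]inr_homE.
by congr pair; exact: (@zero_rep_eq k Q0 v).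
Qed.

Lemma in_restr_ind (U : rep k Q0) : ext1_vanish U U ->
  ext1_vanish (in_restr (dsum (in_simple k e) (in_ind e U))) U.
Proof.
pose S := in_simple k e; pose C := in_ind e U.
pose f := @Hom k Q0 (in_restr (dsum S C)) U (fun v => snd_hom S C (Some v))
  (fun a u => @hom_rmap k _ _ _ (snd_hom S C) (inl a) u).
apply: (ext1_mono (i := f)) => v [x y]; rewrite [f v _]snd_homE /= => ->.
by congr pair; exact: (@zero_rep_eq k Q0 v).
Qed.

Lemma star_flip_flop (Z Z' Y : Type) (leZ : Z -> Z -> Prop)
    (leZ' : Z' -> Z' -> Prop) (leY : Y -> Y -> Prop) r r' r0 :
  poset_reflection (@rigid_generator k (out_quiver e))
    (@ext1_vanish k (out_quiver e)) leZ r ->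
  poset_reflection (@rigid_generator k (in_quiver e))
    (@ext1_vanish k (in_quiver e)) leZ' r' ->
  poset_reflection (@rigid_generator k Q0) (@ext1_vanish k Q0) leY r0 ->
  related_by_flip_flop leZ leZ'.
Proof.
move=> RZ RZ' RY.
have out_trans := pre_trans (@tilt_preorder k (out_quiver e)).
have in_trans := pre_trans (@tilt_preorder k (in_quiver e)).
have restr_out_ext (T : rep k (out_quiver e)) (U : rep k Q0) :
    ext1_vanish T (dsum (out_simple k e) (out_coind e U)) <->
    ext1_vanish (out_restr T) U.
  split=> [TU|TU].
    exact/ext1_out_coind/(ext1_retract_right (retract_inr _ _) TU).
  by apply: ext1_dsum_right; [apply: ext1_out_simple_target|apply/ext1_out_coind].
have restr_in_ext (T : rep k (in_quiver e)) (U : rep k Q0) :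
    ext1_vanish (dsum (in_simple k e) (in_ind e U)) T <->
    ext1_vanish U (in_restr T).
  split=> [TU|TU].
    exact/ext1_in_ind/(ext1_retract_left (retract_inr _ _) TU).
  by apply: ext1_dsum_left; [apply: ext1_in_simple_source|apply/ext1_in_ind].
apply: (@flip_flop _ _ _ _ _ _ _ _ _ (@tilt_preorder k _) (@tilt_preorder k _)
  (@tilt_preorder k Q0) _ _ _ _ _ _ _ _ _ RZ RZ' RY
  (@out_restr k Q0 B e) (fun U => dsum (out_simple k e) (out_coind e U))
  (ext1_vanish (out_simple k e))
  (@out_restr_tilt k Q0 B e) (@out_coind_tilt k Q0 B e) _ _ _ _ _
  (@in_restr k Q0 B e) (fun U => dsum (in_simple k e) (in_ind e U))
  (fun T => ext1_vanish T (in_simple k e))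
  (@in_restr_tilt k Q0 B e) (@in_ind_tilt k Q0 B e) _ _ _ _ _
  matched_reps).
- by move=> T U _ _; apply: restr_out_ext.
- move=> U Ut; split; last exact: out_restr_coind Ut.1.
  by apply/restr_out_ext; apply: (out_coind_tilt e Ut).1.
- move=> U Ut; apply: ext1_retract_left (retract_inl _ _) _.
  exact: (out_coind_tilt e Ut).1.
- exact: out_coind_restr_le.
(* The simple module is not tilting by itself; transitivity is applied to the tilting module S + j_*
   j^* T below [T], of which it is a summand. *)
- move=> T T' Tt Tt' ST TT'.
  apply: ext1_retract_left (retract_inl _ (out_coind e (out_restr T))) _.
  apply: out_trans (out_coind_restr_le Tt ST) TT' => //.
  exact/out_coind_tilt/out_restr_tilt.
- by move=> T U _ _; apply: restr_in_ext.
- move=> U Ut; split; last exact: in_restr_ind Ut.1.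
  by apply/restr_in_ext; apply: (in_ind_tilt e Ut).1.
- move=> U Ut; apply: ext1_retract_right (retract_inl _ _) _.
  exact: (in_ind_tilt e Ut).1.
- exact: in_ind_restr_le.
- move=> T T' Tt Tt' TS T'T.
  apply: ext1_retract_right (retract_inl _ (in_ind e (in_restr T))) _.
  apply: in_trans T'T (in_ind_restr_le Tt TS) => //.
  exact/in_ind_tilt/in_restr_tilt.
- exact: matched_left_ex.
- exact: matched_right_ex.
- move=> T T' N N' _ _ _ _ [d [Td T'd]] [d' [Nd N'd]].
  by rewrite (ext1_iso Td Nd) (ext1_iso T'd N'd) ext1_data.
- by move=> T T' Tt _; apply: matched_reps_restr.
Qed.

End Main.

(** * A quiver with a source as a one-vertex extension *)

Section AtSource.
Variables (Q : quiver) (x : vertex Q).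
Hypothesis hx : is_source x.

Definition rest_vertex : finType := {v : vertex Q | v != x}.
Definition rest_arrow : finType := {a : arrow Q | src a != x}.
Definition out_arrow : finType := {a : arrow Q | src a == x}.

Definition rest_quiver : quiver :=
  @Quiver rest_vertex rest_arrow
    (fun a => exist _ (src (val a)) (valP a))
    (fun a => exist _ (tgt (val a)) (hx (val a))).
Definition out_end (b : out_arrow) : vertex rest_quiver :=
  exist _ (tgt (val b)) (hx (val b)).

Definition star_vertex (v : option rest_vertex) : vertex Q :=
  if v is Some v then val v else x.
Definition star_arrow (a : rest_arrow + out_arrow) : arrow Q :=
  match a with inl a => val a | inr b => val b end.

Lemma star_vertex_bij : bijective star_vertex.
Proof.
exists (fun v => insub v) => [[v|]|v] /=; first by rewrite valK.
  by rewrite insubN // negbK.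
by case: insubP => [u _ //|/negbNE/eqP->].
Qed.

Lemma star_arrow_bij : bijective star_arrow.
Proof.
apply: (@inj_card_bij _ _ star_arrow).
  move=> [a|b] [a'|b'] /= E; first by rewrite (val_inj E).
  - by case/negP: (svalP a); rewrite E; exact: (svalP b').
  - by case/negP: (svalP a'); rewrite -E; exact: (svalP b).
  - by rewrite (val_inj E).
rewrite card_sum !card_sig -(cardC (fun a : arrow Q => src a != x)) leq_add2l.
by apply: subset_leq_card; apply/subsetP => a; rewrite !inE negbK.
Qed.

Lemma out_star_src (a : arrow (out_quiver out_end)) :
  src (star_arrow a) = star_vertex (src a).
Proof. by case: a => [//|b]; apply/eqP; apply: (valP b). Qed.
Lemma out_star_tgt (a : arrow (out_quiver out_end)) :
  tgt (star_arrow a) = star_vertex (tgt a).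
Proof. by case: a. Qed.

Lemma in_star_src (a : arrow (in_quiver out_end)) :
  @src (reflection x) (star_arrow a) = star_vertex (src a).
Proof. by case: a => [a|b] /=; [rewrite (negPf (valP a))|rewrite (valP b)]. Qed.
Lemma in_star_tgt (a : arrow (in_quiver out_end)) :
  @tgt (reflection x) (star_arrow a) = star_vertex (tgt a).
Proof.
case: a => [a|b] /=; first by rewrite (negPf (valP a)).
by rewrite (valP b); apply/eqP; apply: (valP b).
Qed.

(** After reflection [x] is a sink, so it is placed above all other vertices. *)
Lemma reflection_height (h : vertex Q -> nat) :
  (forall a, (h (src a) < h (tgt a))%N) ->
  exists h' : vertex (reflection x) -> nat,
    forall a : arrow (reflection x), (h' (src a) < h' (tgt a))%N.
Proof.
move=> h_lt; exists (fun v => if v == x then (\max_w h w).+1 else h v) => a /=.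
have tx := negPf (hx a); case: (boolP (@src Q a == x)) => [sx|/negPf sx].
  by rewrite sx tx ltnS; apply: leq_bigmax.
by rewrite sx tx.
Qed.

End AtSource.

Theorem theorem1p1 (k : fieldType) (Q : quiver) (x : vertex Q)
    (hQ : acyclic Q) (hx : is_source x) :
  related_by_flip_flop (@tilting_le k Q) (@tilting_le k (reflection x)).
Proof.
have [h h_lt] := acyclic_height hQ.
have [h' h_lt'] := reflection_height hx h_lt.
have h_lt0 (a : arrow (rest_quiver hx)) :
    (h (val (src a)) < h (val (tgt a)))%N by apply: h_lt.
(* [Q] and its reflection are only isomorphic to star quivers over the rest of [Q], so both
   presentations are relabelled. *)
have R := pull_reflection (Q1 := out_quiver (@out_end Q x hx)) (Q2 := Q)
  (star_vertex_bij x) (star_arrow_bij x)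
  (out_star_src (hx := hx)) (out_star_tgt (hx := hx))
  (tilting_reflection k h_lt).
have R' := pull_reflection (Q1 := in_quiver (@out_end Q x hx))
  (Q2 := reflection x) (star_vertex_bij x) (star_arrow_bij x)
  (in_star_src (hx := hx)) (in_star_tgt (hx := hx))
  (tilting_reflection k h_lt').
have R0 := tilting_reflection k (Q := rest_quiver hx)
  (h := fun v => h (val v)) h_lt0.
exact: (star_flip_flop R R' R0).
Qed.
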